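(* Let $A_0(z)\not\equiv0,A_1(z),\dots,A_{k-1}(z)$ be analytic functions in $D(0,R)=\{z\in\mathbb{C}:0<|z|<R\}$ satisfying $0<\sigma(A_j,0)\le\sigma(A_0,0)<\infty$ $(j=1,\dots,k-1)$ and $$\max\{\tau_M(A_j,0):\sigma(A_j,0)=\sigma(A_0,0),\ j=1,\dots,k-1\}<\tau_M(A_0,0)$$ (a condition only on those $j\in\{1,\dots,k-1\}$ with $\sigma(A_j,0)=\sigma(A_0,0)$). Then every solution $f(z)\not\equiv0$ of $$f^{(k)}+A_{k-1}(z)f^{(k-1)}+\dots+A_1(z)f'+A_0(z)f=0$$ satisfies $\sigma_2(f,0)=\sigma(A_0,0)$.
   Context: For an analytic function $f$ in $D(0,R)=\{z\in\mathbb{C}:0<|z|<R\}$ let $M_0(r,f)=\max\{|f(z)|:|z|=r\}$. The order and the hyper-order (second iterated order) of $f$ near $0$ are $$\sigma(f,0)=\limsup_{r\to0}\frac{\log^+\log^+M_0(r,f)}{-\log r},\qquad \sigma_2(f,0)=\limsup_{r\to0}\frac{\log^+\log^+\log^+M_0(r,f)}{-\log r},$$ where $\log^+x=\max\{\log x,0\}$. If $0<\sigma(f,0)=\sigma<\infty$, the type of $f$ is $\tau_M(f,0)=\limsup_{r\to0}r^{\sigma}\log^+M_0(r,f)$. *)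

(* Defs.v *)
From Stdlib Require Import Reals.
From Coquelicot Require Import Coquelicot.
Open Scope R_scope.

Definition log_plus (x : R) : R := Rmax (ln x) 0.

(* limsup along the filter [F]: inf over members [P] of [F] of sup of [g] on [P]. *)
Definition LimSup {T : Type} (F : (T -> Prop) -> Prop) (g : T -> R) : Rbar :=
  Rbar_glb (fun y : Rbar => exists P : T -> Prop, F P /\
    y = Lub_Rbar (fun x : R => exists t : T, P t /\ x = g t)).

Definition punctured_disc (rho : R) (z : C) : Prop := 0 < Cmod z < rho.

(* Meant for open [D], where complex differentiability at every point is
   analyticity. *)
Definition analytic_on (D : C -> Prop) (f : C -> C) : Prop :=
  forall z : C, D z -> @ex_derive C_AbsRing C_NormedModule f z.

(* [C_derive] is a total function, taking a limit along horizontal lines; it is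
   the complex derivative where [f] is complex differentiable. *)
Definition C_derive_n (f : C -> C) (n : nat) : C -> C := Nat.iter n C_derive f.

(* The supremum is a maximum whenever [f] is continuous on the circle. *)
Definition max_modulus (f : C -> C) (r : R) : R :=
  real (Lub_Rbar (fun m : R => exists z : C, Cmod z = r /\ m = Cmod (f z))).

Definition order0 (f : C -> C) : Rbar :=
  LimSup (at_right 0) (fun r : R =>
    log_plus (log_plus (max_modulus f r)) / - ln r).

Definition hyper_order0 (f : C -> C) : Rbar :=
  LimSup (at_right 0) (fun r : R =>
    log_plus (log_plus (log_plus (max_modulus f r))) / - ln r).

(* Meaningful only when [order0 f] is finite and positive. *)
Definition type0 (f : C -> C) : Rbar :=
  LimSup (at_right 0) (fun r : R =>
    Rpower r (real (order0 f)) * log_plus (max_modulus f r)).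

(* f^(k) + A_(k-1) f^(k-1) + ... + A_1 f' + A_0 f = 0 on [D], for [1 <= k];
   [sum_n] includes its upper bound. *)
Definition linear_ode_solution (D : C -> Prop) (k : nat) (A : nat -> C -> C)
    (f : C -> C) : Prop :=
  analytic_on D f /\
  forall z : C, D z ->
    (C_derive_n f k z +
     @sum_n C_AbelianGroup (fun j : nat => A j z * C_derive_n f j z) (k - 1)
     = 0)%C.

(* Main.v *)
Require Import Defs.
From Stdlib Require Import Reals.
From Coquelicot Require Import Coquelicot.
From Stdlib Require Import Lra Lia Psatz Classical ClassicalEpsilon.
Open Scope R_scope.

(** Put [sigma = order0 (A 0)] and write [r = |z|].

Upper bound. Along a ray towards the origin the energy
[E = sum_(j < k) |f^(j)|^2] satisfies [E' >= - 2 k^2 B E], where [B] bounds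
the coefficients between the starting circle and the point reached
([ray_energy]). Since [B <= exp (r^(-c))] for each [c > sigma], integrating
inwards gives [log |f| <= exp (r^(-c'))] up to constants, whence
[hyper_order0 f <= sigma] ([growth_upper], [hyper_order_upper]).

Lower bound. Suppose that [log |f| <= exp (r^(-b))] near [0] for some
[b < sigma]. The hypotheses on orders and types give an exponent [a] with
[b < a <= sigma] and constants [beta < K] such that
[|A_j| <= exp (beta r^(-a))] for [j >= 1] near [0], while
[|A_0| >= exp (K r^(-a))] at points arbitrarily close to [0]
([growth_data]). Among these, [select_point] finds a point [z0] with
[|A_0 z0| = exp L] such that [|A_0| <= exp ((1 + eta) L)] on a disc
[D(z0, delta |z0|)]. So [|A_0| >= exp L / 2] on a disc of radius about
[exp (- eta L)], where moreover [|A_j| <= exp (theta L)] with [theta < 1].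

The equation solved for [A_0 f], with Cauchy's estimates for the derivatives
on discs of radius [k rho], [rho ~ exp (- (1 - theta) L / k)], shows that
[|f|] is at the centre at most [1 / e] times its supremum on the disc
([ode_contraction]). As this may be repeated about
[exp ((1 - theta) L / k - eta L)] times, [log |f|] lies below minus that
number on a disc around [z0] ([ode_local_smallness]). Such smallness spreads: a two-constants
estimate, derived from Cauchy's formula ([smallness_doubling]), applied
along a segment in the logarithmic coordinate [w = log z], carries it to a
fixed point where [f <> 0], at the cost of a factor of size
[exp (3 eta L)] times a power of [1 / r] and times the bound of [log |f|]
([smallness_to_point]). Since [L >= const r^(-a)] and [b < a], this is
impossible for small [r] ([growth_lower]).

The function theory needed is derived from Goursat's theorem on rectangles.
Integrals over circles are integrals of the pullback by the exponential over
vertical segments, so that Goursat's theorem and periodicity make them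
independent of the radius; Cauchy's formulas, the analyticity of the derivative
and Cauchy's estimates follow from this. *)

(** * Complex differentiability *)

(** Complex differentiability with an explicit remainder. On [C],
[is_derive] can be read with two normed module structures on the target
that have the same norm but are not convertible; this form is neutral between
them. *)
Definition cderiv (f : C -> C) (z l : C) : Prop :=
  forall eps : R, 0 < eps -> exists del : R, 0 < del /\
    forall w : C, Cmod (w - z)%C < del ->
      Cmod (f w - f z - (w - z) * l)%C <= eps * Cmod (w - z)%C.

Lemma cderiv_is_derive (f : C -> C) (z l : C) :
  cderiv f z l <-> @is_derive C_AbsRing C_NormedModule f z l.
Proof.
split.
- intros H; split.
  + apply is_linear_scal_l.
  + intros x Hx eps. 
    apply (@is_filter_lim_locally_unique C_AbsRing (AbsRing_NormedModule C_AbsRing)) in Hx. subst x.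
    destruct (H eps (cond_pos eps)) as [d [Hd Hw]].
    exists (mkposreal d Hd). intros w Hw'.
    apply (Hw w). exact Hw'.
- intros [_ H] eps Heps.
  assert (HH := H z (fun P HP => HP) (mkposreal eps Heps)).
  destruct HH as [d Hd]. exists d. split; [apply cond_pos|].
  intros w Hw. apply (Hd w Hw).
Qed.

(** The same for the target structure used by the product and chain
rules. *)
Lemma cderiv_is_derive_ring (f : C -> C) (z l : C) :
  cderiv f z l <-> @is_derive C_AbsRing (AbsRing_NormedModule C_AbsRing) f z l.
Proof.
split.
- intros H; split.
  + apply (@is_linear_scal_l C_AbsRing (AbsRing_NormedModule C_AbsRing)).
  + intros x Hx eps. 
    apply (@is_filter_lim_locally_unique C_AbsRing (AbsRing_NormedModule C_AbsRing)) in Hx. subst x.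
    destruct (H eps (cond_pos eps)) as [d [Hd Hw]].
    exists (mkposreal d Hd). intros w Hw'.
    apply (Hw w). exact Hw'.
- intros [_ H] eps Heps.
  assert (HH := H z (fun P HP => HP) (mkposreal eps Heps)).
  destruct HH as [d Hd]. exists d. split; [apply cond_pos|].
  intros w Hw. apply (Hd w Hw).
Qed.

Lemma cderiv_mult (f g : C -> C) (z l m : C) :
  cderiv f z l -> cderiv g z m ->
  cderiv (fun w => f w * g w)%C z (l * g z + f z * m)%C.
Proof.
intros Hf Hg. apply cderiv_is_derive_ring. apply cderiv_is_derive_ring in Hf. apply cderiv_is_derive_ring in Hg.
apply (@is_derive_mult C_AbsRing f g z l m Hf Hg). apply Cmult_comm.
Qed.

Lemma cderiv_plus (f g : C -> C) (z l m : C) :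
  cderiv f z l -> cderiv g z m ->
  cderiv (fun w => f w + g w)%C z (l + m)%C.
Proof.
intros Hf Hg. apply cderiv_is_derive. apply cderiv_is_derive in Hf. apply cderiv_is_derive in Hg.
apply (@is_derive_plus C_AbsRing C_NormedModule f g z l m Hf Hg).
Qed.

Lemma cderiv_comp (f g : C -> C) (z l m : C) :
  cderiv f (g z) l -> cderiv g z m ->
  cderiv (fun w => f (g w)) z (m * l)%C.
Proof.
intros Hf Hg. apply cderiv_is_derive. apply cderiv_is_derive in Hf. apply cderiv_is_derive_ring in Hg.
apply (@is_derive_comp C_AbsRing C_NormedModule f g z l m Hf Hg).
Qed.

Lemma cderiv_ext_loc (f g : C -> C) (z l : C) (d : R) : 0 < d ->
  (forall w, Cmod (w - z)%C < d -> f w = g w) -> cderiv f z l -> cderiv g z l.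
Proof.
intros Hd E H eps He. destruct (H eps He) as [d' [Hd' Hw]].
exists (Rmin d d'). split; [apply Rmin_glb_lt; auto|].
intros w Hww. assert (Cmod (w - z) < d)%R by (eapply Rlt_le_trans; [exact Hww|apply Rmin_l]).
assert (Cmod (w - z) < d')%R by (eapply Rlt_le_trans; [exact Hww|apply Rmin_r]).
rewrite <- (E w), <- (E z); auto.
replace (z - z)%C with (RtoC 0) by ring. rewrite Cmod_0. auto.
Qed.

Lemma cderiv_unique (f : C -> C) (z l : C) : cderiv f z l -> C_derive f z = l.
Proof. intros H. apply is_C_derive_unique. now apply cderiv_is_derive. Qed.

Lemma cderiv_const (c z : C) : cderiv (fun _ => c) z 0%C.
Proof.
intros eps He; exists 1; split; [lra|]. intros w _.
replace (c - c - (w - z) * 0)%C with (RtoC 0) by ring. rewrite Cmod_0.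
apply Rmult_le_pos; [lra|apply Cmod_ge_0].
Qed.

Lemma cderiv_id (z : C) : cderiv (fun w => w) z 1%C.
Proof.
intros eps He; exists 1; split; [lra|]. intros w _.
replace (w - z - (w - z) * 1)%C with (RtoC 0) by ring. rewrite Cmod_0.
apply Rmult_le_pos; [lra|apply Cmod_ge_0].
Qed.

Lemma cderiv_eq (f : C -> C) (z l l' : C) : l = l' -> cderiv f z l -> cderiv f z l'.
Proof. now intros ->. Qed.

Lemma Cmod_sub_sym (z w : C) : Cmod (z - w)%C = Cmod (w - z)%C.
Proof. replace (z - w)%C with (- (w - z))%C by ring. apply Cmod_opp. Qed.

Lemma Cmod_triangle_sub (x y : C) : Cmod (x - y)%C <= Cmod x + Cmod y.
Proof. unfold Cminus. eapply Rle_trans; [apply Cmod_triangle|]. rewrite Cmod_opp. lra. Qed.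

Lemma Cmod_triangle_rev (x y : C) : Cmod x - Cmod y <= Cmod (x - y)%C.
Proof.
assert (H := Cmod_triangle (x - y)%C y). replace (x - y + y)%C with x in H by ring. lra.
Qed.

Lemma cderiv_inv (z : C) : z <> 0%C -> cderiv (fun w => / w)%C z (- / (z * z))%C.
Proof.
intros Hz eps He.
assert (Hm : 0 < Cmod z) by now apply Cmod_gt_0.
set (m := Cmod z) in *.
exists (Rmin (m / 2) (eps * (m * m * m) / 2)). split.
{ apply Rmin_glb_lt; [lra|]. apply Rmult_lt_0_compat; [|lra]. repeat apply Rmult_lt_0_compat; lra. }
intros w Hw.
assert (H1 : Cmod (w - z) < m / 2) by (eapply Rlt_le_trans; [exact Hw|apply Rmin_l]).
assert (H2 : Cmod (w - z) < eps * (m * m * m) / 2) by (eapply Rlt_le_trans; [exact Hw|apply Rmin_r]).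
assert (H3 : m / 2 <= Cmod w).
{ assert (H := Cmod_triangle_rev z w). rewrite Cmod_sub_sym in H. fold m in H. lra. }
assert (Hw0 : w <> 0%C) by (apply Cmod_gt_0; lra).
replace (/ w - / z - (w - z) * - / (z * z))%C with ((w - z) * (w - z) / (w * (z * z)))%C
  by (field; auto).
rewrite Cmod_div by (repeat apply Cmult_neq_0; auto). rewrite !Cmod_mult. fold m.
set (h := Cmod (w - z)) in *.
assert (0 <= h) by apply Cmod_ge_0.
apply Rmult_le_reg_r with (Cmod w * (m * m)). { repeat apply Rmult_lt_0_compat; lra. }
unfold Rdiv. rewrite Rmult_assoc, Rinv_l, Rmult_1_r by (apply Rgt_not_eq; repeat apply Rmult_lt_0_compat; lra).
assert (m / 2 * (m * m) <= Cmod w * (m * m)).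
{ apply Rmult_le_compat_r; [|lra]. apply Rmult_le_pos; lra. }
replace (eps * h * (Cmod w * (m * m))) with (h * (eps * (Cmod w * (m * m)))) by ring.
apply Rmult_le_compat_l; [lra|].
assert (eps * (m / 2 * (m * m)) <= eps * (Cmod w * (m * m))) by (apply Rmult_le_compat_l; lra).
nra.
Qed.

Definition ccont (f : C -> C) (z : C) : Prop :=
  forall eps : R, 0 < eps -> exists del : R, 0 < del /\
    forall w : C, Cmod (w - z)%C < del -> Cmod (f w - f z)%C < eps.

Lemma cderiv_cont (f : C -> C) (z l : C) : cderiv f z l -> ccont f z.
Proof.
intros H eps He. destruct (H 1 Rlt_0_1) as [d [Hd Hw]].
assert (0 <= Cmod l) by apply Cmod_ge_0.
exists (Rmin d (eps / (2 + Cmod l))). split.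
{ apply Rmin_glb_lt; auto. apply Rdiv_lt_0_compat; lra. }
intros w Hww.
assert (H1 : Cmod (w - z) < d) by (eapply Rlt_le_trans; [exact Hww|apply Rmin_l]).
assert (H2 : Cmod (w - z) < eps / (2 + Cmod l)) by (eapply Rlt_le_trans; [exact Hww|apply Rmin_r]).
specialize (Hw w H1).
replace (f w - f z)%C with ((f w - f z - (w - z) * l) + (w - z) * l)%C by ring.
eapply Rle_lt_trans; [apply Cmod_triangle|]. rewrite Cmod_mult.
assert (Cmod (w - z) * (2 + Cmod l) < eps).
{ apply Rlt_div_r in H2; lra. }
assert (0 <= Cmod (w - z)) by apply Cmod_ge_0. 
destruct (Req_dec (Cmod (w - z)) 0) as [E|E]; [rewrite E in *; lra|nra].
Qed.

Lemma ex_derive_cderiv (f : C -> C) (z : C) :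
  @ex_derive C_AbsRing C_NormedModule f z <-> exists l, cderiv f z l.
Proof.
split; intros [l H]; exists l; now apply cderiv_is_derive.
Qed.

Lemma ccont_const (c z : C) : ccont (fun _ => c) z.
Proof. eapply cderiv_cont. apply cderiv_const. Qed.

Lemma Cmult_close (x y : C) (e : R) : 0 < e -> exists eta, 0 < eta /\
  forall x' y', Cmod (x' - x)%C < eta -> Cmod (y' - y)%C < eta -> Cmod (x' * y' - x * y)%C < e.
Proof.
intros He. set (A := 1 + Cmod x + Cmod y).
assert (Ax := Cmod_ge_0 x). assert (Ay := Cmod_ge_0 y).
exists (Rmin 1 (e / (2 * A))). split.
{ apply Rmin_glb_lt; [lra|]. unfold A. apply Rdiv_lt_0_compat; lra. }
intros x' y' Hx Hy.
assert (G1 := Rlt_le_trans _ _ _ Hx (Rmin_l _ _)). assert (G2 := Rlt_le_trans _ _ _ Hx (Rmin_r _ _)).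
assert (G4 := Rlt_le_trans _ _ _ Hy (Rmin_r _ _)).
replace (x' * y' - x * y)%C with ((x' - x) * (y' - y) + ((x' - x) * y + x * (y' - y)))%C by ring.
set (a := Cmod (x' - x)) in *. set (b := Cmod (y' - y)) in *.
assert (0 <= a) by apply Cmod_ge_0. assert (0 <= b) by apply Cmod_ge_0.
eapply Rle_lt_trans; [apply Cmod_triangle|]. rewrite Cmod_mult. fold a b.
eapply Rle_lt_trans; [apply Rplus_le_compat_l, Cmod_triangle|]. rewrite !Cmod_mult. fold a b.
apply Rlt_div_r in G2; [|unfold A; lra]. apply Rlt_div_r in G4; [|unfold A; lra].
apply Rle_lt_trans with (b + a * Cmod y + Cmod x * b); [nra|]. unfold A in *. nra.
Qed.

Lemma ccont_mult (g h : C -> C) (z : C) : ccont g z -> ccont h z -> ccont (fun w => g w * h w)%C z.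
Proof.
intros Hg Hh e He. destruct (Cmult_close (g z) (h z) e He) as [eta [Heta H]].
destruct (Hg eta Heta) as [d [Hd Hg']]. destruct (Hh eta Heta) as [d' [Hd' Hh']].
exists (Rmin d d'); split; [apply Rmin_glb_lt; auto|]. intros w Hw.
apply H; [apply Hg'|apply Hh']; (eapply Rlt_le_trans; [exact Hw|]); [apply Rmin_l|apply Rmin_r].
Qed.

Lemma ccont_plus (g h : C -> C) (z : C) : ccont g z -> ccont h z -> ccont (fun w => g w + h w)%C z.
Proof.
intros Hg Hh e He. destruct (Hg (e/2)) as [d [Hd Hg']]; [lra|]. destruct (Hh (e/2)) as [d' [Hd' Hh']]; [lra|].
exists (Rmin d d'); split; [apply Rmin_glb_lt; auto|]. intros w Hw.
specialize (Hg' w (Rlt_le_trans _ _ _ Hw (Rmin_l _ _))). specialize (Hh' w (Rlt_le_trans _ _ _ Hw (Rmin_r _ _))).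
replace (g w + h w - (g z + h z))%C with ((g w - g z) + (h w - h z))%C by ring.
eapply Rle_lt_trans; [apply Cmod_triangle|]. lra.
Qed.

(** * Bisection of rectangles and integrals of complex-valued functions *)

(** The supremum of the left endpoints lies in all intervals. *)
Lemma nested_intervals (a w : nat -> R) :
  (forall n, 0 <= w n) -> (forall n, a n <= a (S n)) ->
  (forall n, a (S n) + w (S n) <= a n + w n) ->
  exists u, forall n, a n <= u <= a n + w n.
Proof.
intros Hw Ha Hb.
assert (Ha' : forall n m, a n <= a (n + m)%nat).
{ intros n m; induction m; [rewrite Nat.add_0_r; lra|]. rewrite Nat.add_succ_r. specialize (Ha (n + m)%nat); lra. }
assert (Hb' : forall n m, a (n + m)%nat + w (n + m)%nat <= a n + w n).
{ intros n m; induction m; [rewrite Nat.add_0_r; lra|]. rewrite Nat.add_succ_r. specialize (Hb (n + m)%nat); lra. }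
assert (Hab : forall n m, a n <= a m + w m).
{ intros n m. specialize (Ha' n m). specialize (Hb' m n). rewrite Nat.add_comm in Hb'.
  specialize (Hw (n + m)%nat). lra. }
destruct (completeness (fun x => exists n, x = a n)) as [u [Hu1 Hu2]].
- exists (a O + w O). intros x [n ->]. apply Hab.
- exists (a O). now exists O.
- exists u. intros n; split.
  + apply Hu1. now exists n.
  + apply Hu2. intros x [m ->]. apply Hab.
Qed.

Lemma pow_half_lt (d : R) : 0 < d -> exists n, (/ 2) ^ n < d.
Proof.
intros Hd. destruct (pow_lt_1_zero (/ 2)) with (y := d) as [n Hn].
- rewrite Rabs_pos_eq; lra.
- auto.
- exists n. specialize (Hn n (Nat.le_refl n)). rewrite Rabs_pos_eq in Hn; auto.
  apply pow_le; lra.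
Qed.

(** Compactness of a rectangle as an induction over cells. A cell has
corner [(x, y)] and sides [h p], [h q], so all cells are similar to the whole
rectangle: this bounds the squared perimeter of a cell by a multiple of [h^2], the
quantity that adds up under subdivision in Goursat's theorem. If the property failed for the rectangle it would fail for a nested sequence of
quarters, contradicting its validity for small cells around their common point. *)
Lemma bisection_principle (p q x0 y0 : R) (P : R -> R -> R -> Prop) :
  0 <= p -> 0 <= q ->
  (forall x y h, 0 < h ->
     P x y (h / 2) -> P (x + h / 2 * p) y (h / 2) ->
     P x (y + h / 2 * q) (h / 2) -> P (x + h / 2 * p) (y + h / 2 * q) (h / 2) -> P x y h) ->
  (forall u v, x0 <= u <= x0 + p -> y0 <= v <= y0 + q ->
     exists del, 0 < del /\ forall x y h, 0 < h < del ->
       x <= u <= x + h * p -> y <= v <= y + h * q -> 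
       x0 <= x -> x + h * p <= x0 + p -> y0 <= y -> y + h * q <= y0 + q -> P x y h) ->
  P x0 y0 1.
Proof.
intros Hp Hq Hstep Hloc. apply NNPP. intros HnP.
set (ch := fun (h : R) (s : R * R) =>
  let (x, y) := s in
  if excluded_middle_informative (~ P x y (h / 2)) then (x, y) else
  if excluded_middle_informative (~ P (x + h / 2 * p) y (h / 2)) then (x + h / 2 * p, y) else
  if excluded_middle_informative (~ P x (y + h / 2 * q) (h / 2)) then (x, y + h / 2 * q) else
  (x + h / 2 * p, y + h / 2 * q)).
set (s := fix s n := match n with O => (x0, y0) | S n => ch ((/ 2) ^ n) (s n) end).
assert (Hpos : forall n, 0 < (/ 2) ^ n) by (intros; apply pow_lt; lra).
assert (Hh : forall n, (/ 2) ^ (S n) = (/ 2) ^ n / 2) by (intros; simpl; lra).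
assert (Hinv : forall n,
  ~ P (fst (s n)) (snd (s n)) ((/ 2) ^ n)).
{ induction n; [exact HnP|].
  change (s (S n)) with (ch ((/ 2) ^ n) (s n)). rewrite Hh.
  destruct (s n) as [x y]. simpl fst in *; simpl snd in *. unfold ch.
  destruct excluded_middle_informative as [H1|H1]; [exact H1|].
  destruct excluded_middle_informative as [H2|H2]; [exact H2|].
  destruct excluded_middle_informative as [H3|H3]; [exact H3|].
  simpl. intros H4. apply NNPP in H1, H2, H3. apply IHn. now apply Hstep. }
assert (Hx : forall n, fst (s n) <= fst (s (S n)) /\ 
   fst (s (S n)) + (/ 2) ^ (S n) * p <= fst (s n) + (/ 2) ^ n * p /\
   snd (s n) <= snd (s (S n)) /\ 
   snd (s (S n)) + (/ 2) ^ (S n) * q <= snd (s n) + (/ 2) ^ n * q).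
{ intros n. change (s (S n)) with (ch ((/ 2) ^ n) (s n)). rewrite Hh.
  specialize (Hpos n). destruct (s n) as [x y]. set (h := (/ 2) ^ n) in *. unfold ch.
  assert (0 <= h * p) by (apply Rmult_le_pos; lra).
  assert (0 <= h * q) by (apply Rmult_le_pos; lra).
  repeat destruct excluded_middle_informative; simpl; lra. }
destruct (nested_intervals (fun n => fst (s n)) (fun n => (/ 2) ^ n * p)) as [u Hu].
{ intros n; apply Rmult_le_pos; auto. left; auto. }
{ intros n; apply Hx. } { intros n; apply Hx. }
destruct (nested_intervals (fun n => snd (s n)) (fun n => (/ 2) ^ n * q)) as [v Hv].
{ intros n; apply Rmult_le_pos; auto. left; auto. }
{ intros n; apply Hx. } { intros n; apply Hx. }
assert (Hbig : forall n, x0 <= fst (s n) /\ fst (s n) + (/ 2) ^ n * p <= x0 + p /\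
   y0 <= snd (s n) /\ snd (s n) + (/ 2) ^ n * q <= y0 + q).
{ induction n; [simpl; lra|]. specialize (Hx n). lra. }
destruct (Hloc u v) as [d [Hd HP]].
{ specialize (Hu O). simpl in Hu. lra. } { specialize (Hv O). simpl in Hv. lra. }
destruct (pow_half_lt d Hd) as [n Hn].
apply (Hinv n). apply HP; auto; apply Hbig.
Qed.

Definition rcont (g : R -> C) (t : R) : Prop :=
  forall eps : R, 0 < eps -> exists del : R, 0 < del /\
    forall s : R, Rabs (s - t) < del -> Cmod (g s - g t)%C < eps.

Lemma ccont_rcont (f : C -> C) (g : R -> C) (t : R) :
  ccont f (g t) -> rcont g t -> rcont (fun s => f (g s)) t.
Proof.
intros Hf Hg eps He. destruct (Hf eps He) as [d [Hd Hf']].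
destruct (Hg d Hd) as [d' [Hd' Hg']]. exists d'. split; auto.
Qed.

Lemma im_le_Cmod (c : C) : Rabs (snd c) <= Cmod c.
Proof. eapply Rle_trans; [|apply Rmax_Cmod]. apply Rmax_r. Qed.

Lemma fst_le_Cmod (c : C) : Rabs (fst c) <= Cmod c.
Proof. eapply Rle_trans; [|apply Rmax_Cmod]. apply Rmax_l. Qed.

Lemma Cmod_le_sum (c : C) : Cmod c <= Rabs (fst c) + Rabs (snd c).
Proof.
assert (H : c = (RtoC (fst c) + Ci * RtoC (snd c))%C).
{ destruct c; unfold RtoC, Ci, Cplus, Cmult; simpl; f_equal; ring. }
rewrite H at 1. eapply Rle_trans; [apply Cmod_triangle|].
rewrite Cmod_mult, Cmod_Ci, !Cmod_R. lra.
Qed.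

Lemma continuous_R_eps (f : R -> R) (t : R) :
  (forall eps, 0 < eps -> exists del, 0 < del /\ forall s, Rabs (s - t) < del -> Rabs (f s - f t) < eps) ->
  continuous f t.
Proof.
intros H. apply continuity_pt_filterlim. intros eps He. destruct (H eps He) as [d [Hd Hs]].
exists d. split; auto. intros x [_ Hx]. apply Hs, Hx.
Qed.

Lemma rcont_continuous (g : R -> C) (t : R) : rcont g t ->
  continuous (fun s => fst (g s)) t /\ continuous (fun s => snd (g s)) t.
Proof.
intros H; split; apply continuous_R_eps; intros eps He; destruct (H eps He) as [d [Hd Hs]];
 exists d; (split; [exact Hd|]); intros s Hss; (eapply Rle_lt_trans; [|exact (Hs s Hss)]).
- apply (fst_le_Cmod (g s - g t)%C).
- apply (im_le_Cmod (g s - g t)%C).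
Qed.

Definition cont_on (g : R -> C) (a b : R) : Prop := forall t, a <= t <= b -> rcont g t.

(** Integrating the real and imaginary parts separately reduces linearity over
[C] to identities between real integrals. *)
Definition CInt (g : R -> C) (a b : R) : C :=
  (RInt (fun t => fst (g t)) a b, RInt (fun t => snd (g t)) a b).

Lemma cont_on_ex_RInt (g : R -> C) (a b : R) : a <= b -> cont_on g a b ->
  ex_RInt (fun t => fst (g t)) a b /\ ex_RInt (fun t => snd (g t)) a b.
Proof.
intros Hab H; split; apply (@ex_RInt_continuous R_CompleteNormedModule); 
 rewrite Rmin_left, Rmax_right by auto; intros t Ht; now apply rcont_continuous, H.
Qed.

Lemma CInt_ext (g h : R -> C) (a b : R) : a <= b -> (forall t, a <= t <= b -> g t = h t) ->
  CInt g a b = CInt h a b.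
Proof.
intros Hab H; unfold CInt; f_equal; apply RInt_ext; rewrite Rmin_left, Rmax_right by auto;
 intros t Ht; rewrite H; auto; lra.
Qed.

Lemma CInt_Chasles (g : R -> C) (a b c : R) : a <= b -> b <= c -> cont_on g a c ->
  (CInt g a b + CInt g b c)%C = CInt g a c.
Proof.
intros Hab Hbc H.
destruct (cont_on_ex_RInt g a b) as [E1 E2]; auto. { intros t Ht; apply H; lra. }
destruct (cont_on_ex_RInt g b c) as [E3 E4]; auto. { intros t Ht; apply H; lra. }
unfold CInt, Cplus; simpl. f_equal; apply (@RInt_Chasles R_CompleteNormedModule); auto.
Qed.

Lemma CInt_plus (g h : R -> C) (a b : R) : a <= b -> cont_on g a b -> cont_on h a b ->
  CInt (fun t => g t + h t)%C a b = (CInt g a b + CInt h a b)%C.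
Proof.
intros Hab Hg Hh.
destruct (cont_on_ex_RInt g a b Hab Hg). destruct (cont_on_ex_RInt h a b Hab Hh).
unfold CInt, Cplus; simpl. f_equal; apply (@RInt_plus R_CompleteNormedModule); auto.
Qed.

Lemma CInt_mult (c : C) (g : R -> C) (a b : R) : a <= b -> cont_on g a b ->
  CInt (fun t => c * g t)%C a b = (c * CInt g a b)%C.
Proof.
intros Hab Hg.
destruct (cont_on_ex_RInt g a b Hab Hg) as [E1 E2].
unfold CInt, Cmult; simpl.
assert (S1 : forall k, ex_RInt (fun t => k * fst (g t)) a b).
{ intros k. apply (@ex_RInt_scal R_NormedModule); auto. }
assert (S2 : forall k, ex_RInt (fun t => k * snd (g t)) a b).
{ intros k. apply (@ex_RInt_scal R_NormedModule); auto. }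
assert (R1 : forall k, RInt (fun t => k * fst (g t)) a b = k * RInt (fun t => fst (g t)) a b).
{ intros k. exact (@RInt_scal R_CompleteNormedModule _ a b k E1). }
assert (R2 : forall k, RInt (fun t => k * snd (g t)) a b = k * RInt (fun t => snd (g t)) a b).
{ intros k. exact (@RInt_scal R_CompleteNormedModule _ a b k E2). }
f_equal.
- etransitivity; [exact (@RInt_minus R_CompleteNormedModule _ _ a b (S1 (fst c)) (S2 (snd c)))|].
  now rewrite R1, R2.
- etransitivity; [exact (@RInt_plus R_CompleteNormedModule _ _ a b (S2 (fst c)) (S1 (snd c)))|].
  now rewrite R1, R2.
Qed.

Lemma CInt_const (c : C) (a b : R) : CInt (fun _ => c) a b = (RtoC (b - a) * c)%C.
Proof.
unfold CInt. rewrite !RInt_const. unfold scal; simpl; unfold mult; simpl.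
unfold Cmult, RtoC; simpl. f_equal; ring.
Qed.

Lemma rcont_const (c : C) (t : R) : rcont (fun _ => c) t.
Proof.
intros e He; exists 1; split; [lra|]; intros. replace (c - c)%C with (RtoC 0) by ring. now rewrite Cmod_0.
Qed.

Lemma rcont_mult (g h : R -> C) (t : R) : rcont g t -> rcont h t -> rcont (fun s => g s * h s)%C t.
Proof.
intros Hg Hh e He. destruct (Cmult_close (g t) (h t) e He) as [eta [Heta H]].
destruct (Hg eta Heta) as [d [Hd Hg']]. destruct (Hh eta Heta) as [d' [Hd' Hh']].
exists (Rmin d d'); split; [apply Rmin_glb_lt; auto|]. intros s Hs.
apply H; [apply Hg'|apply Hh']; (eapply Rlt_le_trans; [exact Hs|]); [apply Rmin_l|apply Rmin_r].
Qed.

(** Multiplying [g] by the conjugate of its integral [I] makes the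
integral equal to [|I|^2], which the real part of the integrand bounds by
[|I| M (b - a)]. *)
Lemma Cmod_CInt_le (g : R -> C) (a b M : R) : a <= b -> cont_on g a b ->
  (forall t, a <= t <= b -> Cmod (g t) <= M) -> Cmod (CInt g a b) <= M * (b - a).
Proof.
intros Hab Hg HM. set (I := CInt g a b).
assert (HM0 : 0 <= M). { eapply Rle_trans; [apply Cmod_ge_0|apply (HM a); lra]. }
destruct (Req_dec (Cmod I) 0) as [E|E].
{ rewrite E. apply Rmult_le_pos; lra. }
assert (Hp : 0 < Cmod I) by (assert (H := Cmod_ge_0 I); lra).
set (h := fun t => (Cconj I * g t)%C).
assert (Hh : cont_on h a b). { intros t Ht. apply rcont_mult; auto. apply rcont_const. }
assert (Hfst : fst (CInt h a b) = Cmod I ^ 2).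
{ unfold h. rewrite CInt_mult by auto. fold I. rewrite Cmult_comm. 
  rewrite <- Cmod2_conj. reflexivity. }
destruct (cont_on_ex_RInt h a b Hab Hh) as [E1 _].
assert (Hpt : forall t, a <= t <= b -> fst (h t) <= Cmod I * M).
{ intros t Ht. eapply Rle_trans; [apply Rle_abs|]. eapply Rle_trans; [apply fst_le_Cmod|].
  unfold h. rewrite Cmod_mult, Cmod_conj. apply Rmult_le_compat_l; [lra|]. apply HM; lra. }
assert (Hle : fst (CInt h a b) <= Cmod I * M * (b - a)).
{ replace (Cmod I * M * (b - a)) with (RInt (fun _ => Cmod I * M) a b).
  2:{ rewrite RInt_const. apply Rmult_comm. }
  apply RInt_le; auto. { apply ex_RInt_const. } intros t Ht. apply Hpt. lra. }
rewrite Hfst in Hle. apply Rmult_le_reg_l with (Cmod I); auto. 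
replace (Cmod I * (M * (b - a))) with (Cmod I * M * (b - a)) by ring. 
replace (Cmod I * Cmod I) with (Cmod I ^ 2) by ring. exact Hle.
Qed.

(** * Goursat's theorem on rectangles *)

(** The integral over the boundary, counterclockwise. *)
Definition rect_int (F : C -> C) (a b c d : R) : C :=
  (CInt (fun x => F (x, c)) a b - CInt (fun x => F (x, d)) a b +
   Ci * (CInt (fun y => F (b, y)) c d - CInt (fun y => F (a, y)) c d))%C.

Definition cont_rect (F : C -> C) (a b c d : R) : Prop :=
  forall x y, a <= x <= b -> c <= y <= d -> ccont F (x, y).

Lemma rcont_hor (y t : R) : rcont (fun x => (x, y)) t.
Proof.
intros e He; exists e; split; auto. intros s Hs.
replace ((s, y) - (t, y))%C with (RtoC (s - t)). { now rewrite Cmod_R. }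
unfold RtoC, Cminus, Cplus, Copp; simpl; f_equal; ring.
Qed.

Lemma rcont_ver (x t : R) : rcont (fun y => (x, y)) t.
Proof.
intros e He; exists e; split; auto. intros s Hs.
replace ((x, s) - (x, t))%C with (Ci * RtoC (s - t))%C. { now rewrite Cmod_mult, Cmod_Ci, Cmod_R, Rmult_1_l. }
unfold RtoC, Cminus, Cplus, Copp, Cmult, Ci; simpl; f_equal; ring.
Qed.

Lemma cont_rect_hor F a b c d y : cont_rect F a b c d -> c <= y <= d ->
  cont_on (fun x => F (x, y)) a b.
Proof. intros H Hy t Ht. apply (ccont_rcont F (fun x => (x, y))). { now apply H. } apply rcont_hor. Qed.

Lemma cont_rect_ver F a b c d x : cont_rect F a b c d -> a <= x <= b ->
  cont_on (fun y => F (x, y)) c d.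
Proof. intros H Hy t Ht. apply (ccont_rcont F (fun y => (x, y))). { now apply H. } apply rcont_ver. Qed.

Lemma rect_int_split_x F a m b c d : a <= m <= b -> c <= d -> cont_rect F a b c d ->
  (rect_int F a m c d + rect_int F m b c d)%C = rect_int F a b c d.
Proof.
intros Hm Hcd H. unfold rect_int.
rewrite <- (CInt_Chasles (fun x => F (x, c)) a m b), <- (CInt_Chasles (fun x => F (x, d)) a m b);
 try lra; try (apply (cont_rect_hor F a b c d); auto; lra). ring.
Qed.

Lemma rect_int_split_y F a b c m d : a <= b -> c <= m <= d -> cont_rect F a b c d ->
  (rect_int F a b c m + rect_int F a b m d)%C = rect_int F a b c d.
Proof.
intros Hm Hcd H. unfold rect_int.
rewrite <- (CInt_Chasles (fun y => F (a, y)) c m d), <- (CInt_Chasles (fun y => F (b, y)) c m d);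
 try lra; try (apply (cont_rect_ver F a b c d); auto; lra). ring.
Qed.

Lemma rect_int_plus F G a b c d : a <= b -> c <= d -> cont_rect F a b c d -> cont_rect G a b c d ->
  rect_int (fun w => F w + G w)%C a b c d = (rect_int F a b c d + rect_int G a b c d)%C.
Proof.
intros Hab Hcd HF HG. unfold rect_int.
rewrite !CInt_plus; auto; try (eapply cont_rect_hor; [eassumption|lra]); try (eapply cont_rect_ver; [eassumption|lra]).
ring.
Qed.

Lemma cont_rect_sub F a b c d a' b' c' d' : cont_rect F a b c d -> a <= a' -> b' <= b -> c <= c' -> d' <= d ->
  cont_rect F a' b' c' d'.
Proof. intros H ? ? ? ? x y Hx Hy. apply H; lra. Qed.

(** The contributions of opposite sides cancel. *)
Lemma rect_int_affine (A B : C) a b c d : a <= b -> c <= d ->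
  rect_int (fun w => A + B * w)%C a b c d = 0%C.
Proof.
intros Hab Hcd. unfold rect_int.
rewrite !CInt_plus, !CInt_mult, !CInt_const; auto;
 try (intros t Ht; apply rcont_const); try (intros t Ht; apply rcont_hor); try (intros t Ht; apply rcont_ver);
 try (intros t Ht; apply rcont_mult; [apply rcont_const|apply rcont_hor || apply rcont_ver]).
unfold CInt; simpl. rewrite !RInt_const. unfold scal; simpl; unfold mult; simpl.
destruct A as [A1 A2], B as [B1 B2].
unfold RtoC, Cminus, Cplus, Copp, Cmult, Ci; simpl; f_equal; ring.
Qed.

Lemma rect_int_bound F a b c d M : a <= b -> c <= d -> cont_rect F a b c d ->
  (forall x y, a <= x <= b -> c <= y <= d -> Cmod (F (x, y)) <= M) ->
  Cmod (rect_int F a b c d) <= 2 * M * ((b - a) + (d - c)).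
Proof.
intros Hab Hcd HF HM. unfold rect_int.
assert (H1 : Cmod (CInt (fun x => F (x, c)) a b) <= M * (b - a)).
{ apply Cmod_CInt_le; auto. { apply (cont_rect_hor F a b c d); auto; lra. } intros; apply HM; lra. }
assert (H2 : Cmod (CInt (fun x => F (x, d)) a b) <= M * (b - a)).
{ apply Cmod_CInt_le; auto. { apply (cont_rect_hor F a b c d); auto; lra. } intros; apply HM; lra. }
assert (H3 : Cmod (CInt (fun y => F (b, y)) c d) <= M * (d - c)).
{ apply Cmod_CInt_le; auto. { apply (cont_rect_ver F a b c d); auto; lra. } intros; apply HM; lra. }
assert (H4 : Cmod (CInt (fun y => F (a, y)) c d) <= M * (d - c)).
{ apply Cmod_CInt_le; auto. { apply (cont_rect_ver F a b c d); auto; lra. } intros; apply HM; lra. }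
eapply Rle_trans; [apply Cmod_triangle|]. rewrite Cmod_mult, Cmod_Ci.
eapply Rle_trans; [apply Rplus_le_compat; [apply Cmod_triangle_sub|apply Rmult_le_compat_l; [lra|apply Cmod_triangle_sub]]|].
lra.
Qed.

Lemma cont_rect_affine (A B : C) a b c d : cont_rect (fun w => A + B * w)%C a b c d.
Proof.
intros x y _ _. eapply cderiv_cont. apply cderiv_plus; [apply cderiv_const|].
apply cderiv_mult; [apply cderiv_const|apply cderiv_id].
Qed.

(** By bisection, it is enough that on small cells of scale [h] the integral
is at most [eps h^2]. Near a point of differentiability [F] is affine, with zero
integral, up to a remainder [o(h)], and the perimeter is of order [h]. *)
Lemma goursat F a b c d : a <= b -> c <= d ->
  (forall x y, a <= x <= b -> c <= y <= d -> exists l, cderiv F (x, y) l) ->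
  rect_int F a b c d = 0%C.
Proof.
intros Hab Hcd HF.
assert (Hcont : cont_rect F a b c d).
{ intros x y Hx Hy. destruct (HF x y Hx Hy) as [l Hl]. now apply cderiv_cont with l. }
set (p := b - a). set (q := d - c).
assert (Hp : 0 <= p) by (unfold p; lra). assert (Hq : 0 <= q) by (unfold q; lra).
assert (Hall : forall eps, 0 < eps -> Cmod (rect_int F a b c d) <= eps).
{ intros eps He.
  set (P := fun x y h => a <= x -> x + h * p <= b -> c <= y -> y + h * q <= d ->
     Cmod (rect_int F x (x + h * p) y (y + h * q)) <= eps * (h * h)).
  assert (HP : P a c 1).
  { apply (bisection_principle p q); auto.
    - intros x y h Hh P1 P2 P3 P4 X1 X2 Y1 Y2.
      assert (Hhp : 0 <= h / 2 * p) by (apply Rmult_le_pos; lra).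
      assert (Hhq : 0 <= h / 2 * q) by (apply Rmult_le_pos; lra).
      assert (Ep : h * p = h / 2 * p + h / 2 * p) by field.
      assert (Eq : h * q = h / 2 * q + h / 2 * q) by field.
      set (p' := h / 2 * p) in *. set (q' := h / 2 * q) in *.
      assert (Hc' : cont_rect F x (x + h * p) y (y + h * q)) by (apply (cont_rect_sub F a b c d); auto).
      rewrite <- (rect_int_split_x F x (x + p') (x + h * p) y (y + h * q)); try lra; auto.
      rewrite <- (rect_int_split_y F x (x + p') y (y + q') (y + h * q)); try lra.
      2:{ apply (cont_rect_sub F a b c d); auto; lra. }
      rewrite <- (rect_int_split_y F (x + p') (x + h * p) y (y + q') (y + h * q)); try lra.
      2:{ apply (cont_rect_sub F a b c d); auto; lra. }
      replace (x + h * p) with (x + p' + p') by lra. replace (y + h * q) with (y + q' + q') by lra.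
      assert (Q1 := P1 ltac:(lra) ltac:(fold p'; lra) ltac:(lra) ltac:(fold q'; lra)).
      assert (Q2 := P2 ltac:(lra) ltac:(fold p'; lra) ltac:(lra) ltac:(fold q'; lra)).
      assert (Q3 := P3 ltac:(lra) ltac:(fold p'; lra) ltac:(lra) ltac:(fold q'; lra)).
      assert (Q4 := P4 ltac:(lra) ltac:(fold p'; lra) ltac:(lra) ltac:(fold q'; lra)).
      fold p' q' in Q1, Q2, Q3, Q4.
      eapply Rle_trans; [apply Cmod_triangle|].
      eapply Rle_trans; [apply Rplus_le_compat; apply Cmod_triangle|]. 
      replace (eps * (h * h)) with (4 * (eps * (h / 2 * (h / 2)))) by field. lra.
    - intros u v Hu Hv. replace (a + p) with b in * by (unfold p; ring). replace (c + q) with d in * by (unfold q; ring).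
      destruct (HF u v Hu Hv) as [l Hl].
      set (S := p + q). assert (HS : 0 <= S) by (unfold S; lra).
      (* A cell of scale h has diameter at most h S and semiperimeter h S, and the bound of the boundary integral carries a factor 2. *)
      destruct (Hl (eps / (2 * (S * S) + 1))) as [del [Hdel Hw]]. { apply Rdiv_lt_0_compat; nra. }
      set (e := eps / (2 * (S * S) + 1)) in *.
      assert (He' : 0 <= e) by (unfold e; apply Rlt_le, Rdiv_lt_0_compat; nra).
      exists (del / (S + 1)). split; [apply Rdiv_lt_0_compat; lra|].
      intros x y h Hh Hx Hy X1 X2 Y1 Y2 _ _ _ _.
      assert (Hhp : 0 <= h * p) by (apply Rmult_le_pos; lra).
      assert (Hhq : 0 <= h * q) by (apply Rmult_le_pos; lra).
      assert (Hhdel : h * S < del).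
      { destruct Hh as [Hh1 Hh2]. apply Rlt_div_r in Hh2; [|lra]. nra. }
      set (z := (u, v) : C) in *.
      set (A := fun w => (F z - l * z + l * w)%C).
      set (G := fun w => (F w + - (1) * A w)%C).
      assert (HcF : cont_rect F x (x + h * p) y (y + h * q)) by (apply (cont_rect_sub F a b c d); auto).
      assert (HcA : cont_rect A x (x + h * p) y (y + h * q)) by apply cont_rect_affine.
      assert (HcG : cont_rect G x (x + h * p) y (y + h * q)).
      { intros s t Hs Ht. unfold G. destruct (HF s t) as [l' Hl']; [lra|lra|].
        eapply cderiv_cont. apply cderiv_plus; [exact Hl'|]. apply cderiv_mult; [apply cderiv_const|].
        apply cderiv_plus; [apply cderiv_const|]. apply cderiv_mult; [apply cderiv_const|apply cderiv_id]. }
      assert (E : rect_int F x (x + h * p) y (y + h * q) = rect_int G x (x + h * p) y (y + h * q)).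
      { transitivity (rect_int (fun w => G w + A w)%C x (x + h * p) y (y + h * q)).
        - unfold rect_int. f_equal; [f_equal|f_equal; f_equal]; apply CInt_ext; try lra; intros; unfold G; ring.
        - rewrite rect_int_plus by (auto; lra). unfold A at 1. rewrite rect_int_affine by lra. ring. }
      rewrite E. eapply Rle_trans; [apply (rect_int_bound G) with (M := e * (h * S)); auto; try lra|].
      { intros s t Hs Ht.
        assert (Hst : Cmod ((s, t) - z)%C <= h * S).
        { eapply Rle_trans; [apply Cmod_le_sum|]. simpl. unfold S.
          assert (Rabs (s + - u) <= h * p) by (apply Rabs_le; lra).
          assert (Rabs (t + - v) <= h * q) by (apply Rabs_le; lra). lra. }
        replace (G (s, t)) with (F (s, t) - F z - ((s, t) - z) * l)%C by (unfold G, A; ring).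
        eapply Rle_trans; [apply Hw; lra|]. apply Rmult_le_compat_l; auto. }
      replace (x + h * p - x + (y + h * q - y)) with (h * S) by (unfold S; ring).
      replace (2 * (e * (h * S)) * (h * S)) with (e * (2 * (S * S)) * (h * h)) by ring.
      apply Rmult_le_compat_r; [nra|]. 
      assert (e * (2 * (S * S) + 1) = eps) by (unfold e; field; nra). nra. }
  unfold P in HP. replace (a + 1 * p) with b in HP by (unfold p; ring). replace (c + 1 * q) with d in HP by (unfold q; ring).
  specialize (HP ltac:(lra) ltac:(lra) ltac:(lra) ltac:(lra)). lra. }
apply Cmod_eq_0. apply Rle_antisym; [|apply Cmod_ge_0].
apply Rnot_lt_le; intros Hpos. specialize (Hall (Cmod (rect_int F a b c d) / 2)). lra.
Qed.

Lemma cont_rect_bounded F a b c d : a <= b -> c <= d -> cont_rect F a b c d ->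
  exists M, forall x y, a <= x <= b -> c <= y <= d -> Cmod (F (x, y)) <= M.
Proof.
intros Hab Hcd Hcont. set (p := b - a). set (q := d - c).
set (P := fun x y h => exists M, forall s t, x <= s <= x + h * p -> y <= t <= y + h * q -> Cmod (F (s, t)) <= M).
assert (HP : P a c 1).
{ apply (bisection_principle p q); [unfold p; lra|unfold q; lra| |].
  - intros x y h Hh [M1 H1] [M2 H2] [M3 H3] [M4 H4].
    exists (Rmax (Rmax M1 M2) (Rmax M3 M4)). intros s t Hs Ht.
    destruct (Rle_dec s (x + h / 2 * p)); destruct (Rle_dec t (y + h / 2 * q)).
    + eapply Rle_trans; [apply H1; lra|]. eapply Rle_trans; [apply Rmax_l|apply Rmax_l].
    + eapply Rle_trans; [apply H3; lra|]. eapply Rle_trans; [|apply Rmax_r]. apply Rmax_l.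
    + eapply Rle_trans; [apply H2; lra|]. eapply Rle_trans; [|apply Rmax_l]. apply Rmax_r.
    + eapply Rle_trans; [apply H4; lra|]. eapply Rle_trans; [|apply Rmax_r]. apply Rmax_r.
  - intros u v Hu Hv. destruct (Hcont u v) with (eps := 1) as [del [Hdel Hw]]; [unfold p in *; lra|unfold q in *; lra|lra|].
    assert (0 <= p) by (unfold p; lra). assert (0 <= q) by (unfold q; lra).
    exists (del / (p + q + 1)). split; [apply Rdiv_lt_0_compat; lra|].
    intros x y h Hh Hx Hy _ _ _ _. exists (Cmod (F (u, v)) + 1). intros s t Hs Ht.
    assert (Hst : Cmod ((s, t) - (u, v))%C < del).
    { eapply Rle_lt_trans; [apply Cmod_le_sum|]. simpl.
      assert (Rabs (s + - u) <= h * p) by (apply Rabs_le; lra).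
      assert (Rabs (t + - v) <= h * q) by (apply Rabs_le; lra).
      destruct Hh as [Hh1 Hh2]. apply Rlt_div_r in Hh2; lra. }
    specialize (Hw _ Hst). assert (H3 := Cmod_triangle_rev (F (s, t)) (F (u, v))). lra. }
destruct HP as [M HM]. exists M. intros x y Hx Hy. apply HM; unfold p, q; lra.
Qed.

(** * Integrals over circles *)

Definition cexp (w : C) : C := (exp (fst w) * cos (snd w), exp (fst w) * sin (snd w)).

Lemma cexp_plus (a b : C) : cexp (a + b)%C = (cexp a * cexp b)%C.
Proof.
destruct a as [a1 a2], b as [b1 b2]. unfold cexp, Cplus, Cmult; simpl.
rewrite exp_plus, cos_plus, sin_plus. f_equal; ring.
Qed.

Lemma Cmod_polar (r t : R) : 0 <= r -> Cmod (r * cos t, r * sin t) = r.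
Proof.
intros Hr. unfold Cmod; simpl fst; simpl snd.
replace ((r * cos t) ^ 2 + (r * sin t) ^ 2) with (r * r).
- apply sqrt_square; auto.
- assert (H := sin2_cos2 t). unfold Rsqr in H. 
  replace (r * r) with (r * r * (sin t * sin t + cos t * cos t)) by (rewrite H; ring). ring.
Qed.

Lemma Cmod_cexp (w : C) : Cmod (cexp w) = exp (fst w).
Proof. unfold cexp. apply Cmod_polar. left; apply exp_pos. Qed.

Lemma derivable_pt_lim_little_o (f : R -> R) (x l eps : R) : derivable_pt_lim f x l -> 0 < eps ->
  exists del, 0 < del /\ forall h, Rabs h < del -> Rabs (f (x + h) - f x - l * h) <= eps * Rabs h.
Proof.
intros H He. destruct (H eps He) as [d Hd]. exists d. split; [apply cond_pos|]. intros h Hh.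
destruct (Req_dec h 0) as [->|Hh0].
- rewrite Rplus_0_r, Rabs_R0. replace (f x - f x - l * 0) with 0 by ring. rewrite Rabs_R0. lra.
- specialize (Hd h Hh0 Hh).
  replace (f (x + h) - f x - l * h) with (((f (x + h) - f x) / h - l) * h) by (field; auto).
  rewrite Rabs_mult. apply Rmult_le_compat_r; [apply Rabs_pos|lra].
Qed.

Lemma cexp_little_o (eps : R) : 0 < eps -> exists del, 0 < del /\
  forall h : C, Cmod h < del -> Cmod (cexp h - 1 - h)%C <= eps * Cmod h.
Proof.
intros He0. set (e := Rmin 1 (eps / 10)).
assert (He : 0 < e) by (unfold e; apply Rmin_glb_lt; lra).
assert (He1 : e <= 1) by apply Rmin_l. assert (He2 : e <= eps / 10) by apply Rmin_r. clearbody e.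
destruct (derivable_pt_lim_little_o exp 0 1 e) as [d1 [Hd1 H1]]; auto.
{ rewrite <- exp_0. apply derivable_pt_lim_exp. }
destruct (derivable_pt_lim_little_o cos 0 0 e) as [d2 [Hd2 H2]]; auto.
{ replace 0 with (- sin 0) at 2 by (rewrite sin_0; ring). apply derivable_pt_lim_cos. }
destruct (derivable_pt_lim_little_o sin 0 1 e) as [d3 [Hd3 H3]]; auto.
{ rewrite <- cos_0. apply derivable_pt_lim_sin. }
exists (Rmin (Rmin d1 d2) (Rmin d3 (e / 2))). split.
{ repeat apply Rmin_glb_lt; lra. }
intros h Hh.
assert (L1 := Rlt_le_trans _ _ _ Hh (Rmin_l _ _)). assert (L2 := Rlt_le_trans _ _ _ Hh (Rmin_r _ _)).
assert (A1 := Rlt_le_trans _ _ _ L1 (Rmin_l _ _)). assert (A2 := Rlt_le_trans _ _ _ L1 (Rmin_r _ _)).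
assert (A3 := Rlt_le_trans _ _ _ L2 (Rmin_l _ _)). assert (A4 := Rlt_le_trans _ _ _ L2 (Rmin_r _ _)).
assert (Hx := fst_le_Cmod h). assert (Hy := im_le_Cmod h).
set (m := Cmod h) in *. destruct h as [x y]. simpl fst in *; simpl snd in *.
specialize (H1 x ltac:(lra)). specialize (H2 y ltac:(lra)). specialize (H3 y ltac:(lra)).
rewrite Rplus_0_l, exp_0 in H1. rewrite Rplus_0_l, cos_0 in H2. rewrite Rplus_0_l, sin_0 in H3.
assert (Px := Rabs_pos x). assert (Py := Rabs_pos y).
assert (Ex : Rabs (exp x - 1) <= 2 * Rabs x).
{ replace (exp x - 1) with ((exp x - 1 - 1 * x) + x) by ring.
  eapply Rle_trans; [apply Rabs_triang|]. nra. }
assert (Ex2 : Rabs (exp x) <= 2).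
{ replace (exp x) with (1 + (exp x - 1)) by ring. eapply Rle_trans; [apply Rabs_triang|].
  rewrite Rabs_R1. lra. }
eapply Rle_trans; [apply Cmod_le_sum|]. unfold cexp; simpl fst; simpl snd.
replace (exp x * cos y + - (1) + - x) with ((exp x - 1 - 1 * x) + exp x * (cos y - 1 - 0 * y)) by ring.
replace (exp x * sin y + - 0 + - y) with (exp x * (sin y - 0 - 1 * y) + y * (exp x - 1)) by ring.
assert (T1 : Rabs ((exp x - 1 - 1 * x) + exp x * (cos y - 1 - 0 * y)) <= e * m + 2 * (e * m)).
{ eapply Rle_trans; [apply Rabs_triang|]. apply Rplus_le_compat; [nra|]. rewrite Rabs_mult.
  apply Rmult_le_compat; auto using Rabs_pos. nra. }
assert (T2 : Rabs (exp x * (sin y - 0 - 1 * y) + y * (exp x - 1)) <= 2 * (e * m) + m * e).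
{ eapply Rle_trans; [apply Rabs_triang|]. apply Rplus_le_compat; rewrite Rabs_mult.
  - apply Rmult_le_compat; auto using Rabs_pos. nra.
  - apply Rmult_le_compat; auto using Rabs_pos. nra. }
assert (0 <= m) by apply Cmod_ge_0. nra.
Qed.

Lemma cderiv_cexp (z : C) : cderiv cexp z (cexp z).
Proof.
intros eps He. assert (Hz : 0 < Cmod (cexp z)) by (rewrite Cmod_cexp; apply exp_pos).
destruct (cexp_little_o (eps / Cmod (cexp z))) as [d [Hd H]]. { now apply Rdiv_lt_0_compat. }
exists d. split; auto. intros w Hw. specialize (H _ Hw).
replace (cexp w) with (cexp z * cexp (w - z))%C.
2:{ rewrite <- cexp_plus. f_equal. ring. }
replace (cexp z * cexp (w - z) - cexp z - (w - z) * cexp z)%C with (cexp z * (cexp (w - z) - 1 - (w - z)))%C by ring.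
rewrite Cmod_mult. apply Rmult_le_compat_l with (r := Cmod (cexp z)) in H; [|lra].
eapply Rle_trans; [exact H|]. right. field. lra.
Qed.

Definition circ (t th : R) : C := (t * cos th, t * sin th).

Lemma Cmod_circ t th : 0 <= t -> Cmod (circ t th) = t.
Proof. apply Cmod_polar. Qed.

Lemma cexp_circ t th : 0 < t -> cexp (ln t, th) = circ t th.
Proof. intros Ht. unfold cexp, circ; simpl. now rewrite exp_ln. Qed.

Lemma rcont_circ t th : 0 < t -> rcont (circ t) th.
Proof.
intros Ht. intros e He.
destruct (ccont_rcont cexp (fun y => (ln t, y)) th) with (eps := e) as [d [Hd H]]; auto.
- eapply cderiv_cont, cderiv_cexp.
- apply rcont_ver.
- exists d; split; auto. intros s Hs. specialize (H s Hs). now rewrite !cexp_circ in H.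
Qed.

(** The mean over the circle times [2 PI]: the measure is that of the angle, so
that [circ_int h t] is the contour integral of [h z / (i z)]. *)
Definition circ_int (h : C -> C) (t : R) : C := CInt (fun th => h (circ t th)) 0 (2 * PI).

Lemma two_PI_pos : 0 < 2 * PI.
Proof. assert (H := PI_RGT_0). lra. Qed.

Lemma cont_on_circ (h : C -> C) (t : R) : 0 < t -> (forall z, Cmod z = t -> ccont h z) ->
  cont_on (fun th => h (circ t th)) 0 (2 * PI).
Proof.
intros Ht H th _. apply (ccont_rcont h (circ t)). { apply H. apply Cmod_circ; lra. } now apply rcont_circ.
Qed.

Lemma circ_int_bound (h : C -> C) (t M : R) : 0 < t -> (forall z, Cmod z = t -> ccont h z) ->
  (forall z, Cmod z = t -> Cmod (h z) <= M) -> Cmod (circ_int h t) <= M * (2 * PI).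
Proof.
intros Ht H HM. replace (2 * PI) with (2 * PI - 0) by ring. apply Cmod_CInt_le.
- left; apply two_PI_pos. - now apply cont_on_circ. - intros th _. apply HM, Cmod_circ; lra.
Qed.

Lemma circ_int_plus (g h : C -> C) (t : R) : 0 < t -> (forall z, Cmod z = t -> ccont g z) ->
  (forall z, Cmod z = t -> ccont h z) ->
  circ_int (fun z => g z + h z)%C t = (circ_int g t + circ_int h t)%C.
Proof.
intros. unfold circ_int. apply (CInt_plus (fun th => g (circ t th)) (fun th => h (circ t th)));
 try (now apply cont_on_circ). left; apply two_PI_pos.
Qed.

Lemma circ_int_mult (c : C) (h : C -> C) (t : R) : 0 < t ->
  (forall z, Cmod z = t -> ccont h z) ->
  circ_int (fun z => c * h z)%C t = (c * circ_int h t)%C.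
Proof.
intros. unfold circ_int. apply (CInt_mult c (fun th => h (circ t th)));
 try (now apply cont_on_circ). left; apply two_PI_pos.
Qed.

Lemma circ_int_ext (g h : C -> C) (t : R) : 0 < t -> (forall z, Cmod z = t -> g z = h z) ->
  circ_int g t = circ_int h t.
Proof.
intros Ht H. unfold circ_int. apply CInt_ext; [left; apply two_PI_pos|]. intros th _. apply H. apply Cmod_circ; lra.
Qed.

Lemma circ_int_const (c : C) (t : R) : circ_int (fun _ => c) t = (RtoC (2 * PI) * c)%C.
Proof. unfold circ_int. rewrite CInt_const. now rewrite Rminus_0_r. Qed.

(** In the coordinate [log z] the annulus becomes a rectangle whose
horizontal sides carry equal values, [cexp] having period [2 PI i]. Their contributions
to the integral of Goursat's theorem cancel, so those of the vertical sides, which are the two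
circles, agree. *)
Lemma circ_int_radius (h : C -> C) (t1 t2 : R) : 0 < t1 <= t2 ->
  (forall z, t1 <= Cmod z <= t2 -> exists l, cderiv h z l) ->
  circ_int h t1 = circ_int h t2.
Proof.
intros Ht H. assert (Hpi := two_PI_pos).
assert (Hln : ln t1 <= ln t2). { destruct (Rle_lt_or_eq_dec t1 t2) as [L| ->]; try lra. left; apply ln_increasing; lra. }
assert (G := goursat (fun w => h (cexp w)) (ln t1) (ln t2) 0 (2 * PI) Hln ltac:(lra)).
assert (G' : rect_int (fun w => h (cexp w)) (ln t1) (ln t2) 0 (2 * PI) = 0%C).
{ apply G. intros x y Hx Hy. destruct (H (cexp (x, y))) as [l Hl].
  - rewrite Cmod_cexp; simpl. rewrite <- (exp_ln t1), <- (exp_ln t2) by lra.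
    destruct Hx as [[Hx1|Hx1] [Hx2|Hx2]]; split; try (rewrite Hx1); try (rewrite <- Hx2); try lra;
     try (left; apply exp_increasing; lra); try (rewrite ?Hx1, ?Hx2 in *; right; reflexivity).
  - eexists. apply (cderiv_comp h cexp); [exact Hl|apply cderiv_cexp]. }
unfold rect_int in G'.
rewrite (CInt_ext (fun x => h (cexp (x, 0))) (fun x => h (cexp (x, 2 * PI)))) in G'; auto.
2:{ intros x _. f_equal. unfold cexp; simpl. rewrite cos_0, sin_0, cos_2PI, sin_2PI. reflexivity. }
assert (E : CInt (fun y => h (cexp (ln t2, y))) 0 (2 * PI) = CInt (fun y => h (cexp (ln t1, y))) 0 (2 * PI)).
{ set (I1 := CInt (fun y => h (cexp (ln t2, y))) 0 (2 * PI)) in *.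
  set (I2 := CInt (fun y => h (cexp (ln t1, y))) 0 (2 * PI)) in *.
  set (J := CInt _ _ _) in G'.
  assert (E : (Ci * (I1 - I2) = 0)%C) by (rewrite <- G'; ring).
  assert (E2 : (I1 - I2 = 0)%C). 
  { apply Cmod_eq_0. rewrite <- (Rmult_1_l (Cmod _)), <- Cmod_Ci, <- Cmod_mult, E. apply Cmod_0. }
  replace I1 with ((I1 - I2) + I2)%C by ring. rewrite E2. ring. }
unfold circ_int.
rewrite (CInt_ext (fun th => h (circ t1 th)) (fun y => h (cexp (ln t1, y)))), 
        (CInt_ext (fun th => h (circ t2 th)) (fun y => h (cexp (ln t2, y)))); try lra; auto;
 intros; rewrite cexp_circ; auto; lra.
Qed.

Lemma Ceq_of_dist_le (a b : C) (K : R) : (forall e, 0 < e -> Cmod (a - b)%C <= K * e) -> a = b.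
Proof.
intros H. assert (E : (a - b = 0)%C).
{ apply Cmod_eq_0. apply Rle_antisym; [|apply Cmod_ge_0]. apply Rnot_lt_le; intros Hp.
  set (m := Cmod (a - b)) in *. set (K' := Rabs K + 1). assert (0 < K') by (unfold K'; assert (G := Rabs_pos K); lra).
  specialize (H (m / (2 * K')) ltac:(apply Rdiv_lt_0_compat; lra)).
  assert (K <= K') by (unfold K'; assert (G := Rle_abs K); lra).
  assert (K * (m / (2 * K')) <= K' * (m / (2 * K'))).
  { apply Rmult_le_compat_r; auto. left; apply Rdiv_lt_0_compat; lra. }
  assert (K' * (m / (2 * K')) = m / 2) by (field; lra). lra. }
replace a with ((a - b) + b)%C by ring. rewrite E. ring.
Qed.

(** Mean value property. Only continuity is asked at the centre, since the radius may be
shrunk to [0]. *)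
Lemma circ_int_center (h : C -> C) (R t : R) : 0 < t < R -> ccont h 0%C ->
  (forall z, 0 < Cmod z < R -> exists l, cderiv h z l) ->
  circ_int h t = (RtoC (2 * PI) * h 0)%C.
Proof.
intros Ht H0 H. assert (Hpi := two_PI_pos). apply (Ceq_of_dist_le _ _ (2 * PI)). intros e He.
destruct (H0 e He) as [d [Hd Hw]].
set (s := Rmin (d / 2) t). assert (Hs : 0 < s) by (apply Rmin_glb_lt; lra).
assert (Hs1 : s <= d / 2) by apply Rmin_l. assert (Hs2 : s <= t) by apply Rmin_r. clearbody s.
rewrite <- (circ_int_radius h s t); [|lra|intros z Hz; apply H; lra].
assert (Hc : forall z, Cmod z = s -> ccont h z).
{ intros z Hz. destruct (H z) as [l Hl]; [lra|]. eapply cderiv_cont, Hl. }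
replace (circ_int h s - RtoC (2 * PI) * h 0)%C with (circ_int (fun z => h z + (- h 0))%C s).
2:{ rewrite circ_int_plus, circ_int_const; auto. 2:{ intros; apply ccont_const. } ring. }
rewrite Rmult_comm. apply circ_int_bound; auto.
- intros z Hz e' He'. destruct (Hc z Hz e' He') as [d' [Hd' G]]. exists d'; split; auto. intros w Hw'.
  replace (h w + - h 0 - (h z + - h 0))%C with (h w - h z)%C by ring. auto.
- intros z Hz. left. apply Hw. replace (z - 0)%C with z by ring. lra.
Qed.

(** * Cauchy's formula for the derivative at the centre *)

Definition holo_ball (f : C -> C) (c : C) (R : R) : Prop :=
  forall z, Cmod (z - c)%C < R -> exists l, cderiv f z l.

Lemma C_derive_correct_at f z : (exists l, cderiv f z l) -> cderiv f z (C_derive f z).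
Proof. intros [l H]. now rewrite (cderiv_unique f z l H). Qed.

Lemma cderiv_shift (f : C -> C) (c z l : C) : cderiv f (c + z)%C l -> cderiv (fun w => f (c + w)%C) z l.
Proof.
intros H. apply cderiv_eq with (1 * l)%C; [ring|]. apply (cderiv_comp f (fun w => (c + w)%C)); auto.
apply cderiv_eq with (0 + 1)%C; [ring|]. apply cderiv_plus; [apply cderiv_const|apply cderiv_id].
Qed.

Lemma ex_cderiv_inv (z : C) : z <> 0%C -> exists l, cderiv (fun w => / w)%C z l.
Proof. intros Hz. eexists. now apply cderiv_inv. Qed.

Lemma ex_cderiv_mult f g z : (exists l, cderiv f z l) -> (exists l, cderiv g z l) ->
  exists l, cderiv (fun w => f w * g w)%C z l.
Proof. intros [l H] [m G]. eexists. apply cderiv_mult; eassumption. Qed.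

Lemma ex_cderiv_plus f g z : (exists l, cderiv f z l) -> (exists l, cderiv g z l) ->
  exists l, cderiv (fun w => f w + g w)%C z l.
Proof. intros [l H] [m G]. eexists. apply cderiv_plus; eassumption. Qed.

Lemma ex_cderiv_const c z : exists l, cderiv (fun _ => c) z l.
Proof. eexists. apply cderiv_const. Qed.

Lemma ex_cderiv_id z : exists l, cderiv (fun w => w) z l.
Proof. eexists. apply cderiv_id. Qed.

Lemma ex_cderiv_shift f c z : (exists l, cderiv f (c + z)%C l) -> exists l, cderiv (fun w => f (c + w)%C) z l.
Proof. intros [l H]. exists l. now apply cderiv_shift. Qed.

Lemma ex_cderiv_ccont f z : (exists l, cderiv f z l) -> ccont f z.
Proof. intros [l H]. eapply cderiv_cont, H. Qed.

(** The integral is independent of the radius, and tends to [0] as the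
radius grows. *)
Lemma circ_int_inv (t : R) : 0 < t -> circ_int (fun z => / z)%C t = 0%C.
Proof.
intros Ht. apply (Ceq_of_dist_le _ _ (2 * PI)). intros e He.
(* A radius at which the integrand is at most e. *)
set (s := Rmax t (/ e)). assert (Hs1 : t <= s) by apply Rmax_l. assert (Hs2 : / e <= s) by apply Rmax_r.
assert (0 < / e) by now apply Rinv_0_lt_compat. 
assert (Hpi := two_PI_pos).
rewrite (circ_int_radius _ t s); [|lra|].
2:{ intros z Hz. apply ex_cderiv_inv. apply Cmod_gt_0. lra. }
replace (circ_int (fun z => / z) s - 0)%C with (circ_int (fun z => / z)%C s) by ring.
rewrite Rmult_comm. apply circ_int_bound; [lra| |].
- intros z Hz. apply ex_cderiv_ccont, ex_cderiv_inv. apply Cmod_gt_0. lra.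
- intros z Hz. rewrite Cmod_inv by (apply Cmod_gt_0; lra). rewrite Hz.
  rewrite <- (Rinv_inv e). apply Rinv_le_contravar; auto.
Qed.

Definition dquot (f : C -> C) (c : C) (z : C) : C :=
  if excluded_middle_informative (z = 0%C) then C_derive f c else ((f (c + z) - f c) * / z)%C.

Lemma dquot_0 f c : dquot f c 0%C = C_derive f c.
Proof. unfold dquot. destruct excluded_middle_informative; auto. now elim n. Qed.

Lemma dquot_neq f c (z : C) : z <> 0%C -> dquot f c z = ((f (c + z) - f c) * / z)%C.
Proof. intros H. unfold dquot. destruct excluded_middle_informative as [e|e]; [contradiction|reflexivity]. Qed.

Lemma ccont_dquot f c : (exists l, cderiv f c l) -> ccont (dquot f c) 0%C.
Proof.
intros H. apply C_derive_correct_at in H. intros e He. destruct (H (e / 2)) as [d [Hd Hw]]; [lra|].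
exists d; split; auto. intros w Hww. rewrite dquot_0.
destruct (excluded_middle_informative (w = 0%C)) as [->|Hn].
{ rewrite dquot_0. replace (C_derive f c - C_derive f c)%C with (RtoC 0) by ring. now rewrite Cmod_0. }
rewrite dquot_neq by auto.
replace (w - 0)%C with w in Hww by ring.
specialize (Hw (c + w)%C). replace (c + w - c)%C with w in Hw by ring. specialize (Hw Hww).
replace ((f (c + w) - f c) * / w - C_derive f c)%C with ((f (c + w) - f c - w * C_derive f c) / w)%C.
2:{ field. auto. }
rewrite Cmod_div by auto. assert (Hp : 0 < Cmod w) by now apply Cmod_gt_0.
apply Rle_lt_trans with (e / 2); [|lra]. apply Rle_div_l; auto.
Qed.

Lemma dquot_holo f c (z : C) : z <> 0%C -> (exists l, cderiv f (c + z)%C l) -> exists l, cderiv (dquot f c) z l.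
Proof.
intros Hz H.
assert (Hex : exists l, cderiv (fun z => (f (c + z) + - f c) * / z)%C z l).
{ apply ex_cderiv_mult; [|now apply ex_cderiv_inv]. apply ex_cderiv_plus; [|apply ex_cderiv_const].
  now apply ex_cderiv_shift. }
destruct Hex as [l Hl]. exists l. apply (cderiv_ext_loc _ (dquot f c) _ _ (Cmod z)) in Hl; [exact Hl|now apply Cmod_gt_0|].
intros w Hw. rewrite dquot_neq; [reflexivity|]. intros ->.
replace (0 - z)%C with (- z)%C in Hw by ring. rewrite Cmod_opp in Hw. lra.
Qed.

(** The mean value property of [dquot f c], whose value at [0] is the
derivative; the constant term [f c / z] has mean [0]. *)
Lemma cauchy_derivative f c R t : 0 < t < R -> holo_ball f c R ->
  circ_int (fun z => f (c + z) * / z)%C t = (RtoC (2 * PI) * C_derive f c)%C.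
Proof.
intros Ht Hf.
assert (Hfz : forall z, Cmod z < R -> exists l, cderiv f (c + z)%C l).
{ intros z Hz. apply Hf. replace (c + z - c)%C with z by ring. auto. }
assert (Hn : forall z : C, Cmod z = t -> z <> 0%C). { intros z Hz. apply Cmod_gt_0; lra. }
assert (E := circ_int_center (dquot f c) R t Ht).
rewrite dquot_0 in E. rewrite <- E; clear E.
- transitivity (circ_int (fun z => dquot f c z + f c * / z)%C t).
  + apply circ_int_ext; [lra|]. intros z Hz. rewrite dquot_neq by auto. field. auto.
  + rewrite circ_int_plus; [|lra| |].
    * rewrite circ_int_mult; [|lra|]. { rewrite circ_int_inv by lra. ring. }
      intros z Hz. apply ex_cderiv_ccont, ex_cderiv_inv; auto.
    * intros z Hz. apply ex_cderiv_ccont, dquot_holo; auto. apply Hfz; lra.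
    * intros z Hz. apply ex_cderiv_ccont, ex_cderiv_mult; [apply ex_cderiv_const|apply ex_cderiv_inv; auto].
- apply ccont_dquot. assert (G := Hfz 0%C). rewrite Cplus_0_r in G. apply G. rewrite Cmod_0. lra.
- intros z Hz. apply dquot_holo. { apply Cmod_gt_0; lra. } apply Hfz; lra.
Qed.

Lemma cauchy_estimate_lt f c R t M : 0 < t < R -> holo_ball f c R ->
  (forall z, Cmod (z - c)%C < R -> Cmod (f z) <= M) -> Cmod (C_derive f c) <= M / t.
Proof.
intros Ht Hf HM. assert (Hpi := two_PI_pos). assert (E := cauchy_derivative f c R t Ht Hf).
assert (Hfz : forall z, Cmod z < R -> exists l, cderiv f (c + z)%C l).
{ intros z Hz. apply Hf. replace (c + z - c)%C with z by ring. auto. }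
assert (Hn : forall z : C, Cmod z = t -> z <> 0%C). { intros z Hz. apply Cmod_gt_0; lra. }
assert (B : Cmod (circ_int (fun z => f (c + z) * / z)%C t) <= M / t * (2 * PI)).
{ apply circ_int_bound; [lra| |].
  - intros z Hz. apply ex_cderiv_ccont, ex_cderiv_mult; [|apply ex_cderiv_inv; auto].
    apply ex_cderiv_shift, Hfz. lra.
  - intros z Hz. rewrite Cmod_mult, Cmod_inv, Hz by auto. apply Rmult_le_compat_r.
    { left; apply Rinv_0_lt_compat; lra. } apply HM. replace (c + z - c)%C with z by ring. lra. }
rewrite E, Cmod_mult, Cmod_R, Rabs_pos_eq in B by lra.
apply Rmult_le_reg_l with (2 * PI); auto. lra.
Qed.

Lemma cauchy_estimate f c R M : 0 < R -> holo_ball f c R ->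
  (forall z, Cmod (z - c)%C < R -> Cmod (f z) <= M) -> Cmod (C_derive f c) <= M / R.
Proof.
intros HR Hf HM. set (D := Cmod (C_derive f c)).
assert (HD : 0 <= D) by apply Cmod_ge_0.
apply Rle_div_r; auto. apply Rnot_lt_le; intros Hlt.
assert (HM0 : 0 <= M). { eapply Rle_trans; [apply Cmod_ge_0|apply (HM c)]. replace (c - c)%C with (RtoC 0) by ring. rewrite Cmod_0; auto. }
assert (HD' : 0 < D) by nra.
set (t := (M / D + R) / 2).
assert (M / D < R) by (apply Rlt_div_l; lra). assert (0 <= M / D) by (apply Rdiv_le_0_compat; lra).
assert (Ht : 0 < t < R) by (unfold t; lra).
assert (G := cauchy_estimate_lt f c R t M Ht Hf HM). fold D in G.
apply Rle_div_r in G; [|lra]. assert (M < t * D); [|lra]. apply Rlt_div_l; auto. unfold t; lra.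
Qed.

Definition curve_deriv (g : R -> C) (s : R) (l : C) : Prop :=
  forall eps, 0 < eps -> exists del, 0 < del /\ forall h, Rabs h < del ->
    Cmod (g (s + h)%R - g s - RtoC h * l)%C <= eps * Rabs h.

Lemma curve_deriv_line (f : C -> C) (a v : C) (s : R) (l : C) : cderiv f (a + RtoC s * v)%C l ->
  curve_deriv (fun s => f (a + RtoC s * v)%C) s (v * l)%C.
Proof.
intros H eps He. set (V := Cmod v). assert (HV : 0 <= V) by apply Cmod_ge_0.
destruct (H (eps / (V + 1))) as [d [Hd Hw]]. { apply Rdiv_lt_0_compat; lra. }
exists (d / (V + 1)). split. { apply Rdiv_lt_0_compat; lra. } intros h Hh.
assert (Hhd : Rabs h * (V + 1) < d) by (apply Rlt_div_r in Hh; lra).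
assert (P := Rabs_pos h).
specialize (Hw (a + RtoC (s + h) * v)%C).
replace (a + RtoC (s + h) * v - (a + RtoC s * v))%C with (RtoC h * v)%C in Hw by (rewrite RtoC_plus; ring).
rewrite Cmod_mult, Cmod_R in Hw. fold V in Hw.
replace (RtoC h * (v * l))%C with (RtoC h * v * l)%C by ring.
eapply Rle_trans; [apply Hw; nra|].
replace (eps / (V + 1) * (Rabs h * V)) with (eps * Rabs h * (V / (V + 1))) by (field; lra).
rewrite <- (Rmult_1_r (eps * Rabs h)) at 2. apply Rmult_le_compat_l; [nra|]. apply Rle_div_l; lra.
Qed.

Lemma curve_deriv_mult_l (c : C) (g : R -> C) s l : curve_deriv g s l -> curve_deriv (fun s => c * g s)%C s (c * l)%C.
Proof.
intros H eps He. set (V := Cmod c). assert (HV : 0 <= V) by apply Cmod_ge_0.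
destruct (H (eps / (V + 1))) as [d [Hd Hw]]. { apply Rdiv_lt_0_compat; lra. }
exists d; split; auto. intros h Hh. specialize (Hw h Hh). assert (P := Rabs_pos h).
replace (c * g (s + h)%R - c * g s - RtoC h * (c * l))%C with (c * (g (s + h)%R - g s - RtoC h * l))%C by ring.
rewrite Cmod_mult. fold V. eapply Rle_trans; [apply Rmult_le_compat_l; [auto|exact Hw]|].
replace (V * (eps / (V + 1) * Rabs h)) with (eps * Rabs h * (V / (V + 1))) by (field; lra).
rewrite <- (Rmult_1_r (eps * Rabs h)) at 2. apply Rmult_le_compat_l; [nra|]. apply Rle_div_l; lra.
Qed.

Lemma is_derive_little_o (f : R -> R) (x l : R) :
  (forall eps, 0 < eps -> exists del, 0 < del /\ forall h, Rabs h < del -> Rabs (f (x + h) - f x - h * l) <= eps * Rabs h) ->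
  is_derive f x l.
Proof.
intros H. apply is_derive_Reals. intros eps He. destruct (H (eps / 2)) as [d [Hd Hh]]; [lra|].
exists (mkposreal d Hd). intros h Hh0 Hhd. specialize (Hh h Hhd).
replace ((f (x + h) - f x) / h - l) with ((f (x + h) - f x - h * l) / h) by (field; auto).
unfold Rdiv. rewrite Rabs_mult, Rabs_inv. assert (0 < Rabs h) by now apply Rabs_pos_lt.
apply Rle_lt_trans with (eps / 2); [|lra]. apply Rle_div_l; auto.
Qed.

Lemma curve_deriv_components g s l : curve_deriv g s l ->
  is_derive (fun s => fst (g s)) s (fst l) /\ is_derive (fun s => snd (g s)) s (snd l).
Proof.
intros H; split; apply is_derive_little_o; intros eps He; destruct (H eps He) as [d [Hd Hh]];
 exists d; (split; [exact Hd|]); intros h Hhd; (eapply Rle_trans; [|exact (Hh h Hhd)]).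
- eapply Rle_trans; [|apply fst_le_Cmod]. right. f_equal. simpl. ring.
- eapply Rle_trans; [|apply im_le_Cmod]. right. f_equal. simpl. ring.
Qed.

Lemma ball_convex (c z1 z2 : C) (R s : R) : Cmod (z1 - c)%C < R -> Cmod (z2 - c)%C < R -> 0 <= s <= 1 ->
  Cmod (z1 + RtoC s * (z2 - z1) - c)%C < R.
Proof.
intros H1 H2 Hs.
replace (z1 + RtoC s * (z2 - z1) - c)%C with (RtoC (1 - s) * (z1 - c) + RtoC s * (z2 - c))%C by (rewrite RtoC_minus; ring).
eapply Rle_lt_trans; [apply Cmod_triangle|]. rewrite !Cmod_mult, !Cmod_R, !Rabs_pos_eq by lra.
destruct (Req_dec s 0) as [->|]; [lra|]. nra.
Qed.

(** With [w = f z2 - f z1], the real mean value theorem is applied to the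
real part of [conj w * f] on the segment; it increases by exactly [|w|^2]. *)
Lemma mean_value_ineq (f f' : C -> C) (z1 z2 : C) (M : R) :
  (forall s, 0 <= s <= 1 -> cderiv f (z1 + RtoC s * (z2 - z1))%C (f' (z1 + RtoC s * (z2 - z1))%C) /\
     Cmod (f' (z1 + RtoC s * (z2 - z1))%C) <= M) ->
  Cmod (f z2 - f z1)%C <= M * Cmod (z2 - z1)%C.
Proof.
intros H. set (w := (f z2 - f z1)%C). set (v := (z2 - z1)%C) in *.
destruct (Req_dec (Cmod w) 0) as [E|E].
{ rewrite E. apply Rmult_le_pos; [|apply Cmod_ge_0]. eapply Rle_trans; [apply Cmod_ge_0|]. apply (H 0); lra. }
assert (Hw : 0 < Cmod w) by (assert (G := Cmod_ge_0 w); lra).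
(* The real part of conj w times f along the segment. *)
set (phi := fun s => fst (Cconj w * f (z1 + RtoC s * v))%C).
set (dphi := fun s => fst (Cconj w * (v * f' (z1 + RtoC s * v)))%C).
assert (Hd : forall s, 0 <= s <= 1 -> is_derive phi s (dphi s)).
{ intros s Hs. apply (curve_deriv_components (fun s => Cconj w * f (z1 + RtoC s * v))%C).
  apply curve_deriv_mult_l, curve_deriv_line. now apply H. }
destruct (MVT_gen phi 0 1 dphi) as [c [Hc Heq]].
{ rewrite Rmin_left, Rmax_right by lra. intros x Hx. apply Hd; lra. }
{ rewrite Rmin_left, Rmax_right by lra. intros x Hx. apply continuity_pt_filterlim.
  apply (@ex_derive_continuous R_AbsRing R_NormedModule). exists (dphi x). apply Hd; lra. }
rewrite Rmin_left, Rmax_right in Hc by lra.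
assert (E1 : phi 1 - phi 0 = Cmod w ^ 2).
{ unfold phi. replace (z1 + RtoC 1 * v)%C with z2 by (unfold v; ring). replace (z1 + RtoC 0 * v)%C with z1 by ring.
  transitivity (fst (w * Cconj w)%C); [unfold w; simpl; ring|]. now rewrite <- Cmod2_conj. }
assert (E2 : dphi c <= Cmod w * (Cmod v * M)).
{ unfold dphi. eapply Rle_trans; [apply Rle_abs|]. eapply Rle_trans; [apply fst_le_Cmod|].
  rewrite !Cmod_mult, Cmod_conj. apply Rmult_le_compat_l; [lra|]. apply Rmult_le_compat_l; [apply Cmod_ge_0|].
  now apply H. }
rewrite E1 in Heq. apply Rmult_le_reg_l with (Cmod w); auto. nra.
Qed.

Lemma mean_value_ball f c R M z1 z2 : holo_ball f c R -> 
  (forall z, Cmod (z - c)%C < R -> Cmod (C_derive f z) <= M) ->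
  Cmod (z1 - c)%C < R -> Cmod (z2 - c)%C < R -> Cmod (f z2 - f z1)%C <= M * Cmod (z2 - z1)%C.
Proof.
intros Hf HM H1 H2. apply (mean_value_ineq f (C_derive f)). intros s Hs.
assert (Hb := ball_convex c z1 z2 R s H1 H2 Hs). split; [|now apply HM]. apply C_derive_correct_at. now apply Hf.
Qed.

Lemma holo_ball_sub f c R c' R' : holo_ball f c R -> Cmod (c' - c)%C + R' <= R -> holo_ball f c' R'.
Proof.
intros H Hs z Hz. apply H. replace (z - c)%C with ((z - c') + (c' - c))%C by ring.
eapply Rle_lt_trans; [apply Cmod_triangle|]. lra.
Qed.

Lemma in_ball_trans (z c c' : C) (R R' : R) : Cmod (z - c')%C < R' -> Cmod (c' - c)%C + R' <= R -> Cmod (z - c)%C < R.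
Proof.
intros H Hs. replace (z - c)%C with ((z - c') + (c' - c))%C by ring.
eapply Rle_lt_trans; [apply Cmod_triangle|]. lra.
Qed.

(** * Analyticity of the derivative and Cauchy estimates *)

Lemma cderiv_minus f g z l m : cderiv f z l -> cderiv g z m -> cderiv (fun w => f w - g w)%C z (l - m)%C.
Proof.
intros Hf Hg. apply cderiv_eq with (l + (0 * g z + - (1) * m))%C; [ring|].
apply (cderiv_ext_loc (fun w => f w + - (1) * g w)%C _ _ _ 1 Rlt_0_1). { intros w _. ring. }
apply cderiv_plus; auto. apply (cderiv_mult (fun _ => (- (1))%C)); auto. apply cderiv_const.
Qed.

Lemma Cmod_self (c : C) : Cmod (c - c)%C = 0.
Proof. replace (c - c)%C with (RtoC 0) by ring. apply Cmod_0. Qed.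

(** Mean value inequality for [f w - f' z * w], whose derivative is
[f' w - f' z]. *)
Lemma first_order_remainder f (z u : C) (K : R) :
  (forall s, 0 <= s <= 1 -> (exists l, cderiv f (z + RtoC s * u)%C l) /\
     Cmod (C_derive f (z + RtoC s * u) - C_derive f z)%C <= K) ->
  Cmod (f (z + u) - f z - u * C_derive f z)%C <= K * Cmod u.
Proof.
intros H. set (g := fun w => (f w - C_derive f z * w)%C).
assert (E : (f (z + u) - f z - u * C_derive f z = g (z + u) - g z)%C) by (unfold g; ring).
rewrite E. replace (Cmod u) with (Cmod (z + u - z)%C) by (f_equal; ring).
apply (mean_value_ineq g (fun w => C_derive f w - C_derive f z)%C). intros s Hs.
replace (z + RtoC s * (z + u - z))%C with (z + RtoC s * u)%C by ring.
destruct (H s Hs) as [He Hb]. split; auto.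
unfold g. apply cderiv_minus. { now apply C_derive_correct_at. }
apply cderiv_eq with (0 * (z + RtoC s * u) + C_derive f z * 1)%C; [ring|].
apply (cderiv_mult (fun _ => C_derive f z) (fun w => w)); [apply cderiv_const|apply cderiv_id].
Qed.

(** Differentiation of the formula [2 PI f' (c) = circ_int (f (c + z) / z)]
under the integral. This requires [f (c + z + u) - f (c + z) - u f' (c + z) = O(u^2)]
uniformly in [z], that is, a Lipschitz bound for [f']; it comes from the
Cauchy estimate applied to the difference of two translates of [f], since [f] is itself
Lipschitz. *)
Lemma C_derive_holo_center f c R : 0 < R -> holo_ball f c R -> exists l, cderiv (C_derive f) c l.
Proof.
intros HR Hf. assert (Hpi := two_PI_pos).
assert (Hc : ccont f c). { apply ex_cderiv_ccont, Hf. now rewrite Cmod_self. }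
destruct (Hc 1 Rlt_0_1) as [d [Hd Hw]].
set (B := Cmod (f c) + 1). assert (HB : 0 < B) by (unfold B; assert (G := Cmod_ge_0 (f c)); lra).
set (t := Rmin d R / 4). 
assert (Ht1 : 4 * t <= d) by (unfold t; assert (G := Rmin_l d R); lra).
assert (Ht2 : 4 * t <= R) by (unfold t; assert (G := Rmin_r d R); lra).
assert (Ht : 0 < t) by (unfold t; assert (G : 0 < Rmin d R) by (now apply Rmin_glb_lt); lra).
clearbody t.
assert (Hh : holo_ball f c (4 * t)). { intros z Hz. apply Hf. lra. }
assert (HfB : forall z, Cmod (z - c)%C < 4 * t -> Cmod (f z) <= B).
{ intros z Hz. specialize (Hw z ltac:(lra)). assert (G := Cmod_triangle_rev (f z) (f c)). unfold B; lra. }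
assert (Hdf : forall z, Cmod (z - c)%C < 3 * t -> Cmod (C_derive f z) <= B / t).
{ intros z Hz. apply cauchy_estimate; auto. { apply (holo_ball_sub f c (4 * t)); auto; lra. }
  intros w Hw'. apply HfB. apply (in_ball_trans w c z _ t); auto; lra. }
assert (Hlip : forall z1 z2, Cmod (z1 - c)%C < 3 * t -> Cmod (z2 - c)%C < 3 * t ->
   Cmod (f z2 - f z1)%C <= B / t * Cmod (z2 - z1)%C).
{ intros z1 z2 H1 H2. apply (mean_value_ball f c (3 * t)); auto. intros z Hz; apply Hh; lra. }
set (K := B / t / t).
assert (HK : 0 < K). { unfold K. repeat apply Rdiv_lt_0_compat; auto. }
assert (Hlip' : forall z1 z2, Cmod (z1 - c)%C < 2 * t -> Cmod (z2 - c)%C < 2 * t ->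
   Cmod (C_derive f z2 - C_derive f z1)%C <= K * Cmod (z2 - z1)%C).
{ intros z1 z2 H1 H2. set (g := fun w => (f (z2 + w) - f (z1 + w))%C).
  assert (Hin : forall z w, Cmod (z - c)%C < 2 * t -> Cmod w < t -> Cmod (z + w - c)%C < 3 * t).
  { intros z w Hz Hww. replace (z + w - c)%C with ((z - c) + w)%C by ring. eapply Rle_lt_trans; [apply Cmod_triangle|]. lra. }
  assert (Hg : forall w, Cmod w < t -> cderiv g w (C_derive f (z2 + w) - C_derive f (z1 + w))%C).
  { intros w Hww. apply cderiv_minus; apply cderiv_shift, C_derive_correct_at, Hh.
    - specialize (Hin z2 w H2 Hww); lra. - specialize (Hin z1 w H1 Hww); lra. }
  assert (E : C_derive g 0%C = (C_derive f z2 - C_derive f z1)%C).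
  { rewrite (cderiv_unique g 0 (C_derive f (z2 + 0) - C_derive f (z1 + 0))%C).
    - now rewrite !Cplus_0_r. - apply Hg. rewrite Cmod_0; auto. }
  rewrite <- E. unfold K. replace (B / t / t * Cmod (z2 - z1)) with (B / t * Cmod (z2 - z1) / t) by (field; lra).
  apply cauchy_estimate; auto.
  - intros w Hww. eexists. apply Hg. now replace (w - 0)%C with w in Hww by ring.
  - intros w Hww. replace (w - 0)%C with w in Hww by ring. unfold g.
    replace (z2 - z1)%C with (z2 + w - (z1 + w))%C by ring. apply Hlip; now apply Hin. }
set (s := t / 2).
set (m := (/ RtoC (2 * PI) * circ_int (fun z => C_derive f (c + z) * / z) s)%C).
exists m. 
assert (Hrem : forall u, Cmod u < t -> Cmod (C_derive f (c + u) - C_derive f c - u * m)%C <= K / s * (Cmod u * Cmod u)).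
{ intros u Hu.
  assert (Hs0 : forall z, Cmod z = s -> z <> RtoC 0). { intros z Hz. apply Cmod_gt_0. unfold s in Hz; lra. }
  assert (I1 := cauchy_derivative f (c + u)%C t s ltac:(unfold s; lra)).
  assert (I2 := cauchy_derivative f c t s ltac:(unfold s; lra)).
  rewrite <- (Rmult_1_l (Cmod _)). 
  assert (Hpc : RtoC (2 * PI) <> 0%C). { apply Cmod_gt_0. rewrite Cmod_R, Rabs_pos_eq; lra. }
  assert (C1 : forall z, Cmod z = s -> ccont (fun z => f (c + u + z) * / z)%C z).
  { intros z Hz. apply ex_cderiv_ccont, ex_cderiv_mult; [|apply ex_cderiv_inv; auto].
    apply ex_cderiv_shift, Hh. replace (c + u + z - c)%C with (u + z)%C by ring.
    eapply Rle_lt_trans; [apply Cmod_triangle|]. unfold s in Hz; lra. }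
  assert (C2 : forall z, Cmod z = s -> ccont (fun z => f (c + z) * / z)%C z).
  { intros z Hz. apply ex_cderiv_ccont, ex_cderiv_mult; [|apply ex_cderiv_inv; auto].
    apply ex_cderiv_shift, Hh. replace (c + z - c)%C with z by ring. unfold s in Hz; lra. }
  assert (C0 : forall z, Cmod z = s -> ccont (fun z => C_derive f (c + z))%C z).
  { intros z Hz e He. exists (Rmin s (e / K)). split.
    { apply Rmin_glb_lt; [unfold s; lra|now apply Rdiv_lt_0_compat]. }
    intros w Hww. assert (G1 := Rlt_le_trans _ _ _ Hww (Rmin_l _ _)). assert (G2 := Rlt_le_trans _ _ _ Hww (Rmin_r _ _)).
    eapply Rle_lt_trans; [apply Hlip'|].
    - replace (c + z - c)%C with z by ring. unfold s in Hz; lra.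
    - replace (c + w - c)%C with ((w - z) + z)%C by ring. eapply Rle_lt_trans; [apply Cmod_triangle|]. unfold s in *; lra.
    - replace (c + w - (c + z))%C with (w - z)%C by ring. apply Rlt_div_r in G2; lra. }
  assert (C3 : forall z, Cmod z = s -> ccont (fun z => C_derive f (c + z) * / z)%C z).
  { intros z Hz. apply ccont_mult; [now apply C0|]. apply ex_cderiv_ccont, ex_cderiv_inv; auto. }
  assert (CC : forall k g z, ccont g z -> ccont (fun w => k * g w)%C z).
  { intros k g z Hg. apply (ccont_mult (fun _ => k) g); auto. apply ccont_const. }
  assert (CP := ccont_plus).
  set (rem := fun z => (f (c + u + z) * / z + (- (1) * (f (c + z) * / z) + - u * (C_derive f (c + z) * / z)))%C).
  assert (Erem : (circ_int rem s = RtoC (2 * PI) * (C_derive f (c + u) - C_derive f c - u * m))%C).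
  { unfold rem. rewrite circ_int_plus; [|unfold s; lra|auto|auto].
    rewrite circ_int_plus; [|unfold s; lra|auto|auto]. rewrite !circ_int_mult by (auto; unfold s; lra).
    rewrite I1, I2. unfold m. field. auto.
    intros z Hz; apply Hh; lra.
    intros z Hz. apply Hh. apply (in_ball_trans z c (c + u)%C _ t); auto.
    replace (c + u - c)%C with u by ring. lra. }
  assert (Hb : Cmod (circ_int rem s) <= (K * Cmod u * Cmod u / s) * (2 * PI)).
  { apply circ_int_bound; [unfold s; lra| |].
    - intros z Hz. unfold rem. auto.
    - intros z Hz. unfold rem.
      replace (f (c + u + z) * / z + (- (1) * (f (c + z) * / z) + - u * (C_derive f (c + z) * / z)))%C with
        ((f (c + z + u) - f (c + z) - u * C_derive f (c + z)) * / z)%C.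
      2:{ replace (c + z + u)%C with (c + u + z)%C by ring. ring. }
      rewrite Cmod_mult, Cmod_inv, Hz by auto. apply Rmult_le_compat_r; [left; apply Rinv_0_lt_compat; unfold s; lra|].
      apply first_order_remainder. intros x Hx. 
      assert (Hxu : Cmod (RtoC x * u)%C <= Cmod u).
      { rewrite Cmod_mult, Cmod_R, Rabs_pos_eq by lra. assert (G := Cmod_ge_0 u). nra. }
      assert (Hin : Cmod (c + z + RtoC x * u - c)%C < 2 * t).
      { replace (c + z + RtoC x * u - c)%C with (z + RtoC x * u)%C by ring. eapply Rle_lt_trans; [apply Cmod_triangle|]. unfold s in Hz; lra. }
      split; [apply Hh; lra|]. eapply Rle_trans; [apply Hlip'; auto|].
      + replace (c + z - c)%C with z by ring. unfold s in Hz; lra.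
      + replace (c + z + RtoC x * u - (c + z))%C with (RtoC x * u)%C by ring. apply Rmult_le_compat_l; lra. }
  rewrite Erem, Cmod_mult, Cmod_R, Rabs_pos_eq in Hb by lra. rewrite Rmult_1_l.
  apply Rmult_le_reg_l with (2 * PI); auto. eapply Rle_trans; [exact Hb|]. right. field. unfold s; lra. }
intros e He. exists (Rmin t (e / (K / s))).
assert (HKs : 0 < K / s). { apply Rdiv_lt_0_compat; auto. unfold s; lra. }
split. { apply Rmin_glb_lt; auto. now apply Rdiv_lt_0_compat. }
intros w Hww. assert (G1 := Rlt_le_trans _ _ _ Hww (Rmin_l _ _)). assert (G2 := Rlt_le_trans _ _ _ Hww (Rmin_r _ _)).
specialize (Hrem (w - c)%C G1). replace (c + (w - c))%C with w in Hrem by ring.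
eapply Rle_trans; [exact Hrem|]. apply Rlt_div_r in G2; auto.
assert (G := Cmod_ge_0 (w - c)). nra.
Qed.

Lemma C_derive_holo f c R : holo_ball f c R -> holo_ball (C_derive f) c R.
Proof.
intros Hf z Hz. apply (C_derive_holo_center f z (R - Cmod (z - c)%C)); [lra|].
apply (holo_ball_sub f c R); auto. lra.
Qed.

Lemma C_derive_n_holo f c R n : holo_ball f c R -> holo_ball (C_derive_n f n) c R.
Proof. intros Hf. induction n; [exact Hf|]. now apply C_derive_holo. Qed.

(** The first-order estimate is iterated, giving up a margin
[rho] at each derivative. The resulting constant [1 / rho ^ n] is not sharp, but
requires no integral formula of higher order. *)
Lemma cauchy_estimate_n f c R rho S n : 0 < rho -> holo_ball f c R ->
  (forall z, Cmod (z - c)%C < R -> Cmod (f z) <= S) ->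
  forall z, Cmod (z - c)%C < R - INR n * rho -> Cmod (C_derive_n f n z) <= S / rho ^ n.
Proof.
intros Hrho Hf HS. induction n; intros z Hz.
- simpl in Hz |- *. unfold Rdiv. rewrite Rinv_1, Rmult_1_r. apply HS. lra.
- rewrite S_INR in Hz. change (C_derive_n f (Datatypes.S n) z) with (C_derive (C_derive_n f n) z).
  replace (S / rho ^ Datatypes.S n) with (S / rho ^ n / rho).
  2:{ simpl. field. split; [apply pow_nonzero|]; lra. }
  assert (0 <= INR n) by apply pos_INR.
  apply cauchy_estimate; auto.
  + apply (holo_ball_sub _ c R). { now apply C_derive_n_holo. } nra.
  + intros w Hw. apply IHn. apply (in_ball_trans w c z _ rho); auto. lra.
Qed.

(** * Cauchy's integral formula *)

(** The second-order Taylor expansion of [f] at [c], which is available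
because [f'] is differentiable, makes the singularity of [dquot f c] removable. *)
Lemma dquot_holo_0 f c R : 0 < R -> holo_ball f c R -> exists l, cderiv (dquot f c) 0%C l.
Proof.
intros HR Hf. destruct (C_derive_holo_center f c R HR Hf) as [m Hm].
exists (m * / 2)%C. intros e He. destruct (Hm e He) as [d [Hd Hw]].
exists (Rmin d R). split; [now apply Rmin_glb_lt|]. intros h Hh.
replace (h - 0)%C with h in * by ring. rewrite dquot_0.
assert (G1 := Rlt_le_trans _ _ _ Hh (Rmin_l _ _)). assert (G2 := Rlt_le_trans _ _ _ Hh (Rmin_r _ _)).
destruct (excluded_middle_informative (h = 0%C)) as [->|Hn].
{ rewrite dquot_0, Cmod_0. replace (C_derive f c - C_derive f c - 0 * (m * / 2))%C with (RtoC 0) by ring. rewrite Cmod_0. lra. }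
rewrite dquot_neq by auto.
assert (Hp : 0 < Cmod h) by now apply Cmod_gt_0.
set (g := fun w => (f w - (C_derive f c * w + m * / 2 * ((w - c) * (w - c))))%C).
assert (Hg : Cmod (g (c + h) - g c)%C <= e * Cmod h * Cmod (c + h - c)%C).
{ apply (mean_value_ineq g (fun w => C_derive f w - (C_derive f c + (w - c) * m))%C). intros s Hs.
  replace (c + h - c)%C with h by ring. 
  assert (Hsh : Cmod (RtoC s * h)%C <= Cmod h). { rewrite Cmod_mult, Cmod_R, Rabs_pos_eq by lra. nra. }
  set (w := (c + RtoC s * h)%C). assert (Ew : (w - c = RtoC s * h)%C) by (unfold w; ring).
  split.
  - unfold g. apply cderiv_minus. { apply C_derive_correct_at, Hf. rewrite Ew. lra. }
    apply cderiv_eq with ((0 * w + C_derive f c * 1) + (0 * ((w - c) * (w - c)) + (m * / 2) * ((1 - 0) * (w - c) + (w - c) * (1 - 0))))%C.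
    { field. }
    assert (Hid := cderiv_id w). assert (Hc := cderiv_const c w).
    apply cderiv_plus.
    + apply (cderiv_mult (fun _ => C_derive f c) (fun w => w)); auto using cderiv_const.
    + apply (cderiv_mult (fun _ => m * / 2)%C (fun w => (w - c) * (w - c))%C); [apply cderiv_const|].
      assert (Hmin := cderiv_minus (fun w => w) (fun _ => c) w 1 0 Hid Hc).
      apply (cderiv_mult (fun w => w - c)%C (fun w => w - c)%C); auto.
  - replace (C_derive f w - (C_derive f c + (w - c) * m))%C with (C_derive f w - C_derive f c - (w - c) * m)%C by ring.
    eapply Rle_trans; [apply Hw; rewrite Ew; lra|]. apply Rmult_le_compat_l; [lra|]. rewrite Ew; auto. }
replace (c + h - c)%C with h in Hg by ring.
assert (E : (g (c + h) - g c = h * ((f (c + h) - f c) * / h - C_derive f c - h * (m * / 2)))%C).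
{ unfold g. field. auto. }
rewrite E, Cmod_mult in Hg. apply Rmult_le_reg_l with (Cmod h); auto. lra.
Qed.

Lemma sub_neq_0 (a b : C) : Cmod b < Cmod a -> (a - b)%C <> 0%C.
Proof. intros H. apply Cmod_gt_0. assert (G := Cmod_triangle_rev a b). lra. Qed.

Lemma ex_cderiv_sub_inv (u z : C) : Cmod u < Cmod z -> exists l, cderiv (fun w => / (w - u))%C z l.
Proof.
intros H. eexists. apply (cderiv_comp (fun w => / w)%C (fun w => w - u)%C).
- apply cderiv_inv. now apply sub_neq_0.
- apply cderiv_minus; [apply cderiv_id|apply cderiv_const].
Qed.

Lemma kernel_ex_cderiv (u z : C) : Cmod u < Cmod z -> exists l, cderiv (fun w => w * / (w - u))%C z l.
Proof. intros H. apply ex_cderiv_mult; [apply ex_cderiv_id|now apply ex_cderiv_sub_inv]. Qed.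

Lemma kernel_bound (u z : C) : Cmod u < Cmod z -> Cmod (z * / (z - u))%C <= Cmod z / (Cmod z - Cmod u).
Proof.
intros H. rewrite Cmod_mult, Cmod_inv by now apply sub_neq_0.
apply Rmult_le_compat_l; [apply Cmod_ge_0|]. apply Rinv_le_contravar; [lra|]. apply Cmod_triangle_rev.
Qed.

(** Independence of the radius, and the limit at infinity, where the
kernel tends to [1]. *)
Lemma circ_int_kernel (u : C) (t : R) : Cmod u < t -> circ_int (fun z => z * / (z - u))%C t = RtoC (2 * PI).
Proof.
intros Hu. assert (Hu0 := Cmod_ge_0 u). assert (Hpi := two_PI_pos).
apply (Ceq_of_dist_le _ _ (2 * PI)). intros e He.
(* A radius at which the kernel differs from 1 by at most e. *)
set (s := Rmax t (Cmod u + Cmod u / e + 1)).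
assert (Hs1 : t <= s) by apply Rmax_l. assert (Hs2 : Cmod u + Cmod u / e + 1 <= s) by apply Rmax_r. clearbody s.
assert (Hue : 0 <= Cmod u / e) by (apply Rdiv_le_0_compat; lra).
rewrite (circ_int_radius _ t s); [|lra|]. 2:{ intros z Hz. apply kernel_ex_cderiv. lra. }
replace (circ_int (fun z => z * / (z - u)) s - RtoC (2 * PI))%C with (circ_int (fun z => z * / (z - u) + - (1))%C s).
2:{ rewrite circ_int_plus, circ_int_const; try lra; try ring; intros z Hz; [|apply ccont_const].
    apply ex_cderiv_ccont, kernel_ex_cderiv; lra. }
rewrite Rmult_comm. apply circ_int_bound; [lra| |].
- intros z Hz. apply ex_cderiv_ccont, ex_cderiv_plus; [apply kernel_ex_cderiv; lra|apply ex_cderiv_const].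
- intros z Hz. assert (Hn : (z - u)%C <> 0%C) by (apply sub_neq_0; lra).
  replace (z * / (z - u) + - (1))%C with (u * / (z - u))%C by (field; auto).
  rewrite Cmod_mult, Cmod_inv by auto. assert (G := Cmod_triangle_rev z u).
  apply Rle_div_l; [lra|]. 
  assert (Cmod u = Cmod u / e * e) by (field; lra). nra.
Qed.

(** The function [z * dquot f (c + u) (z - u)] is holomorphic in the
whole disc and vanishes at the centre, so its mean is [0]; off [z = u] it is
[(f (c + z) - f (c + u)) * z / (z - u)]. *)
Lemma cauchy_formula f c R t u : 0 < t < R -> Cmod u < t -> holo_ball f c R ->
  circ_int (fun z => f (c + z) * (z * / (z - u)))%C t = (RtoC (2 * PI) * f (c + u))%C.
Proof.
intros Ht Hu Hf. 
assert (Hfz : forall z, Cmod z < R -> exists l, cderiv f (c + z)%C l).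
{ intros z Hz. apply Hf. replace (c + z - c)%C with z by ring. auto. }
set (H := fun z => (z * dquot f (c + u) (z - u))%C).
assert (HH : forall z, Cmod z < R -> exists l, cderiv H z l).
{ intros z Hz. apply ex_cderiv_mult; [apply ex_cderiv_id|].
  assert (G : exists l, cderiv (dquot f (c + u)) (z - u)%C l).
  { destruct (excluded_middle_informative ((z - u)%C = 0%C)) as [E|E].
    - rewrite E. apply (dquot_holo_0 f (c + u)%C (R - Cmod u)); [lra|].
      apply (holo_ball_sub f c R); auto. replace (c + u - c)%C with u by ring. lra.
    - apply dquot_holo; auto. replace (c + u + (z - u))%C with (c + z)%C by ring. auto. }
  destruct G as [l Hl]. eexists. apply (cderiv_comp (dquot f (c + u)%C) (fun w => w - u)%C); [exact Hl|].
  apply cderiv_minus; [apply cderiv_id|apply cderiv_const]. }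
assert (E := circ_int_center H R t Ht).
replace (H 0%C) with (RtoC 0) in E by (unfold H; ring). rewrite Cmult_0_r in E.
assert (Hk : forall z, Cmod z = t -> ccont (fun z => z * / (z - u))%C z).
{ intros z Hz. apply ex_cderiv_ccont, kernel_ex_cderiv. lra. }
transitivity (circ_int (fun z => H z + f (c + u) * (z * / (z - u)))%C t).
- apply circ_int_ext; [lra|]. intros z Hz. unfold H.
  assert (Hn : (z - u)%C <> 0%C) by (apply sub_neq_0; lra). rewrite dquot_neq by auto.
  replace (c + u + (z - u))%C with (c + z)%C by ring. ring.
- rewrite circ_int_plus; [|lra| |].
  + rewrite E; [|apply ex_cderiv_ccont, HH; rewrite Cmod_0; lra|intros z Hz; apply HH; lra].
    rewrite circ_int_mult by (auto; lra). rewrite circ_int_kernel by auto. ring.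
  + intros z Hz. apply ex_cderiv_ccont, HH. lra.
  + intros z Hz. apply ccont_mult; auto. apply ccont_const.
Qed.

Lemma ex_cderiv_pow g z n : (exists l, cderiv g z l) -> exists l, cderiv (fun w => (g w) ^ n)%C z l.
Proof.
intros H. induction n; [exact (ex_cderiv_const 1%C z)|]. now apply (ex_cderiv_mult g (fun w => (g w) ^ n)%C).
Qed.

(** A two-constants estimate, with a free parameter [m]. Expand the
Cauchy kernel in powers of [u / z] up to order [m]. The first [m] terms do not depend on the radius of
the circle, and on the circle of radius [r / 2], where [f] is small, they are at most
[eps * 4 ^ n]; the remainder is taken on the circle of radius [4 r] and is at most
[2 M (1 / 2) ^ m]. *)
Lemma smallness_doubling f c r M eps (m : nat) (u : C) : 0 < r -> holo_ball f c (5 * r) ->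
  (forall z, Cmod (z - c)%C < 5 * r -> Cmod (f z) <= M) ->
  (forall z, Cmod (z - c)%C < r -> Cmod (f z) <= eps) ->
  Cmod u < 2 * r -> Cmod (f (c + u)%C) <= eps * 4 ^ m + 2 * M * (/ 2) ^ m.
Proof.
intros Hr Hf HM Heps Hu. assert (Hpi := two_PI_pos). assert (Hu0 := Cmod_ge_0 u).
assert (Hfz : forall z, Cmod z < 5 * r -> exists l, cderiv f (c + z)%C l).
{ intros z Hz. apply Hf. replace (c + z - c)%C with z by ring. auto. }
assert (Hcz : forall z, (c + z - c)%C = z) by (intros; ring).
assert (He0 : 0 <= eps). { eapply Rle_trans; [apply Cmod_ge_0|apply (Heps c)]. rewrite Cmod_self; auto. }
assert (HM0 : 0 <= M). { eapply Rle_trans; [apply Cmod_ge_0|apply (HM c)]. rewrite Cmod_self; lra. }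
set (t := 4 * r). assert (Ht : 0 < t) by (unfold t; lra).
set (q := fun (n : nat) z => ((u * / z) ^ n)%C).
assert (Hq : forall n z, 0 < Cmod z -> exists l, cderiv (q n) z l).
{ intros n z Hz. unfold q. apply ex_cderiv_pow, ex_cderiv_mult; [apply ex_cderiv_const|].
  apply ex_cderiv_inv. now apply Cmod_gt_0. }
(* E n is the Cauchy integral with the kernel replaced by its remainder of order n. *)
set (E := fun n => circ_int (fun z => q n z * (f (c + z) * (z * / (z - u))))%C t).
assert (Hk : forall n z, Cmod z = t -> ccont (fun z => q n z * (f (c + z) * (z * / (z - u))))%C z).
{ intros n z Hz. apply ex_cderiv_ccont, ex_cderiv_mult; [apply Hq; lra|]. apply ex_cderiv_mult.
  - apply ex_cderiv_shift, Hfz. rewrite Hz. unfold t; lra. 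
  - apply kernel_ex_cderiv. rewrite Hz. unfold t. lra. }
assert (Hqf : forall n z, 0 < Cmod z < 5 * r -> exists l, cderiv (fun z => q n z * f (c + z))%C z l).
{ intros n z Hz. apply ex_cderiv_mult; [apply Hq; lra|]. apply ex_cderiv_shift, Hfz. lra. }
assert (Hstep : forall n, Cmod (E n) <= Cmod (E (S n)) + eps * 4 ^ n * (2 * PI)).
{ intros n.
  assert (Eq : E n = (E (S n) + circ_int (fun z => q n z * f (c + z))%C t)%C).
  { unfold E. rewrite <- circ_int_plus; [|lra|auto|].
    - apply circ_int_ext; auto. intros z Hz. unfold q. simpl.
      assert (Hn : (z - u)%C <> 0%C) by (apply sub_neq_0; rewrite Hz; unfold t; lra).
      assert (Hz0 : z <> 0%C) by (apply Cmod_gt_0; lra). field. auto.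
    - intros z Hz. apply ex_cderiv_ccont, Hqf. rewrite Hz; unfold t; lra. }
  rewrite Eq. eapply Rle_trans; [apply Cmod_triangle|]. apply Rplus_le_compat_l.
  rewrite <- (circ_int_radius _ (r / 2) t); [|unfold t; lra|intros z Hz; apply Hqf; unfold t in Hz; lra].
  apply circ_int_bound; [lra| |].
  - intros z Hz. apply ex_cderiv_ccont, Hqf; lra.
  - intros z Hz. unfold q. assert (Hz0 : z <> 0%C) by (apply Cmod_gt_0; lra).
    rewrite Cmod_mult, Cmod_pow, Cmod_mult, Cmod_inv, Hz by auto. rewrite Rmult_comm.
    apply Rmult_le_compat; [apply Cmod_ge_0| |apply Heps; rewrite Hcz; lra|].
    + apply pow_le, Rmult_le_pos; [lra|]. left; apply Rinv_0_lt_compat; lra.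
    + apply pow_incr. split.
      * apply Rmult_le_pos; [lra|]. left; apply Rinv_0_lt_compat; lra.
      * apply Rle_div_l; lra. }
assert (Hsum : forall n, Cmod (E O) <= Cmod (E n) + eps * 4 ^ n * (2 * PI)).
{ induction n.
  { assert (0 <= eps * (2 * PI)) by (apply Rmult_le_pos; lra). simpl pow. lra. } specialize (Hstep n).
  assert (0 < 4 ^ n) by (apply pow_lt; lra). change (4 ^ S n) with (4 * 4 ^ n).
  assert (0 <= eps * 4 ^ n * (2 * PI)) by (apply Rmult_le_pos; [apply Rmult_le_pos; lra|lra]). lra. }
assert (Hlast : Cmod (E m) <= 2 * M * (/ 2) ^ m * (2 * PI)).
{ unfold E. apply circ_int_bound; [exact Ht|exact (Hk m)|]. intros z Hz. unfold q.
  assert (Hz0 : z <> 0%C) by (apply Cmod_gt_0; lra).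
  rewrite Cmod_mult, Cmod_mult, Cmod_pow, Cmod_mult, Cmod_inv, Hz by auto. 
  rewrite Rmult_comm. apply Rmult_le_compat.
  - apply Rmult_le_pos; apply Cmod_ge_0.
  - apply pow_le, Rmult_le_pos; [lra|]. left; apply Rinv_0_lt_compat; lra.
  - rewrite (Rmult_comm 2). apply Rmult_le_compat; try apply Cmod_ge_0.
    + apply HM. rewrite Hcz, Hz. unfold t; lra.
    + eapply Rle_trans; [apply kernel_bound; rewrite Hz; unfold t; lra|]. rewrite Hz.
      apply Rle_div_l; unfold t; lra.
  - apply pow_incr. split.
    * apply Rmult_le_pos; [lra|]. left; apply Rinv_0_lt_compat; lra.
    * apply Rle_div_l; unfold t; lra. }
assert (E0 : E O = (RtoC (2 * PI) * f (c + u))%C).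
{ rewrite <- (cauchy_formula f c (5 * r) t u); auto; [|unfold t; lra|unfold t; lra].
  unfold E. apply circ_int_ext; [exact Ht|]. intros z Hz. unfold q. rewrite Cmult_assoc. symmetry. simpl. ring. }
specialize (Hsum m). rewrite E0, Cmod_mult, Cmod_R, Rabs_pos_eq in Hsum by lra.
apply Rmult_le_reg_l with (2 * PI); auto. lra.
Qed.

(** * Propagation of smallness *)

Lemma exp_le x y : x <= y -> exp x <= exp y.
Proof. intros [H| ->]; [left; now apply exp_increasing|lra]. Qed.

Lemma exp_pow x n : exp x ^ n = exp (INR n * x).
Proof.
induction n; [simpl; now rewrite Rmult_0_l, exp_0|]. rewrite S_INR. simpl. rewrite IHn, <- exp_plus. f_equal. ring.
Qed.

Lemma exp_1_ge_2 : 2 <= exp 1.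
Proof. assert (H := exp_ineq1_le 1). lra. Qed.

Lemma nat_floor x : 0 <= x -> exists n, INR n <= x < INR n + 1.
Proof. intros H. destruct (nfloor_ex x H) as [n Hn]. exists n. exact Hn. Qed.

(** [smallness_doubling] with [m] near [X / 4]: both terms are then of
size [exp (N - X / 8)]. *)
Lemma smallness_step F w r N X : 0 < r -> 0 <= N -> holo_ball F w (5 * r) ->
  (forall z, Cmod (z - w)%C < 5 * r -> Cmod (F z) <= exp N) ->
  (forall z, Cmod (z - w)%C < r -> Cmod (F z) <= exp (- X)) ->
  forall z, Cmod (z - w)%C < 2 * r -> Cmod (F z) <= exp (N + 3 - X / 8).
Proof.
intros Hr HN HF HM HX z Hz.
(* For X <= 0 the global bound is already stronger. *)
destruct (Rle_dec X 0) as [Hn|Hp].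
{ eapply Rle_trans; [apply HM; lra|]. apply exp_le. lra. }
destruct (nat_floor (X / 4)) as [m [Hm1 Hm2]]; [lra|].
assert (B := smallness_doubling F w r (exp N) (exp (- X)) m (z - w)%C Hr HF HM HX Hz).
replace (w + (z - w))%C with z in B by ring. eapply Rle_trans; [exact B|].
assert (E1 : 2 <= exp 1) by apply exp_1_ge_2.
assert (E3 : exp 1 <= 3) by apply exp_le_3.
assert (H4 : 4 ^ m <= exp (X / 2)).
{ apply Rle_trans with (exp 2 ^ m).
  - apply pow_incr. split; [lra|]. replace 2 with (1 + 1) by ring. rewrite exp_plus. nra.
  - rewrite exp_pow. apply exp_le. lra. }
(* The power of 1/2 is compared with exp through 2 >= exp (1/2), that of 4 through 4 <= exp 2. *)
assert (Hh : exp (/ 2) <= 2).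
{ apply Rsqr_incr_0; try lra; [|left; apply exp_pos]. unfold Rsqr. rewrite <- exp_plus. replace (/ 2 + / 2) with 1 by field. lra. }
assert (H2 : (/ 2) ^ m <= 2 * exp (- (X / 8))).
{ replace ((/ 2) ^ m) with (2 * (/ 2) ^ S m) by (simpl; field).
  apply Rmult_le_compat_l; [lra|]. apply Rle_trans with (exp (- / 2) ^ S m).
  - apply pow_incr. split; [lra|]. rewrite exp_Ropp. apply Rinv_le_contravar; auto. apply exp_pos.
  - rewrite exp_pow, S_INR. apply exp_le. lra. }
assert (T1 : exp (- X) * 4 ^ m <= exp (- (X / 8))).
{ apply Rle_trans with (exp (- X) * exp (X / 2)).
  - apply Rmult_le_compat_l; auto. left; apply exp_pos.
  - rewrite <- exp_plus. apply exp_le. lra. }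
replace (N + 3 - X / 8) with (N + (1 + (1 + 1)) + - (X / 8)) by ring. rewrite !exp_plus.
assert (PN : 1 <= exp N) by (rewrite <- exp_0; now apply exp_le).
assert (PX := exp_pos (- (X / 8))).
set (a := exp (- (X / 8))) in *. set (b := exp N) in *.
apply Rle_trans with (a + 2 * b * (2 * a)).
- apply Rplus_le_compat; auto. apply Rmult_le_compat_l; lra.
- assert (5 <= exp 1 * (exp 1 * exp 1)) by nra.
  apply Rle_trans with (b * 5 * a); [nra|]. apply Rmult_le_compat_r; [lra|]. apply Rmult_le_compat_l; lra.
Qed.

(** The form that can be iterated: with the offset
[2 (N + 3)], the additive loss of one step is absorbed, and [Y] is just divided by [8]. *)
Lemma smallness_step_shifted F w r N Y : 0 < r -> 0 <= N -> holo_ball F w (5 * r) ->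
  (forall z, Cmod (z - w)%C < 5 * r -> Cmod (F z) <= exp N) ->
  (forall z, Cmod (z - w)%C < r -> Cmod (F z) <= exp (2 * (N + 3) - Y)) ->
  forall z, Cmod (z - w)%C < 2 * r -> Cmod (F z) <= exp (2 * (N + 3) - Y / 8).
Proof.
intros Hr HN HF HM HX z Hz.
eapply Rle_trans; [apply (smallness_step F w r N (Y - 2 * (N + 3))); auto|].
- intros z' Hz'. replace (- (Y - 2 * (N + 3))) with (2 * (N + 3) - Y) by ring. auto.
- apply exp_le. lra.
Qed.

(** First [n1] doublings of the disc around [w0], then [n2] moves by
at most [rho] along the segment from [w0] to [wp]. At each move the doubled disc around a
point contains the disc of radius [rho] around the next one. A strip is convex, so the
segment stays in it. *)
Lemma smallness_propagation F lo hi rho N Y w0 wp (n1 n2 : nat) : 0 < rho -> 0 <= N ->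
  (forall z, lo < fst z < hi -> exists l, cderiv F z l) ->
  (forall z, lo < fst z < hi -> Cmod (F z) <= exp N) ->
  lo + 5 * rho <= fst w0 <= hi - 5 * rho -> lo + 5 * rho <= fst wp <= hi - 5 * rho ->
  Cmod (wp - w0)%C <= INR n2 * rho ->
  (forall z, Cmod (z - w0)%C < rho / 2 ^ n1 -> Cmod (F z) <= exp (2 * (N + 3) - Y)) ->
  Cmod (F wp) <= exp (2 * (N + 3) - Y / 8 ^ (n1 + n2)).
Proof.
intros Hrho HN HF HM H0 Hp Hdist Hsmall.
assert (Hin : forall w r, lo + 5 * rho <= fst w <= hi - 5 * rho -> r <= 5 * rho -> 
   forall z, Cmod (z - w)%C < r -> lo < fst z < hi).
{ intros w r Hw Hr z Hz. assert (G := fst_le_Cmod (z - w)%C). simpl in G. apply Rle_lt_trans with (2 := Hz) in G.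
  apply Rabs_def2 in G. lra. }
assert (S1 : forall n, (n <= n1)%nat -> forall z, Cmod (z - w0)%C < rho / 2 ^ (n1 - n) ->
   Cmod (F z) <= exp (2 * (N + 3) - Y / 8 ^ n)).
{ induction n; intros Hn.
  - rewrite Nat.sub_0_r. simpl pow. rewrite Rdiv_1_r. exact Hsmall.
  - replace (8 ^ S n) with (8 ^ n * 8) by (simpl; ring). 
    replace (Y / (8 ^ n * 8)) with (Y / 8 ^ n / 8) by (field; apply pow_nonzero; lra).
    assert (E : 2 ^ (n1 - n) = 2 * 2 ^ (n1 - S n)). { replace (n1 - n)%nat with (S (n1 - S n)) by lia. reflexivity. }
    assert (P2 : 1 <= 2 ^ (n1 - S n)) by (apply pow_R1_Rle; lra).
    set (r := rho / 2 ^ (n1 - n)).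
    replace (rho / 2 ^ (n1 - S n)) with (2 * r) by (unfold r; rewrite E; field; lra).
    assert (Hr : 0 < r). { unfold r. apply Rdiv_lt_0_compat; auto. rewrite E; lra. }
    assert (Hr2 : 5 * r <= 5 * rho). { unfold r. apply Rmult_le_compat_l; [lra|]. apply Rle_div_l; rewrite E; nra. }
    apply smallness_step_shifted; auto.
    + intros z Hz. apply HF. apply (Hin w0 (5 * r)); auto.
    + intros z Hz. apply HM. apply (Hin w0 (5 * r)); auto.
    + apply IHn. lia. }
specialize (S1 n1 (Nat.le_refl n1)). rewrite Nat.sub_diag in S1. simpl pow in S1 at 1. rewrite Rdiv_1_r in S1.
destruct n2 as [|n2].
{ rewrite Nat.add_0_r. apply S1. simpl in Hdist. lra. }
set (h := ((wp - w0) * / RtoC (INR (S n2)))%C).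
assert (Hn2 : 0 < INR (S n2)) by (apply lt_0_INR; lia).
assert (Hnn : RtoC (INR (S n2)) <> 0%C) by (apply Cmod_gt_0; rewrite Cmod_R, Rabs_pos_eq; lra).
assert (Hh : Cmod h <= rho).
{ unfold h. rewrite Cmod_mult, Cmod_inv, Cmod_R, Rabs_pos_eq by (auto; lra). apply Rle_div_l; lra. }
assert (Hstrip : forall i, (i <= S n2)%nat -> lo + 5 * rho <= fst (w0 + RtoC (INR i) * h)%C <= hi - 5 * rho).
{ intros i Hi. unfold h. set (s := INR i / INR (S n2)).
  assert (Hs : 0 <= s <= 1). { unfold s. split; [apply Rdiv_le_0_compat; auto; apply pos_INR|]. apply Rle_div_l; auto. rewrite Rmult_1_l. now apply le_INR. }
  replace (w0 + RtoC (INR i) * ((wp - w0) * / RtoC (INR (S n2))))%C with (w0 + RtoC s * (wp - w0))%C.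
  2:{ unfold s. rewrite RtoC_div by lra. field. auto. }
  simpl. clearbody s. nra. }
assert (S2 : forall i, (i <= S n2)%nat -> forall z, Cmod (z - (w0 + RtoC (INR i) * h))%C < rho ->
   Cmod (F z) <= exp (2 * (N + 3) - Y / 8 ^ (n1 + i))).
{ induction i; intros Hi z Hz.
  - rewrite Nat.add_0_r. apply S1. simpl INR in Hz. rewrite Cmult_0_l, Cplus_0_r in Hz. exact Hz.
  - rewrite Nat.add_succ_r. replace (8 ^ S (n1 + i)) with (8 ^ (n1 + i) * 8) by (simpl; ring).
    replace (Y / (8 ^ (n1 + i) * 8)) with (Y / 8 ^ (n1 + i) / 8) by (field; apply pow_nonzero; lra).
    apply (smallness_step_shifted F (w0 + RtoC (INR i) * h)%C rho); auto.
    + intros z' Hz'. apply HF. apply (Hin (w0 + RtoC (INR i) * h)%C (5 * rho)); auto; try lra. apply Hstrip; lia.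
    + intros z' Hz'. apply HM. apply (Hin (w0 + RtoC (INR i) * h)%C (5 * rho)); auto; try lra. apply Hstrip; lia.
    + apply IHi. lia.
    + rewrite S_INR in Hz. 
      replace (z - (w0 + RtoC (INR i) * h))%C with ((z - (w0 + RtoC (INR i + 1) * h)) + h)%C by (rewrite RtoC_plus; ring).
      eapply Rle_lt_trans; [apply Cmod_triangle|]. lra. }
apply (S2 (S n2) (Nat.le_refl _)).
replace (wp - (w0 + RtoC (INR (S n2)) * h))%C with (RtoC 0). { rewrite Cmod_0. auto. }
unfold h. field. auto.
Qed.

Lemma polar_form (z : C) : z <> 0%C -> exists th, 0 <= th <= 2 * PI /\ z = cexp (ln (Cmod z), th).
Proof.
intros Hz. assert (Hm : 0 < Cmod z) by now apply Cmod_gt_0. set (m := Cmod z) in *.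
assert (Hpi := PI_RGT_0).
assert (Hfst := fst_le_Cmod z). fold m in Hfst.
set (x := fst z / m).
assert (Hx : -1 <= x <= 1).
{ apply Rabs_le_between in Hfst. unfold x. split; [apply Rle_div_r|apply Rle_div_l]; lra. }
assert (Hy : (snd z / m) * (snd z / m) = 1 - x * x).
{ assert (E := Cmod2_alt z). fold m in E. unfold Re, Im in E. unfold x.
  replace (snd z / m * (snd z / m)) with (snd z ^ 2 / m ^ 2) by (field; lra).
  replace (fst z / m * (fst z / m)) with (fst z ^ 2 / m ^ 2) by (field; lra).
  rewrite E. field. nra. }
assert (Hs : sin (acos x) = sqrt (1 - Rsqr x)) by (apply sin_acos; lra).
assert (Hb := acos_bound x). assert (Hc := cos_acos x Hx).
assert (Hyy : Rsqr (snd z / m) = 1 - Rsqr x) by exact Hy.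
assert (Hform : forall th, cos th = x -> sin th = snd z / m -> z = cexp (ln m, th)).
{ intros th H1 H2. unfold cexp; simpl. rewrite exp_ln, H1, H2 by auto. destruct z as [z1 z2]. unfold x; simpl. f_equal; field; lra. }
destruct (Rle_dec 0 (snd z)) as [Hpos|Hneg].
- exists (acos x). split; [lra|]. apply Hform; auto. rewrite Hs, <- Hyy. apply sqrt_Rsqr. apply Rdiv_le_0_compat; lra.
- exists (2 * PI - acos x). split; [lra|]. apply Hform.
  + rewrite cos_minus, cos_2PI, sin_2PI, Hc. ring.
  + rewrite sin_minus, cos_2PI, sin_2PI, Hs, <- Hyy.
    replace (Rsqr (snd z / m)) with (Rsqr (- (snd z / m))) by (symmetry; apply Rsqr_neg).
    rewrite sqrt_Rsqr. ring. replace (- (snd z / m)) with ((- snd z) / m) by (field; lra). apply Rdiv_le_0_compat; lra.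
Qed.

(** The annulus is the image by [cexp] of a compact rectangle. *)
Lemma annulus_bounded f r1 r2 : 0 < r1 <= r2 -> (forall z, r1 <= Cmod z <= r2 -> ccont f z) ->
  exists M, forall z, r1 <= Cmod z <= r2 -> Cmod (f z) <= M.
Proof.
intros Hr Hc. assert (Hpi := two_PI_pos).
assert (Hln : forall a b, 0 < a -> a <= b -> ln a <= ln b).
{ intros a b Ha [H| ->]; [left; now apply ln_increasing|lra]. }
destruct (cont_rect_bounded (fun w => f (cexp w)) (ln r1) (ln r2) 0 (2 * PI)) as [M HM]; try lra.
- apply Hln; lra.
- intros x y Hx Hy. assert (G : ccont f (cexp (x, y))).
  { apply Hc. rewrite Cmod_cexp; simpl. rewrite <- (exp_ln r1), <- (exp_ln r2) by lra. split; apply exp_le; lra. }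
  intros e He. destruct (G e He) as [d [Hd Hw]].
  destruct (cderiv_cont cexp (x, y) _ (cderiv_cexp (x, y)) d Hd) as [d' [Hd' Hw']]. exists d'. split; auto.
- exists M. intros z Hz. destruct (polar_form z) as [th [Hth E]]. { apply Cmod_gt_0; lra. }
  rewrite E. apply HM; auto. split; apply Hln; lra.
Qed.

(** * Ingredients of the lower bound *)

Lemma sum_n_tail_bound (g : nat -> C) (n : nat) (b : R) :
  (forall j, (1 <= j <= n)%nat -> Cmod (g j) <= b) ->
  Cmod (@sum_n C_AbelianGroup g n - g O)%C <= INR n * b.
Proof.
induction n; intros H.
- rewrite sum_O, Cmod_self. simpl. lra.
- rewrite sum_Sn, S_INR. change (plus (@sum_n C_AbelianGroup g n) (g (S n))) with (@sum_n C_AbelianGroup g n + g (S n))%C.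
  replace (@sum_n C_AbelianGroup g n + g (S n) - g O)%C with ((@sum_n C_AbelianGroup g n - g O) + g (S n))%C by ring.
  eapply Rle_trans; [apply Cmod_triangle|]. 
  assert (Cmod (@sum_n C_AbelianGroup g n - g O)%C <= INR n * b) by (apply IHn; intros; apply H; lia).
  assert (Cmod (g (S n)) <= b) by (apply H; lia). lra.
Qed.

(** Solved for [A_0 f], the equation expresses [f z] by derivatives at
[z], which Cauchy's estimates on the disc of radius [k rho] bound by the supremum of
[|f|] there over [rho ^ k]. The numerical hypothesis says that the resulting factor is
at most [1 / e]. Each round shrinks the disc by [k rho]. *)
Lemma ode_contraction (f : C -> C) (A : nat -> C -> C) (k : nat) (z0 : C) (d rho a0 B S : R) :
  (1 <= k)%nat -> 0 < rho <= 1 -> 0 < a0 -> 1 <= B ->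
  INR k * B * exp 1 <= a0 * rho ^ k ->
  holo_ball f z0 d ->
  (forall z, Cmod (z - z0)%C < d ->
    (C_derive_n f k z + @sum_n C_AbelianGroup (fun j => A j z * C_derive_n f j z) (k - 1) = 0)%C) ->
  (forall z, Cmod (z - z0)%C < d -> a0 <= Cmod (A O z)) ->
  (forall j z, (1 <= j < k)%nat -> Cmod (z - z0)%C < d -> Cmod (A j z) <= B) ->
  (forall z, Cmod (z - z0)%C < d -> Cmod (f z) <= S) ->
  forall i z, Cmod (z - z0)%C < d - INR i * (INR k * rho) -> Cmod (f z) <= S * exp (- INR i).
Proof.
intros Hk Hrho Ha0 HB Hcond Hf Hode HA0 HAj HS. 
assert (Hk1 : 1 <= INR k). { change 1 with (INR 1). now apply le_INR. }
induction i; intros z Hz.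
- simpl INR in *. rewrite Ropp_0, exp_0, Rmult_1_r. apply HS. lra.
- rewrite S_INR in Hz. assert (Hi := pos_INR i).
  set (Si := S * exp (- INR i)) in *.
  (* The largest disc around z on which the bound of round i is known; its radius exceeds k rho, which the k-th derivative consumes. *)
  set (R := d - INR i * (INR k * rho) - Cmod (z - z0)%C).
  assert (HkR : INR k * rho < R) by (unfold R; nra).
  assert (Hkr : 0 < INR k * rho) by nra.
  assert (Hikr : 0 <= INR i * (INR k * rho)) by (apply Rmult_le_pos; lra).
  assert (Hzd : Cmod (z - z0)%C < d) by nra.
  assert (Hfz : holo_ball f z R). { apply (holo_ball_sub f z0 d); auto. unfold R. lra. }
  assert (HSz : forall w, Cmod (w - z)%C < R -> Cmod (f w) <= Si).
  { intros w Hw. apply IHi. apply (in_ball_trans w z0 z _ R); auto. unfold R; lra. }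
  assert (HSi : 0 <= Si). { eapply Rle_trans; [apply Cmod_ge_0|]. apply (HSz z). rewrite Cmod_self. lra. }
  assert (Hpk : 0 < rho ^ k) by (apply pow_lt; lra).
  assert (Hder : forall j, (j <= k)%nat -> Cmod (C_derive_n f j z) <= Si / rho ^ k).
  { intros j Hj. eapply Rle_trans; [apply (cauchy_estimate_n f z R rho Si j); auto; try lra|].
    - rewrite Cmod_self. assert (INR j <= INR k) by now apply le_INR. nra.
    - apply Rmult_le_compat_l; auto. apply Rinv_le_contravar; auto.
      replace k with (j + (k - j))%nat by lia. rewrite pow_add.
      assert (0 < rho ^ j) by (apply pow_lt; lra). assert (rho ^ (k - j) <= 1).
      { rewrite <- (pow1 (k - j)). apply pow_incr. lra. } nra. }
  assert (Hsum : Cmod (A O z * f z)%C <= INR k * B * (Si / rho ^ k)).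
  { assert (T := sum_n_tail_bound (fun j => A j z * C_derive_n f j z)%C (k - 1) (B * (Si / rho ^ k))).
    specialize (Hode z Hzd). set (sm := @sum_n C_AbelianGroup (fun j => (A j z * C_derive_n f j z)%C) (k - 1)) in *.
    change (C_derive_n f O z) with (f z) in T. cbv beta in T. 
    change (C_derive_n f O z) with (f z) in T.
    replace (A O z * f z)%C with (- ((sm - A O z * f z) + C_derive_n f k z) + (C_derive_n f k z + sm))%C by ring.
    rewrite Hode, Cplus_0_r, Cmod_opp. eapply Rle_trans; [apply Cmod_triangle|].
    assert (Hd0 : 0 <= Si / rho ^ k) by (apply Rdiv_le_0_compat; auto).
    assert (Hk' : INR (k - 1) = INR k - 1) by (rewrite minus_INR; auto).
    rewrite Hk' in T.
    assert (T' : Cmod (sm - A O z * f z)%C <= (INR k - 1) * (B * (Si / rho ^ k))).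
    { apply T. intros j Hj. rewrite Cmod_mult. apply Rmult_le_compat; try apply Cmod_ge_0.
      - apply HAj; auto. lia. - apply Hder. lia. }
    specialize (Hder k (Nat.le_refl k)). 
    assert (Si / rho ^ k <= B * (Si / rho ^ k)) by nra. lra. }
  rewrite Cmod_mult in Hsum. specialize (HA0 z Hzd). assert (Hf0 := Cmod_ge_0 (f z)).
  rewrite S_INR. replace (- (INR i + 1)) with (- INR i + - (1)) by ring. rewrite exp_plus, <- Rmult_assoc. fold Si.
  rewrite exp_Ropp. assert (He := exp_pos 1).
  apply Rmult_le_reg_l with (a0 * rho ^ k); [now apply Rmult_lt_0_compat|].
  apply Rle_trans with (INR k * B * Si).
  + replace (a0 * rho ^ k * Cmod (f z)) with (a0 * Cmod (f z) * rho ^ k) by ring.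
    replace (INR k * B * Si) with (INR k * B * (Si / rho ^ k) * rho ^ k) by (field; lra).
    apply Rmult_le_compat_r; [lra|]. nra.
  + replace (INR k * B * Si) with (INR k * B * exp 1 * (Si * / exp 1)) by (field; lra).
    apply Rmult_le_compat_r; auto. apply Rmult_le_pos; auto. left; now apply Rinv_0_lt_compat.
Qed.

(** The point nearly maximizes
[|z|^a * min ((|z| / s)^p, s / |z|) * ln |A0 z|], where [|z| = s] is a radius at which the
lower bound on [A0] holds. The factor [min] is [1] at [|z| = s], so the maximum is at
least [K]. The power [p] bounds the supremum near [0], and the factor [s / |z|] keeps the
maximizing point close to [0] when [s] is small. As the logarithm of the weight is Lipschitz
in [ln |z|], the near maximality at [z0] bounds [ln |A0|] at all points of comparable
modulus. This holds on both sides of [|z0|] without monotonicity of the maximum modulus, and whether or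
not [A0] has finite type. *)
Lemma select_point (A0 : C -> C) (a p K s1 nu r1 : R) : 0 < a -> 1 <= p -> 0 < K -> 0 < s1 <= 1 -> 0 < nu ->
  0 < r1 <= s1 ->
  (forall s, 0 < s -> exists z, 0 < Cmod z < s /\ exp (K * exp (- a * ln (Cmod z))) <= Cmod (A0 z)) ->
  (forall z, 0 < Cmod z < s1 -> Cmod (A0 z) <= exp (exp (- p * ln (Cmod z)))) ->
  exists z0 L, 0 < Cmod z0 < r1 /\ Cmod (A0 z0) = exp L /\
    K * exp (- nu) * exp (- a * ln (Cmod z0)) <= L /\
    forall z, 0 < Cmod z < s1 -> Rabs (ln (Cmod z) - ln (Cmod z0)) <= nu ->
      Cmod (A0 z) <= exp (L * exp ((a + p + 1) * nu)).
Proof.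
intros Ha Hp HK Hs1 Hnu Hr1 H2 H3.
assert (Hbig : 0 < Rmin r1 (K * exp (- nu) * exp ((p + 1) * ln r1))).
{ apply Rmin_glb_lt; [lra|]. repeat apply Rmult_lt_0_compat; auto using exp_pos. }
destruct (H2 _ Hbig) as [zs [Hzs HAs]].
set (s := Cmod zs) in *. destruct Hzs as [Hs0 Hs].
assert (Hs2 := Rlt_le_trans _ _ _ Hs (Rmin_l _ _)). assert (Hs3 := Rlt_le_trans _ _ _ Hs (Rmin_r _ _)).
set (la := ln s) in *.
set (W := fun l => a * l + Rmin (p * (l - la)) (la - l)).
assert (HW1 : forall l, W l <= a * l).
{ intros l. unfold W. destruct (Rle_dec l la).
  - assert (Rmin (p * (l - la)) (la - l) <= p * (l - la)) by apply Rmin_l. nra.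
  - assert (Rmin (p * (l - la)) (la - l) <= la - l) by apply Rmin_r. lra. }
assert (HW2 : forall l l', Rabs (l - l') <= nu -> W l' - (a + p) * nu <= W l).
{ intros l l' Hl. apply Rabs_le_between in Hl. unfold W.
  assert (Rmin (p * (l' - la)) (la - l') - p * nu <= Rmin (p * (l - la)) (la - l)).
  { apply Rmin_glb.
    - assert (Rmin (p * (l' - la)) (la - l') <= p * (l' - la)) by apply Rmin_l. nra.
    - assert (Rmin (p * (l' - la)) (la - l') <= la - l') by apply Rmin_r. nra. }
  nra. }
assert (Hln : forall z, 0 < Cmod z < s1 -> ln (Cmod z) <= 0).
{ intros z Hz. rewrite <- ln_1. left. apply ln_increasing; lra. }
set (G := fun x => exists z, 0 < Cmod z < s1 /\ 0 < Cmod (A0 z) /\ x = exp (W (ln (Cmod z))) * ln (Cmod (A0 z))).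
assert (HlnA : forall z, 0 < Cmod z < s1 -> 0 < Cmod (A0 z) -> ln (Cmod (A0 z)) <= exp (- p * ln (Cmod z))).
{ intros z Hz Hz0. rewrite <- (ln_exp (exp _)). destruct (H3 z Hz) as [H|H]; [left; now apply ln_increasing|right; now rewrite H]. }
destruct (completeness G) as [Ga [HG1 HG2]].
{ exists (exp (- p * la)). intros x [z [Hz [Hz0 ->]]].
  specialize (HlnA z Hz Hz0). specialize (Hln z Hz).
  apply Rle_trans with (exp (W (ln (Cmod z))) * exp (- p * ln (Cmod z))).
  - apply Rmult_le_compat_l; auto. left; apply exp_pos.
  - rewrite <- exp_plus. apply exp_le. unfold W.
    assert (Rmin (p * (ln (Cmod z) - la)) (la - ln (Cmod z)) <= p * (ln (Cmod z) - la)) by apply Rmin_l. nra. }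
{ exists (exp (W la) * ln (Cmod (A0 zs))). exists zs. fold s. split; [lra|]. split; [|reflexivity].
  eapply Rlt_le_trans; [apply exp_pos|exact HAs]. }
assert (HGK : K <= Ga).
{ eapply Rle_trans; [|apply HG1; exists zs; split; [fold s; lra|split; [|reflexivity]]].
  2:{ eapply Rlt_le_trans; [apply exp_pos|exact HAs]. }
  fold s la. assert (HlnAs : K * exp (- a * la) <= ln (Cmod (A0 zs))).
  { rewrite <- (ln_exp (K * _)). destruct HAs as [H|H]; [left; apply ln_increasing; auto using exp_pos|right; now rewrite H]. }
  apply Rle_trans with (exp (W la) * (K * exp (- a * la))).
  - replace (exp (W la) * (K * exp (- a * la))) with (K * (exp (W la) * exp (- a * la))) by ring.
    rewrite <- exp_plus. unfold W. replace (la - la) with 0 by ring. rewrite Rmult_0_r, Rmin_left by lra.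
    replace (a * la + 0 + - a * la) with 0 by ring. rewrite exp_0. lra.
  - apply Rmult_le_compat_l; auto. left; apply exp_pos. }
assert (Hnu1 : exp (- nu) < 1) by (rewrite <- exp_0; apply exp_increasing; lra).
assert (Hnu0 := exp_pos (- nu)).
(* The supremum is approached up to the factor exp (- nu), so that it need not be attained. *)
assert (Hex : exists z0, 0 < Cmod z0 < s1 /\ 0 < Cmod (A0 z0) /\ exp (- nu) * Ga < exp (W (ln (Cmod z0))) * ln (Cmod (A0 z0))).
{ apply NNPP. intros Hno. assert (Ga <= exp (- nu) * Ga); [|nra].
  apply HG2. intros x [z [Hz [Hz0 ->]]]. apply Rnot_lt_le. intros Hlt. apply Hno. exists z. auto. }
destruct Hex as [z0 [Hz0 [HA0 Hmax]]].
set (l0 := ln (Cmod z0)) in *. set (L := ln (Cmod (A0 z0))) in *.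
assert (HW0 := exp_pos (W l0)).
assert (HKL : K * exp (- nu) < exp (W l0) * L) by nra.
assert (HL : 0 < L) by nra.
exists z0, L. split; [|split; [|split]].
- split; [lra|]. apply Rnot_le_lt; intros Hge.
  assert (Hl1 : ln r1 <= l0). { unfold l0. destruct Hge as [H|H]; [left; apply ln_increasing; lra|right; now rewrite H]. }
  assert (HLb := HlnA z0 Hz0 HA0). fold L l0 in HLb.
  assert (Hl0 := Hln z0 Hz0). fold l0 in Hl0.
  assert (HWb : W l0 <= la - l0).
  { unfold W. assert (Rmin (p * (l0 - la)) (la - l0) <= la - l0) by apply Rmin_r. nra. }
  assert (C1 : exp (W l0) * L <= exp (la - (p + 1) * ln r1)).
  { apply Rle_trans with (exp (la - l0) * exp (- p * l0)).
    - apply Rmult_le_compat; auto; try lra. now apply exp_le.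
    - rewrite <- exp_plus. apply exp_le. nra. }
  assert (C2 : exp (la - (p + 1) * ln r1) < K * exp (- nu)).
  { unfold Rminus. rewrite exp_plus. unfold la. rewrite exp_ln by auto. rewrite exp_Ropp.
    apply Rlt_div_l; [apply exp_pos|exact Hs3]. }
  lra.
- unfold L. now rewrite exp_ln.
- fold l0. apply Rmult_le_reg_l with (exp (a * l0)); [apply exp_pos|].
  replace (exp (a * l0) * (K * exp (- nu) * exp (- a * l0))) with (K * exp (- nu) * (exp (a * l0) * exp (- a * l0))) by ring.
  rewrite <- exp_plus. replace (a * l0 + - a * l0) with 0 by ring. rewrite exp_0, Rmult_1_r.
  apply Rlt_le, Rlt_le_trans with (1 := HKL). apply Rmult_le_compat_r; [lra|]. apply exp_le, HW1.
- intros z Hz Hdist. destruct (Rle_lt_dec (Cmod (A0 z)) 0) as [Hle|Hpos].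
  { eapply Rle_trans; [exact Hle|]. left; apply exp_pos. }
  rewrite <- (exp_ln (Cmod (A0 z))) by auto. apply exp_le.
  assert (HGz : exp (W (ln (Cmod z))) * ln (Cmod (A0 z)) <= Ga). { apply HG1. exists z. auto. }
  destruct (Rle_dec (ln (Cmod (A0 z))) 0) as [Hn|Hn].
  { apply Rle_trans with 0; auto. apply Rmult_le_pos; [lra|]. left; apply exp_pos. }
  specialize (HW2 _ _ Hdist). apply exp_le in HW2. fold l0 in HW2. unfold Rminus in HW2. rewrite exp_plus in HW2.
  set (x := ln (Cmod (A0 z))) in *.
  assert (Q1 : exp (W l0) * exp (- ((a + p) * nu)) * x <= Ga).
  { eapply Rle_trans; [|exact HGz]. apply Rmult_le_compat_r; lra. }
  assert (Q2 : exp (W l0) * x <= Ga * exp ((a + p) * nu)).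
  { replace (exp (W l0) * x) with (exp (W l0) * exp (- ((a + p) * nu)) * x * exp ((a + p) * nu)).
    - apply Rmult_le_compat_r; auto. left; apply exp_pos.
    - rewrite exp_Ropp. field. apply Rgt_not_eq, exp_pos. }
  assert (Q3 : Ga <= exp (W l0) * L * exp nu).
  { replace Ga with (exp (- nu) * Ga * exp nu). 
    - apply Rmult_le_compat_r; [left; apply exp_pos|lra].
    - rewrite exp_Ropp. field. apply Rgt_not_eq, exp_pos. }
  apply Rmult_le_reg_l with (exp (W l0)); auto.
  eapply Rle_trans; [exact Q2|]. 
  replace ((a + p + 1) * nu) with (nu + (a + p) * nu) by ring. rewrite exp_plus.
  replace (exp (W l0) * (L * (exp nu * exp ((a + p) * nu)))) with (exp (W l0) * L * exp nu * exp ((a + p) * nu)) by ring.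
  apply Rmult_le_compat_r; auto. left; apply exp_pos.
Qed.

(** Here [l] stands for [- ln r], so that powers of [1 / r] are compared. The linear term is
reduced to an exponential by [b * l <= exp (b * l)]. *)
Lemma exp_beats (c Cst P b a : R) : 0 < c -> 0 < b -> b < a ->
  exists l0, 0 < l0 /\ forall l, l0 < l -> Cst + P * l + exp (b * (1 + l)) < c * exp (a * l).
Proof.
intros Hc Hb Hab. set (D := Rabs Cst + Rabs P / b + exp b).
assert (HD : 0 < D).
{ unfold D. assert (H1 := Rabs_pos Cst). assert (H2 := exp_pos b). 
  assert (0 <= Rabs P / b) by (apply Rdiv_le_0_compat; auto using Rabs_pos). lra. }
exists (D / c / (a - b)). split. { repeat apply Rdiv_lt_0_compat; lra. }
intros l Hl. assert (Hl0 : 0 < l). { eapply Rlt_trans; [|exact Hl]. repeat apply Rdiv_lt_0_compat; lra. }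
assert (E1 : 1 + b * l <= exp (b * l)) by apply exp_ineq1_le.
assert (E2 : 1 + (a - b) * l <= exp ((a - b) * l)) by apply exp_ineq1_le.
assert (Hbl : 0 < b * l) by (apply Rmult_lt_0_compat; lra).
replace (a * l) with (b * l + (a - b) * l) by ring. rewrite exp_plus.
replace (b * (1 + l)) with (b + b * l) by ring. rewrite exp_plus.
set (x := exp (b * l)) in *.
apply Rle_lt_trans with (D * x).
- unfold D. assert (Cst <= Rabs Cst * x). { assert (G := Rle_abs Cst). assert (G' := Rabs_pos Cst). nra. }
  assert (P * l <= Rabs P / b * x).
  { apply Rle_trans with (Rabs P * l). { apply Rmult_le_compat_r; [lra|apply Rle_abs]. }
    replace (Rabs P * l) with (Rabs P / b * (b * l)) by (field; lra). apply Rmult_le_compat_l; [|lra].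
    apply Rdiv_le_0_compat; auto using Rabs_pos. }
  lra.
- replace (c * (x * exp ((a - b) * l))) with ((c * exp ((a - b) * l)) * x) by ring. apply Rmult_lt_compat_r; [lra|].
  assert (D / c < (a - b) * l). { apply Rlt_div_l in Hl; lra. }
  apply (proj1 (Rlt_div_l D ((a - b) * l) c Hc)) in H.
  assert (c * (1 + (a - b) * l) <= c * exp ((a - b) * l)) by (apply Rmult_le_compat_l; lra). lra.
Qed.

Lemma pow2_between x : 1 <= x -> exists n, x <= 2 ^ n <= 2 * x.
Proof.
intros Hx. 
assert (Hex : exists n, x <= 2 ^ n).
{ destruct (nat_floor x) as [n Hn]; [lra|]. exists (S n). 
  assert (H : INR n + 1 <= 2 ^ S n). { clear. induction n; [simpl; lra|]. rewrite S_INR. change (2 ^ S (S n)) with (2 * 2 ^ S n). assert (0 <= INR n) by apply pos_INR. lra. }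
  lra. }
destruct Hex as [n Hn]. revert Hn. induction n; intros Hn.
- exists O. simpl in *. lra.
- destruct (Rle_dec x (2 ^ n)) as [H|H]; auto. exists (S n). simpl in *. lra.
Qed.

(** * Smallness of a solution where A_0 dominates *)

(** The Cauchy estimate for the derivative of [A_0], which is at
most of size [exp ((1 + eta) L) / R], keeps [|A_0| >= exp L / 2] on a disc of radius
[R exp (- eta L) / 4]. On it [ode_contraction] applies with
[rho ^ k = 2 k e exp (- (1 - theta) L)], until the radius is halved. *)
Lemma ode_local_smallness (f : C -> C) (A : nat -> C -> C) (k : nat) (z0 : C) (R L theta eta N : R) :
  (1 <= k)%nat -> 0 < R -> 0 <= L -> 0 <= theta -> 0 <= eta ->
  (ln (2 * INR k) + 1) / INR k <= (1 - theta) / INR k * L ->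
  holo_ball f z0 R -> holo_ball (A O) z0 R ->
  (forall z, Cmod (z - z0)%C < R ->
    (C_derive_n f k z + @sum_n C_AbelianGroup (fun j => A j z * C_derive_n f j z) (k - 1) = 0)%C) ->
  Cmod (A O z0) = exp L ->
  (forall z, Cmod (z - z0)%C < R -> Cmod (A O z) <= exp ((1 + eta) * L)) ->
  (forall j z, (1 <= j < k)%nat -> Cmod (z - z0)%C < R -> Cmod (A j z) <= exp (theta * L)) ->
  (forall z, Cmod (z - z0)%C < R -> Cmod (f z) <= exp N) ->
  exists i : nat, 
    R * exp (- (eta * L)) / (8 * INR k) * exp ((1 - theta) / INR k * L - (ln (2 * INR k) + 1) / INR k) - 1 <= INR i /\
    forall z, Cmod (z - z0)%C < R * exp (- (eta * L)) / 8 -> Cmod (f z) <= exp (N - INR i).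
Proof.
intros Hk HR HL Hth Heta Hsmall Hf HA Hode HA0 HAb HAj HN.
assert (Hk1 : 1 <= INR k). { change 1 with (INR 1). now apply le_INR. }
set (q := exp (- (eta * L))). assert (Hq : 0 < q) by apply exp_pos.
assert (Hq1 : q <= 1). { unfold q. rewrite <- exp_0. apply exp_le. assert (0 <= eta * L) by now apply Rmult_le_pos. lra. }
set (d := R * q / 4). assert (Hd : 0 < d). { unfold d. apply Rdiv_lt_0_compat; [now apply Rmult_lt_0_compat|lra]. }
assert (HdR : d <= R / 4). { unfold d. apply Rmult_le_compat_r; nra. }
set (E := (1 - theta) / INR k * L - (ln (2 * INR k) + 1) / INR k) in *.
(* With this choice the hypothesis of the contraction lemma is an equality. *)
set (rho := exp (- E)). assert (Hrho : 0 < rho) by apply exp_pos.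
assert (Hrho1 : rho <= 1). { unfold rho. rewrite <- exp_0. apply exp_le. unfold E. lra. }
assert (HA0low : forall z, Cmod (z - z0)%C < d -> exp L / 2 <= Cmod (A O z)).
{ intros z Hz. set (M0 := exp ((1 + eta) * L)) in *.
  assert (G : Cmod (A O z - A O z0)%C <= M0 / (R / 2) * Cmod (z - z0)%C).
  { apply (mean_value_ball (A O) z0 (R / 2)); try lra.
    - apply (holo_ball_sub _ z0 R); auto. rewrite Cmod_self. lra.
    - intros w Hw. apply cauchy_estimate; [lra| |].
      + apply (holo_ball_sub _ z0 R); auto. lra.
      + intros w' Hw'. apply HAb. apply (in_ball_trans w' z0 w _ (R / 2)); auto. lra.
    - rewrite Cmod_self. lra. }
  assert (G2 : M0 / (R / 2) * Cmod (z - z0)%C <= M0 / (R / 2) * d).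
  { apply Rmult_le_compat_l; [|lra]. apply Rlt_le, Rdiv_lt_0_compat; [apply exp_pos|lra]. }
  assert (G3 : M0 / (R / 2) * d = exp L / 2).
  { unfold d. replace (M0 / (R / 2) * (R * q / 4)) with (M0 * q / 2) by (field; lra).
    unfold M0, q. rewrite <- exp_plus. do 2 f_equal. ring. }
  assert (G4 := Cmod_triangle_rev (A O z0) (A O z)). rewrite Cmod_sub_sym in G4. rewrite HA0 in G4.
  assert (G5 := Cmod_triangle_rev (A O z0) (A O z0 - A O z)%C).
  replace (A O z0 - (A O z0 - A O z))%C with (A O z) in G5 by ring. rewrite HA0, (Cmod_sub_sym (A O z0)) in G5. lra. }
assert (Hc := ode_contraction f A k z0 d rho (exp L / 2) (exp (theta * L)) (exp N) Hk (conj Hrho Hrho1)).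
assert (Hpos : 0 < exp L / 2) by (assert (G := exp_pos L); lra).
specialize (Hc Hpos).
assert (HB : 1 <= exp (theta * L)). { rewrite <- exp_0. apply exp_le. now apply Rmult_le_pos. }
specialize (Hc HB).
assert (Hcond : INR k * exp (theta * L) * exp 1 <= exp L / 2 * rho ^ k).
{ unfold rho. rewrite exp_pow.
  replace (INR k * - E) with (- ((1 - theta) * L) + ln (2 * INR k) + 1) by (unfold E; field; lra).
  rewrite !exp_plus, exp_ln by lra. right.
  replace (exp L / 2 * (exp (- ((1 - theta) * L)) * (2 * INR k) * exp 1)) with (INR k * (exp L * exp (- ((1 - theta) * L))) * exp 1) by field.
  rewrite <- exp_plus. do 3 f_equal. ring. }
specialize (Hc Hcond).
assert (HdR' : forall z, Cmod (z - z0)%C < d -> Cmod (z - z0)%C < R) by (intros; lra).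
specialize (Hc ltac:(apply (holo_ball_sub f z0 R); auto; rewrite Cmod_self; lra)).
specialize (Hc ltac:(auto) HA0low ltac:(auto) ltac:(auto)).
destruct (nat_floor (d / (2 * INR k * rho))) as [i [Hi1 Hi2]].
{ apply Rdiv_le_0_compat; [lra|]. repeat apply Rmult_lt_0_compat; lra. }
exists i. split.
- assert (Er : exp E = / rho). { unfold rho. rewrite exp_Ropp, Rinv_inv. reflexivity. }
  rewrite Er. unfold d in Hi2. 
  replace (R * q / (8 * INR k) * / rho) with (R * q / 4 / (2 * INR k * rho)) by (field; lra). lra.
- intros z Hz. unfold Rminus. rewrite exp_plus. apply Hc.
  assert (INR i * (INR k * rho) <= d / 2).
  { apply Rmult_le_compat_r with (r := INR k * rho) in Hi1; [|nra].
    replace (d / 2) with (d / (2 * INR k * rho) * (INR k * rho)) by (field; lra). exact Hi1. }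
  unfold d in *. lra.
Qed.

(** * Transporting smallness to a fixed point *)

Lemma ln_le x y : 0 < x -> x <= y -> ln x <= ln y.
Proof. intros Hx [H| ->]; [left; now apply ln_increasing|lra]. Qed.

Lemma analytic_holo D f z : analytic_on D f -> D z -> exists l, cderiv f z l.
Proof. intros H Hz. apply ex_derive_cderiv. now apply H. Qed.

(** In the coordinate [w = log z] the disc around [z0] contains the image of one
of radius proportional to [e], independent of [|z0|], and [z0] is at distance [O(ln (1 / |z0|))] from the fixed point
[p0]. The doublings cost a factor [e^(-3)], because [8 = 2^3], and the moves
a power of [1 / |z0|]. *)
Lemma smallness_to_point (rho : R) (f : C -> C) (p0 : C) : analytic_on (punctured_disc rho) f ->
  punctured_disc rho p0 -> f p0 <> 0%C ->
  exists r2 K P, Cmod p0 < r2 < rho /\ 0 < K /\ 0 <= P /\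
  forall z0 e N Y, 0 < Cmod z0 <= Cmod p0 -> 0 < e <= 1 -> 0 <= N ->
    (forall z, exp (ln (Cmod z0) - 1) < Cmod z < r2 -> Cmod (f z) <= exp N) ->
    (forall z, Cmod (z - z0)%C < Cmod z0 * e -> Cmod (f z) <= exp (N - Y)) ->
    Y <= K * exp (- P * ln (Cmod z0)) * (/ e) ^ 3 * (N + 1).
Proof.
intros Hf [Hp0 Hp1] Hfp.
set (r2 := (Cmod p0 + rho) / 2).
destruct (cexp_little_o 1 Rlt_0_1) as [hs [Hhs Hexp]].
assert (Hlnp : ln (Cmod p0) < ln r2) by (apply ln_increasing; unfold r2; lra).
(* Discs of radius 5 vr around points of the segment must stay in the strip from ln |z0| - 1 to ln r2; below hs the increment of the exponential is at most twice that of its argument. *)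
set (vr := Rmin (/ 5) (Rmin hs ((ln r2 - ln (Cmod p0)) / 5))).
assert (V1 : vr <= / 5) by apply Rmin_l.
assert (V2 : vr <= hs) by (eapply Rle_trans; [apply Rmin_r|apply Rmin_l]).
assert (V3 : vr <= (ln r2 - ln (Cmod p0)) / 5) by (eapply Rle_trans; [apply Rmin_r|apply Rmin_r]).
assert (V0 : 0 < vr) by (unfold vr; repeat apply Rmin_glb_lt; lra). clearbody vr.
set (c2 := 3 * ((Rabs (ln (Cmod p0)) + 2 * PI) / vr + 1)).
set (cp := 6 + Rabs (ln (Cmod (f p0)))).
assert (Hcp : 6 <= cp) by (unfold cp; assert (G := Rabs_pos (ln (Cmod (f p0)))); lra).
exists r2, (64 * exp c2 * cp), (3 / vr).
assert (Hpi := PI_RGT_0).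
split; [unfold r2; lra|]. split. { repeat apply Rmult_lt_0_compat; try lra. apply exp_pos. }
split. { apply Rdiv_le_0_compat; lra. }
intros z0 e N Y Hz0 He HN HM HY.
assert (Hz0n : z0 <> 0%C) by (apply Cmod_gt_0; lra).
assert (Hp0n : p0 <> 0%C) by (apply Cmod_gt_0; lra).
destruct (polar_form z0 Hz0n) as [th0 [Hth0 E0]].
destruct (polar_form p0 Hp0n) as [thp [Hthp Ep]].
set (w0 := (ln (Cmod z0), th0) : C) in *. set (wp := (ln (Cmod p0), thp) : C) in *.
destruct (pow2_between (1 + 2 * vr / e)) as [n1 [Hn1 Hn1']].
{ assert (0 <= 2 * vr / e) by (apply Rdiv_le_0_compat; lra). lra. }
set (T := ln (Cmod p0) - ln (Cmod z0) + 2 * PI).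
assert (Hlz : ln (Cmod z0) <= ln (Cmod p0)) by (apply ln_le; lra).
destruct (nat_floor (T / vr)) as [n2 [Hn2 Hn2']]. { apply Rdiv_le_0_compat; unfold T; lra. }
assert (Hfw : forall z, ln (Cmod z0) - 1 < fst z < ln r2 -> exp (ln (Cmod z0) - 1) < Cmod (cexp z) < r2).
{ intros z Hz. rewrite Cmod_cexp. rewrite <- (exp_ln r2) by (unfold r2; lra). split; apply exp_increasing; lra. }
assert (B := smallness_propagation (fun w => f (cexp w)) (ln (Cmod z0) - 1) (ln r2) vr N Y w0 wp n1 (S n2) V0 HN).
cbv beta in B. rewrite <- Ep in B.
assert (B' : Cmod (f p0) <= exp (2 * (N + 3) - Y / 8 ^ (n1 + S n2))).
{ apply B; clear B.
  - intros z Hz. specialize (Hfw z Hz). destruct (analytic_holo _ f (cexp z) Hf) as [l Hl].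
    { split; [eapply Rlt_trans; [apply exp_pos|apply Hfw]|]. unfold r2 in Hfw. lra. }
    eexists. apply (cderiv_comp f cexp); [exact Hl|apply cderiv_cexp].
  - intros z Hz. apply HM. now apply Hfw.
  - unfold w0; simpl. lra.
  - unfold wp; simpl. lra.
  - rewrite S_INR. eapply Rle_trans; [apply Cmod_le_sum|]. unfold wp, w0; simpl.
    assert (Rabs (thp + - th0) <= 2 * PI) by (apply Rabs_le; lra).
    rewrite (Rabs_pos_eq (ln (Cmod p0) + - ln (Cmod z0))) by lra.
    apply Rle_trans with T; [unfold T; lra|].
    replace T with (T / vr * vr) by (field; lra). apply Rmult_le_compat_r; lra.
  - intros z Hz. apply Rle_trans with (exp (N - Y)); [|apply exp_le; lra]. apply HY.
    replace (cexp z) with (z0 * cexp (z - w0))%C.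
    2:{ rewrite E0, <- cexp_plus. f_equal. ring. }
    replace (z0 * cexp (z - w0) - z0)%C with (z0 * (cexp (z - w0) - 1))%C by ring.
    rewrite Cmod_mult. apply Rmult_lt_compat_l; [lra|].
    assert (P2 : 0 < 2 ^ n1) by (apply pow_lt; lra).
    assert (Hv : vr / 2 ^ n1 < e / 2).
    { apply Rlt_div_l; auto. assert (e / 2 * (1 + 2 * vr / e) <= e / 2 * 2 ^ n1) by (apply Rmult_le_compat_l; lra).
      assert (e / 2 * (1 + 2 * vr / e) = e / 2 + vr) by (field; lra). lra. }
    assert (Hv2 : vr / 2 ^ n1 <= vr).
    { apply Rle_div_l; auto. assert (1 <= 2 ^ n1) by (apply pow_R1_Rle; lra). nra. }
    specialize (Hexp (z - w0)%C ltac:(lra)).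
    replace (cexp (z - w0) - 1)%C with ((cexp (z - w0) - 1 - (z - w0)) + (z - w0))%C by ring.
    eapply Rle_lt_trans; [apply Cmod_triangle|]. lra. }
clear B.
assert (Hfp0 : 0 < Cmod (f p0)) by now apply Cmod_gt_0.
assert (B2 : ln (Cmod (f p0)) <= 2 * (N + 3) - Y / 8 ^ (n1 + S n2)).
{ rewrite <- (ln_exp (2 * (N + 3) - _)). now apply ln_le. }
set (Z := 8 ^ (n1 + S n2)) in *.
assert (HZ : 0 < Z) by (apply pow_lt; lra).
assert (B3 : Y <= Z * (cp * (N + 1))).
{ assert (Y / Z <= cp * (N + 1)).
  { assert (G := Rle_abs (- ln (Cmod (f p0)))). rewrite Rabs_Ropp in G. unfold cp in *.
    set (u := Rabs (ln (Cmod (f p0)))) in *. assert (0 <= u) by apply Rabs_pos. nra. }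
  replace Y with (Y / Z * Z) by (field; lra). rewrite Rmult_comm. apply Rmult_le_compat_l; lra. }
assert (HZ1 : 8 ^ n1 <= 64 * (/ e) ^ 3).
{ replace 8 with (2 ^ 3) by ring. rewrite <- pow_mult, Nat.mul_comm, pow_mult.
  apply Rle_trans with ((4 * / e) ^ 3); [|right; ring]. apply pow_incr. split; [apply pow_le; lra|].
  eapply Rle_trans; [exact Hn1'|]. apply Rmult_le_reg_r with e; [lra|].
  replace (2 * (1 + 2 * vr / e) * e) with (2 * e + 4 * vr) by (field; lra).
  replace (4 * / e * e) with 4 by (field; lra). lra. }
assert (HZ2 : 8 ^ S n2 <= exp c2 * exp (- (3 / vr) * ln (Cmod z0))).
{ apply Rle_trans with (exp 3 ^ S n2).
  - apply pow_incr. split; [lra|]. assert (G := exp_1_ge_2). replace 3 with (1 + (1 + 1)) by ring. rewrite !exp_plus.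
    assert (4 <= exp 1 * exp 1) by nra. nra.
  - rewrite exp_pow, <- exp_plus. apply exp_le. rewrite S_INR. unfold c2.
    assert (T / vr <= (Rabs (ln (Cmod p0)) + 2 * PI) / vr - ln (Cmod z0) / vr).
    { unfold Rdiv. rewrite <- Rmult_minus_distr_r. apply Rmult_le_compat_r; [left; now apply Rinv_0_lt_compat|].
      unfold T. assert (G := Rle_abs (ln (Cmod p0))). lra. }
    replace (- (3 / vr) * ln (Cmod z0)) with (3 * (- (ln (Cmod z0) / vr))) by (field; lra). lra. }
eapply Rle_trans; [exact B3|].
replace (64 * exp c2 * cp * exp (- (3 / vr) * ln (Cmod z0)) * (/ e) ^ 3 * (N + 1)) with
  ((64 * (/ e) ^ 3) * (exp c2 * exp (- (3 / vr) * ln (Cmod z0))) * (cp * (N + 1))) by ring.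
apply Rmult_le_compat_r. { apply Rmult_le_pos; lra. }
unfold Z. rewrite pow_add. apply Rmult_le_compat; auto; apply pow_le; lra.
Qed.

(** * Lower bound for the growth of a solution *)

Lemma solution_bound_near_0 (rho r2 s2 b : R) (f : C -> C) : analytic_on (punctured_disc rho) f ->
  0 < r2 < rho -> 0 < s2 ->
  (forall z, 0 < Cmod z < s2 -> Cmod (f z) <= exp (exp (exp (- b * ln (Cmod z))))) -> 0 < b ->
  exists N0, 0 <= N0 /\ forall l z, exp l < Cmod z < r2 -> Cmod (f z) <= exp (N0 + exp (exp (- b * l))).
Proof.
intros Hf Hr2 Hs2 Hb Hb0.
destruct (annulus_bounded f (Rmin (s2 / 2) r2) r2) as [M HM].
{ split; [apply Rmin_glb_lt; lra|apply Rmin_r]. }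
{ intros z Hz. apply ex_cderiv_ccont, (analytic_holo _ f z Hf). 
  assert (0 < Rmin (s2 / 2) r2) by (apply Rmin_glb_lt; lra). split; lra. }
exists (Rabs M). split; [apply Rabs_pos|]. intros l z Hz.
assert (Hz0 : 0 < Cmod z) by (eapply Rlt_trans; [apply exp_pos|apply Hz]).
destruct (Rlt_dec (Cmod z) s2) as [H|H].
- eapply Rle_trans; [apply Hb; lra|]. apply exp_le. 
  assert (G := Rabs_pos M). apply Rle_trans with (exp (exp (- b * l))); [|lra].
  do 2 apply exp_le. assert (l <= ln (Cmod z)). { rewrite <- (ln_exp l). apply ln_le; [apply exp_pos|lra]. } nra.
- eapply Rle_trans; [apply HM; split; [eapply Rle_trans; [apply Rmin_l|]; lra|lra]|].
  apply Rle_trans with (exp (Rabs M)); [|apply exp_le; assert (G := exp_pos (exp (- b * l))); lra].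
  assert (G := exp_ineq1_le (Rabs M)). assert (G' := Rle_abs M). lra.
Qed.

(** At the selected point [ode_local_smallness] makes [- ln |f|] at least of
size [exp ((ga - eta) L - lam)], where [lam = - ln |z0|] and [ga = (1 - th) / k], whereas [smallness_to_point]
bounds it by [exp (3 eta L + P lam + exp (b (1 + lam)))] up to a constant. With
[eta = ga / 8] and [L] of order [exp (a lam)], [a > b], these are incompatible. *)
Lemma growth_lower (rho : R) (k : nat) (A : nat -> C -> C) (f : C -> C) (a b beta K p s1 : R) (p0 : C) :
  (1 <= k)%nat -> 0 < b < a -> 0 < beta < K -> 1 <= p -> 0 < s1 <= 1 -> s1 <= rho ->
  analytic_on (punctured_disc rho) (A O) ->
  linear_ode_solution (punctured_disc rho) k A f ->
  (forall j z, (1 <= j < k)%nat -> 0 < Cmod z < s1 -> Cmod (A j z) <= exp (beta * exp (- a * ln (Cmod z)))) ->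
  (forall s, 0 < s -> exists z, 0 < Cmod z < s /\ exp (K * exp (- a * ln (Cmod z))) <= Cmod (A O z)) ->
  (forall z, 0 < Cmod z < s1 -> Cmod (A O z) <= exp (exp (- p * ln (Cmod z)))) ->
  punctured_disc rho p0 -> f p0 <> 0%C ->
  forall s, 0 < s -> exists z, 0 < Cmod z < s /\ exp (exp (exp (- b * ln (Cmod z)))) < Cmod (f z).
Proof.
intros Hk Hb Hbeta Hp Hs1 Hs1r HA [Hf Hode] H1 H2 H3 Hp0 Hfp0 s2 Hs2.
apply NNPP. intros Hno.
assert (Hub : forall z, 0 < Cmod z < s2 -> Cmod (f z) <= exp (exp (exp (- b * ln (Cmod z))))).
{ intros z Hz. apply Rnot_lt_le. intros Hlt. apply Hno. exists z. auto. }
destruct (smallness_to_point rho f p0 Hf Hp0 Hfp0) as [r2 [Kp [P [Hr2 [HKp [HP Hprop]]]]]].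
destruct Hp0 as [Hp0 Hp0'].
destruct (solution_bound_near_0 rho r2 s2 b f Hf ltac:(lra) Hs2 Hub ltac:(lra)) as [N0 [HN0 HN]].
assert (Hk1 : 1 <= INR k). { change 1 with (INR 1). now apply le_INR. }
set (x := beta / K). 
assert (Hx : 0 < x < 1). { unfold x. split; [apply Rdiv_lt_0_compat; lra|]. apply Rlt_div_l; lra. }
(* The ratio beta / K is below 1; th lies halfway to 1 and leaves room for the loss 1 + eta. *)
set (th := (1 + x) / 2). set (ga := (1 - th) / INR k). set (eta := ga / 8).
assert (Hga : 0 < ga). { unfold ga, th. apply Rdiv_lt_0_compat; lra. }
assert (Hga1 : ga <= 1 - th). { unfold ga. apply Rle_div_l; [lra|]. unfold th. nra. }
assert (Heta : 0 < eta) by (unfold eta; lra).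
assert (Hln1 : 0 < ln (1 + eta)). { rewrite <- ln_1. apply ln_increasing; lra. }
(* Within distance nu of ln |z0| the weights change by a factor of at most 1 + eta; on the disc of radius de |z0| the logarithm of the modulus stays within nu. *)
set (nu := Rmin (/ 2) (ln (1 + eta) / (a + p + 1))).
assert (Hnu1 : nu <= / 2) by apply Rmin_l.
assert (Hnu2 : (a + p + 1) * nu <= ln (1 + eta)).
{ assert (G : nu <= ln (1 + eta) / (a + p + 1)) by apply Rmin_r.
  apply Rmult_le_compat_l with (r := a + p + 1) in G; [|lra].
  replace ((a + p + 1) * (ln (1 + eta) / (a + p + 1))) with (ln (1 + eta)) in G by (field; lra). exact G. }
assert (Hnu0 : 0 < nu). { unfold nu. apply Rmin_glb_lt; [lra|]. apply Rdiv_lt_0_compat; lra. }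
clearbody nu.
set (de := 1 - exp (- nu)).
assert (Hen : exp (- nu) < 1) by (rewrite <- exp_0; apply exp_increasing; lra).
assert (Hen0 := exp_pos (- nu)).
assert (Hde : 0 < de < 1) by (unfold de; lra).
assert (Henu : exp ((a + p + 1) * nu) <= 1 + eta). { rewrite <- (exp_ln (1 + eta)) by lra. now apply exp_le. }
set (ka := (ln (2 * INR k) + 1) / INR k).
set (C4 := 1 + Kp * (8 / de) ^ 3 * (N0 + 2)).
assert (H8 : 0 < (8 / de) ^ 3) by (apply pow_lt, Rdiv_lt_0_compat; lra).
assert (HC4 : 1 <= C4). { unfold C4. assert (0 <= Kp * (8 / de) ^ 3 * (N0 + 2)) by (apply Rmult_le_pos; [apply Rmult_le_pos|]; lra). lra. }
set (c1 := de / (8 * INR k) * exp (- ka)).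
assert (Hc1 : 0 < c1). { unfold c1. apply Rmult_lt_0_compat; [apply Rdiv_lt_0_compat; lra|apply exp_pos]. }
set (cc := ga / 2 * (K * exp (- nu))).
assert (Hcc : 0 < cc). { unfold cc. apply Rmult_lt_0_compat; [lra|]. apply Rmult_lt_0_compat; lra. }
destruct (exp_beats cc (Rabs (ln (C4 / c1)) + Rabs ka) (P + 1) b a Hcc ltac:(lra) ltac:(lra)) as [l0 [Hl0 Hbeats]].
(* Closeness to 0 puts the disc of radius |z0| around z0 in the region where all bounds hold, and makes - ln |z0| > l0. *)
set (r1 := Rmin (Rmin (s1 / 2) (Cmod p0 / 2)) (exp (- l0))).
assert (R1 : r1 <= s1 / 2) by (eapply Rle_trans; [apply Rmin_l|apply Rmin_l]).
assert (R2 : r1 <= Cmod p0 / 2) by (eapply Rle_trans; [apply Rmin_l|apply Rmin_r]).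
assert (R3 : r1 <= exp (- l0)) by apply Rmin_r.
assert (R0 : 0 < r1) by (unfold r1; repeat apply Rmin_glb_lt; try lra; apply exp_pos). clearbody r1.
destruct (select_point (A O) a p K s1 nu r1) as [z0 [L [Hz0 [HA0 [HL Hnear]]]]]; auto; try lra.
set (r := Cmod z0) in *. set (lam := - ln r).
assert (Hlam : l0 < lam).
{ unfold lam. assert (ln r < ln (exp (- l0))) by (apply ln_increasing; lra). rewrite ln_exp in H. lra. }
specialize (Hbeats lam Hlam).
replace (- a * ln r) with (a * lam) in HL by (unfold lam; ring).
assert (HgaL : cc * exp (a * lam) <= ga / 2 * L).
{ unfold cc. rewrite Rmult_assoc. apply Rmult_le_compat_l; lra. }
assert (Hebl := exp_pos (b * (1 + lam))).
assert (HPl : 0 <= P * lam) by (apply Rmult_le_pos; lra).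
assert (Hab1 := Rabs_pos (ln (C4 / c1))). assert (Hab2 := Rabs_pos ka).
assert (Hab3 := Rle_abs (ln (C4 / c1))). assert (Hab4 := Rle_abs ka).
assert (HL0 : 0 < L).
{ eapply Rlt_le_trans; [|exact HL]. repeat apply Rmult_lt_0_compat; try lra. apply exp_pos. }
assert (Hball : forall z, Cmod (z - z0)%C < de * r -> 
  0 < Cmod z < s1 /\ ln r - nu <= ln (Cmod z) /\ Rabs (ln (Cmod z) - ln r) <= nu /\ Cmod z < 2 * r).
{ intros z Hz. assert (G1 := Cmod_triangle_rev z0 z). rewrite Cmod_sub_sym in G1. fold r in G1.
  assert (G2 := Cmod_triangle_rev z z0). fold r in G2.
  assert (G3 : exp (- nu) * r < Cmod z) by (unfold de in Hz; lra).
  assert (G4 : Cmod z < (2 - exp (- nu)) * r) by (unfold de in Hz; lra).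
  assert (G5 : 2 - exp (- nu) <= exp nu). 
  { assert (Q1 := exp_ineq1_le nu). assert (Q2 := exp_ineq1_le (- nu)). 
    assert (exp nu * exp (- nu) = 1) by (rewrite <- exp_plus, Rplus_opp_r; apply exp_0). nra. }
  assert (G6 : 0 < exp (- nu) * r) by (apply Rmult_lt_0_compat; lra).
  assert (L1 : ln r - nu <= ln (Cmod z)).
  { replace (ln r - nu) with (ln (exp (- nu) * r)). { apply ln_le; lra. } rewrite ln_mult, ln_exp; lra. }
  assert (L2 : ln (Cmod z) <= ln r + nu).
  { replace (ln r + nu) with (ln (exp nu * r)). { apply ln_le; [lra|]. apply Rlt_le, Rlt_le_trans with (1 := G4). apply Rmult_le_compat_r; lra. }
    rewrite ln_mult, ln_exp; lra. }
  split; [|split; [exact L1|split; [apply Rabs_le; lra|]]]. { split; [lra|]. nra. } nra. }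
set (N := N0 + exp (exp (b * (1 + lam)))).
assert (HNpos : 0 <= N) by (unfold N; assert (G := exp_pos (exp (b * (1 + lam)))); lra).
assert (HfN : forall z, exp (ln r - 1) < Cmod z < r2 -> Cmod (f z) <= exp N).
{ intros z Hz. unfold N. replace (b * (1 + lam)) with (- b * (ln r - 1)) by (unfold lam; ring). now apply HN. }
assert (Hrr : 0 < de * r) by (apply Rmult_lt_0_compat; lra).
destruct (ode_local_smallness f A k z0 (de * r) L th eta N) as [i [Hi1 Hi2]]; auto; try lra.
{ unfold th; lra. }
{ fold ka ga. assert (cc * exp (a * lam) <= ga * L) by (assert (0 < ga * L) by (now apply Rmult_lt_0_compat); lra).
  assert (0 <= (P + 1) * lam) by (apply Rmult_le_pos; lra). lra. }
{ intros z Hz. apply (analytic_holo _ f z Hf). destruct (Hball z Hz) as [G _]. split; lra. }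
{ intros z Hz. apply (analytic_holo _ (A O) z HA). destruct (Hball z Hz) as [G _]. split; lra. }
{ intros z Hz. apply Hode. destruct (Hball z Hz) as [G _]. split; lra. }
{ intros z Hz. destruct (Hball z Hz) as [G1 [_ [G2 _]]].
  eapply Rle_trans; [apply Hnear; auto|]. apply exp_le. rewrite Rmult_comm. apply Rmult_le_compat_r; lra. }
{ intros j z Hj Hz. destruct (Hball z Hz) as [G1 [G2 _]].
  eapply Rle_trans; [apply H1; auto|]. apply exp_le.
  apply Rle_trans with (beta * (exp (a * nu) * exp (a * lam))).
  - apply Rmult_le_compat_l; [lra|]. rewrite <- exp_plus. apply exp_le. unfold lam. nra.
  - apply Rle_trans with (x * (1 + eta) * L).
    + replace beta with (x * K) by (unfold x; field; lra).
      replace (x * K * (exp (a * nu) * exp (a * lam))) with (x * exp (a * nu) * exp nu * (K * exp (- nu) * exp (a * lam))).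
      2:{ transitivity (x * K * (exp (a * nu) * exp (a * lam)) * (exp nu * exp (- nu))); [ring|].
          rewrite <- (exp_plus nu), Rplus_opp_r, exp_0. ring. }
      apply Rmult_le_compat.
      * apply Rmult_le_pos; [apply Rmult_le_pos; [lra|left; apply exp_pos]|left; apply exp_pos].
      * apply Rmult_le_pos; [apply Rmult_le_pos; [lra|left; apply exp_pos]|left; apply exp_pos].
      * rewrite Rmult_assoc, <- exp_plus. apply Rmult_le_compat_l; [lra|].
        eapply Rle_trans; [|exact Henu]. apply exp_le. nra.
      * exact HL.
    + apply Rmult_le_compat_r; [lra|]. unfold th in *. unfold eta. nra. }
{ intros z Hz. destruct (Hball z Hz) as [G1 [G2 [_ G3]]]. apply HfN. split; [|lra].
  rewrite <- (exp_ln (Cmod z)) by lra. apply exp_increasing. lra. }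
set (q := exp (- (eta * L))) in *.
assert (Hq : 0 < q) by apply exp_pos.
assert (HeL : 0 < eta * L) by now apply Rmult_lt_0_compat.
assert (Hq1 : q <= 1). { unfold q. rewrite <- exp_0. apply exp_le. lra. }
assert (Hfin := Hprop z0 (de * q / 8) N (INR i)).
fold r in Hfin.
assert (Hfin' : INR i <= Kp * exp (- P * ln r) * (/ (de * q / 8)) ^ 3 * (N + 1)).
{ apply Hfin; auto; try lra.
  - split; [apply Rdiv_lt_0_compat; [now apply Rmult_lt_0_compat|lra]|]. nra.
  - intros z Hz. apply Hi2. eapply Rlt_le_trans; [exact Hz|]. right; field. }
clear Hfin. fold ga ka in Hi1.
assert (Einv : (/ (de * q / 8)) ^ 3 = (8 / de) ^ 3 * exp (3 * (eta * L))).
{ replace (/ (de * q / 8)) with (8 / de * exp (eta * L)).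
  - rewrite Rpow_mult_distr, exp_pow. do 2 f_equal. simpl. ring.
  - unfold q. rewrite exp_Ropp. field. split; [apply Rgt_not_eq, exp_pos|lra]. }
rewrite Einv in Hfin'.
replace (- P * ln r) with (P * lam) in Hfin' by (unfold lam; ring).
set (EE := exp (b * (1 + lam))) in *.
assert (Hbig1 : 1 <= exp (P * lam)) by (rewrite <- exp_0; now apply exp_le).
assert (Hbig2 : 1 <= exp (3 * (eta * L))) by (rewrite <- exp_0; apply exp_le; lra).
assert (Hbig3 : 1 <= exp EE) by (rewrite <- exp_0; apply exp_le; lra).
assert (F1 : INR i + 1 <= C4 * (exp (P * lam) * exp (3 * (eta * L)) * exp EE)).
{ set (u := exp (P * lam)) in *. set (v := exp (3 * (eta * L))) in *. set (w := exp EE) in *.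
  assert (Huv : 1 <= u * v) by nra. assert (Huvw : 1 <= u * v * w) by nra.
  assert (HNw : N + 1 <= (N0 + 2) * w) by (unfold N; nra).
  unfold C4. rewrite Rmult_plus_distr_r, Rmult_1_l.
  assert (INR i <= Kp * (8 / de) ^ 3 * (N0 + 2) * (u * v * w)); [|lra].
  eapply Rle_trans; [exact Hfin'|].
  replace (Kp * u * ((8 / de) ^ 3 * v) * (N + 1)) with (Kp * (8 / de) ^ 3 * (u * v) * (N + 1)) by ring.
  replace (Kp * (8 / de) ^ 3 * (N0 + 2) * (u * v * w)) with (Kp * (8 / de) ^ 3 * (u * v) * ((N0 + 2) * w)) by ring.
  apply Rmult_le_compat_l; [|lra]. apply Rmult_le_pos; [apply Rmult_le_pos; lra|lra]. }
assert (F2 : c1 * (exp (- lam) * exp (- (eta * L)) * exp (ga * L)) <= INR i + 1).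
{ apply Rle_trans with (de * r * q / (8 * INR k) * exp (ga * L - ka)); [|lra]. right.
  unfold Rminus. rewrite exp_plus. unfold c1, lam. rewrite Ropp_involutive, exp_ln by lra. fold q. field. lra. }
(* The two bounds for i are compared, using ga - 4 eta = ga / 2. *)
assert (F3 : exp (ga / 2 * L) <= C4 / c1 * exp ((P + 1) * lam + EE)).
{ apply Rmult_le_reg_l with c1; auto.
  replace (c1 * (C4 / c1 * exp ((P + 1) * lam + EE))) with (C4 * exp ((P + 1) * lam + EE)) by (field; lra).
  apply Rmult_le_reg_r with (exp (- lam + 3 * (eta * L))); [apply exp_pos|].
  replace (c1 * exp (ga / 2 * L) * exp (- lam + 3 * (eta * L))) with (c1 * (exp (- lam) * exp (- (eta * L)) * exp (ga * L))).
  2:{ rewrite (Rmult_assoc c1), <- !exp_plus. do 2 f_equal. unfold eta. field. }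
  replace (C4 * exp ((P + 1) * lam + EE) * exp (- lam + 3 * (eta * L))) with (C4 * (exp (P * lam) * exp (3 * (eta * L)) * exp EE)).
  2:{ rewrite (Rmult_assoc C4), <- !exp_plus. do 2 f_equal. ring. }
  lra. }
assert (HCc : 0 < C4 / c1) by (apply Rdiv_lt_0_compat; lra).
rewrite <- (exp_ln (C4 / c1)), <- exp_plus in F3 by auto.
assert (F4 : ga / 2 * L <= ln (C4 / c1) + ((P + 1) * lam + EE)).
{ rewrite <- (ln_exp (ga / 2 * L)), <- (ln_exp (_ + (_ + EE))). apply ln_le; [apply exp_pos|exact F3]. }
lra.
Qed.

(** * Orders, types and the maximum modulus *)

Lemma Rbar_glb_is_glb (E : Rbar -> Prop) : Rbar_is_glb E (Rbar_glb E).
Proof. destruct (Rbar_ex_glb E) as [l Hl]. now rewrite (Rbar_is_glb_unique E l Hl). Qed.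

Lemma LimSup_lt_eventually {T} (F : (T -> Prop) -> Prop) (HF : Filter F) (g : T -> R) (x : R) :
  Rbar_lt (LimSup F g) x -> F (fun t => g t < x).
Proof.
intros H. destruct (Rbar_glb_is_glb (fun y : Rbar => exists P : T -> Prop, F P /\
    y = Lub_Rbar (fun x : R => exists t : T, P t /\ x = g t))) as [_ Hglb].
fold (LimSup F g) in Hglb.
assert (Hex : exists P, F P /\ Rbar_lt (Lub_Rbar (fun x : R => exists t : T, P t /\ x = g t)) x).
{ apply NNPP. intros Hno. apply (Rbar_lt_not_le _ _ H). apply Hglb. intros y [P [HP ->]].
  apply Rbar_not_lt_le. intros Hlt. apply Hno. now exists P. }
destruct Hex as [P [HP Hlt]]. apply (filter_imp P); auto. intros t Ht.
assert (Hle : Rbar_le (g t) (Lub_Rbar (fun x : R => exists t : T, P t /\ x = g t))).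
{ apply Lub_Rbar_correct. now exists t. }
apply (Rbar_le_lt_trans _ _ _ Hle Hlt).
Qed.

Lemma LimSup_le_of_eventually {T} (F : (T -> Prop) -> Prop) (g : T -> R) (x : R) :
  F (fun t => g t <= x) -> Rbar_le (LimSup F g) x.
Proof.
intros H. destruct (Rbar_glb_is_glb (fun y : Rbar => exists P : T -> Prop, F P /\
    y = Lub_Rbar (fun x : R => exists t : T, P t /\ x = g t))) as [Hlb _].
fold (LimSup F g) in Hlb.
eapply Rbar_le_trans; [apply Hlb; exists (fun t => g t <= x); split; [exact H|reflexivity]|].
apply Lub_Rbar_correct. intros y [t [Ht ->]]. exact Ht.
Qed.

Lemma LimSup_nonneg {T} (F : (T -> Prop) -> Prop) (HF : ProperFilter F) (g : T -> R) :
  F (fun t => 0 <= g t) -> Rbar_le 0 (LimSup F g).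
Proof.
intros H. apply Rbar_not_lt_le. intros Hlt. apply LimSup_lt_eventually in Hlt; [|apply HF].
assert (H2 := filter_and _ _ H Hlt). destruct (filter_ex _ H2) as [t [H3 H4]]. lra.
Qed.

Lemma at_right_0 (P : R -> Prop) : at_right 0 P <-> exists d, 0 < d /\ forall r, 0 < r < d -> P r.
Proof.
split.
- intros [d Hd]. exists d. split; [apply cond_pos|]. intros r Hr. apply Hd; [|lra].
  unfold ball; simpl; unfold AbsRing_ball, abs, minus, plus, opp; simpl. rewrite Ropp_0, Rplus_0_r, Rabs_pos_eq; lra.
- intros [d [Hd H]]. exists (mkposreal d Hd). intros r Hr Hr0. apply H. split; auto.
  unfold ball in Hr; simpl in Hr; unfold AbsRing_ball, abs, minus, plus, opp in Hr; simpl in Hr.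
  rewrite Ropp_0, Rplus_0_r in Hr. apply Rabs_def2 in Hr. lra.
Qed.

Lemma max_modulus_le f r B : 0 <= B -> (forall z, Cmod z = r -> Cmod (f z) <= B) -> max_modulus f r <= B.
Proof.
intros HB H. unfold max_modulus.
assert (G : Rbar_le (Lub_Rbar (fun m : R => exists z : C, Cmod z = r /\ m = Cmod (f z))) B).
{ apply Lub_Rbar_correct. intros m [z [Hz ->]]. now apply H. }
destruct Lub_Rbar; simpl in *; try contradiction; auto.
Qed.

(** The maximum modulus is the real part of an extended supremum, which is
[0] when infinite; the circle being compact, it is finite. *)
Lemma max_modulus_ge rho f z : analytic_on (punctured_disc rho) f -> punctured_disc rho z ->
  Cmod (f z) <= max_modulus f (Cmod z).
Proof.
intros Hf [Hz1 Hz2]. set (r := Cmod z) in *.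
destruct (annulus_bounded f r r) as [M HM]; [lra| |].
{ intros w Hw. apply ex_cderiv_ccont, (analytic_holo _ f w Hf). split; lra. }
unfold max_modulus. set (E := fun m : R => exists z : C, Cmod z = r /\ m = Cmod (f z)).
assert (G1 : Rbar_le (Lub_Rbar E) M). { apply Lub_Rbar_correct. intros m [w [Hw ->]]. apply HM; lra. }
assert (G2 : Rbar_le (Cmod (f z)) (Lub_Rbar E)). { apply Lub_Rbar_correct. now exists z. }
destruct (Lub_Rbar E); simpl in *; try contradiction; auto.
Qed.

Lemma log_plus_ge_0 x : 0 <= log_plus x.
Proof. apply Rmax_r. Qed.

Lemma log_plus_le x y : 0 <= y -> x <= exp y -> log_plus x <= y.
Proof.
intros Hy H. unfold log_plus. apply Rmax_lub; auto. destruct (Rlt_dec 0 x) as [Hx|Hx].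
- rewrite <- (ln_exp y). now apply ln_le.
- unfold ln. destruct (Rlt_dec 0 x); [contradiction|exact Hy].
Qed.

Lemma le_exp_of_log_plus x y : log_plus x <= y -> x <= exp y.
Proof.
intros H. destruct (Rlt_dec 0 x) as [Hx|Hx].
- rewrite <- (exp_ln x) by auto. apply exp_le. eapply Rle_trans; [apply Rmax_l|exact H].
- assert (G := exp_pos y). lra.
Qed.

Lemma neg_ln_pos r : 0 < r < 1 -> 0 < - ln r.
Proof. intros H. assert (ln r < ln 1) by (apply ln_increasing; lra). rewrite ln_1 in H0. lra. Qed.

Lemma order0_nonneg g : Rbar_le 0 (order0 g).
Proof.
apply LimSup_nonneg; [apply at_right_proper_filter|]. apply at_right_0. exists 1. split; [lra|].
intros r Hr. apply Rdiv_le_0_compat; [apply log_plus_ge_0|now apply neg_ln_pos].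
Qed.

Lemma hyper_order0_nonneg g : Rbar_le 0 (hyper_order0 g).
Proof.
apply LimSup_nonneg; [apply at_right_proper_filter|]. apply at_right_0. exists 1. split; [lra|].
intros r Hr. apply Rdiv_le_0_compat; [apply log_plus_ge_0|now apply neg_ln_pos].
Qed.

Lemma type0_nonneg g : Rbar_le 0 (type0 g).
Proof.
apply LimSup_nonneg; [apply at_right_proper_filter|]. apply at_right_0. exists 1. split; [lra|].
intros r Hr. apply Rmult_le_pos; [left; apply exp_pos|apply log_plus_ge_0].
Qed.

Lemma order0_lt rho g c : 0 < rho -> analytic_on (punctured_disc rho) g -> 0 <= c -> Rbar_lt (order0 g) c ->
  exists s, 0 < s /\ forall z, 0 < Cmod z < s -> Cmod (g z) <= exp (exp (- c * ln (Cmod z))).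
Proof.
intros Hrho Hg Hc H. apply LimSup_lt_eventually in H; [|apply at_right_proper_filter].
apply at_right_0 in H. destruct H as [d [Hd H]].
exists (Rmin d (Rmin 1 rho)). split; [repeat apply Rmin_glb_lt; lra|]. intros z [Hz1 Hz2].
assert (B1 := Rlt_le_trans _ _ _ Hz2 (Rmin_l _ _)). assert (B0 := Rlt_le_trans _ _ _ Hz2 (Rmin_r _ _)).
assert (B2 := Rlt_le_trans _ _ _ B0 (Rmin_l _ _)). assert (B3 := Rlt_le_trans _ _ _ B0 (Rmin_r _ _)).
specialize (H (Cmod z) (conj Hz1 B1)). assert (Hn := neg_ln_pos (Cmod z) (conj Hz1 B2)).
apply (proj1 (Rlt_div_l _ _ _ Hn)) in H.
eapply Rle_trans; [apply (max_modulus_ge rho g z Hg); split; auto|].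
do 2 apply le_exp_of_log_plus.
assert (0 <= c * - ln (Cmod z)) by (apply Rmult_le_pos; lra). lra.
Qed.

Lemma order0_gt g c : 0 <= c -> Rbar_lt c (order0 g) ->
  forall s, 0 < s -> exists z, 0 < Cmod z < s /\ exp (exp (- c * ln (Cmod z))) < Cmod (g z).
Proof.
intros Hc H s Hs. apply NNPP. intros Hno. apply (Rbar_lt_not_le _ _ H).
apply LimSup_le_of_eventually. apply at_right_0. exists (Rmin s 1). split; [apply Rmin_glb_lt; lra|].
intros r [Hr1 Hr2].
assert (B1 := Rlt_le_trans _ _ _ Hr2 (Rmin_l _ _)). assert (B2 := Rlt_le_trans _ _ _ Hr2 (Rmin_r _ _)).
assert (Hn := neg_ln_pos r (conj Hr1 B2)). apply Rle_div_l; auto.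
assert (Hcn : 0 <= c * - ln r) by (apply Rmult_le_pos; lra).
apply log_plus_le; auto. apply log_plus_le; [left; apply exp_pos|].
apply max_modulus_le; [left; apply exp_pos|]. intros z Hz. apply Rnot_lt_le. intros Hlt. apply Hno.
exists z. split; [lra|]. rewrite Hz. replace (- c * ln r) with (c * - ln r) by ring. exact Hlt.
Qed.

Lemma type0_lt rho g sigma c : 0 < rho -> analytic_on (punctured_disc rho) g -> order0 g = Finite sigma ->
  0 <= c -> Rbar_lt (type0 g) c ->
  exists s, 0 < s /\ forall z, 0 < Cmod z < s -> Cmod (g z) <= exp (c * exp (- sigma * ln (Cmod z))).
Proof.
intros Hrho Hg Hsig Hc H. apply LimSup_lt_eventually in H; [|apply at_right_proper_filter].
apply at_right_0 in H. destruct H as [d [Hd H]]. rewrite Hsig in H. simpl real in H.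
exists (Rmin d rho). split; [repeat apply Rmin_glb_lt; lra|]. intros z [Hz1 Hz2].
assert (B1 := Rlt_le_trans _ _ _ Hz2 (Rmin_l _ _)). assert (B3 := Rlt_le_trans _ _ _ Hz2 (Rmin_r _ _)).
specialize (H (Cmod z) (conj Hz1 B1)). unfold Rpower in H.
eapply Rle_trans; [apply (max_modulus_ge rho g z Hg); split; auto|].
assert (He := exp_pos (sigma * ln (Cmod z))).
apply le_exp_of_log_plus. apply Rmult_le_reg_l with (exp (sigma * ln (Cmod z))); auto.
replace (exp (sigma * ln (Cmod z)) * (c * exp (- sigma * ln (Cmod z)))) with (c * (exp (sigma * ln (Cmod z)) * exp (- sigma * ln (Cmod z)))) by ring.
rewrite <- exp_plus. replace (sigma * ln (Cmod z) + - sigma * ln (Cmod z)) with 0 by ring. rewrite exp_0. lra.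
Qed.

Lemma type0_gt g sigma c : order0 g = Finite sigma -> 0 <= c -> Rbar_lt c (type0 g) ->
  forall s, 0 < s -> exists z, 0 < Cmod z < s /\ exp (c * exp (- sigma * ln (Cmod z))) < Cmod (g z).
Proof.
intros Hsig Hc H s Hs. apply NNPP. intros Hno. apply (Rbar_lt_not_le _ _ H).
apply LimSup_le_of_eventually. apply at_right_0. exists s. split; auto.
intros r Hr. rewrite Hsig. simpl real. unfold Rpower.
assert (He := exp_pos (- sigma * ln r)).
apply Rmult_le_reg_r with (exp (- sigma * ln r)); auto.
replace (exp (sigma * ln r) * log_plus (max_modulus g r) * exp (- sigma * ln r)) with (log_plus (max_modulus g r) * (exp (sigma * ln r) * exp (- sigma * ln r))) by ring.
rewrite <- exp_plus. replace (sigma * ln r + - sigma * ln r) with 0 by ring. rewrite exp_0, Rmult_1_r.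
apply log_plus_le. { apply Rmult_le_pos; lra. }
apply max_modulus_le; [left; apply exp_pos|]. intros z Hz. apply Rnot_lt_le. intros Hlt. apply Hno.
exists z. split; [lra|]. rewrite Hz. exact Hlt.
Qed.

Lemma hyper_order0_le f c s : 0 <= c -> 0 < s ->
  (forall z, 0 < Cmod z < s -> Cmod (f z) <= exp (exp (exp (- c * ln (Cmod z))))) -> Rbar_le (hyper_order0 f) c.
Proof.
intros Hc Hs H. apply LimSup_le_of_eventually. apply at_right_0. exists (Rmin s 1). split; [apply Rmin_glb_lt; lra|].
intros r [Hr1 Hr2].
assert (B1 := Rlt_le_trans _ _ _ Hr2 (Rmin_l _ _)). assert (B2 := Rlt_le_trans _ _ _ Hr2 (Rmin_r _ _)).
assert (Hn := neg_ln_pos r (conj Hr1 B2)). apply Rle_div_l; auto.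
assert (Hcn : 0 <= c * - ln r) by (apply Rmult_le_pos; lra).
apply log_plus_le; auto. apply log_plus_le; [left; apply exp_pos|]. apply log_plus_le; [left; apply exp_pos|].
apply max_modulus_le; [left; apply exp_pos|]. intros z Hz.
replace (c * - ln r) with (- c * ln (Cmod z)) by (rewrite Hz; ring). apply H. lra.
Qed.

Lemma hyper_order0_ge rho f b : 0 < rho -> analytic_on (punctured_disc rho) f -> 0 <= b ->
  (forall s, 0 < s -> exists z, 0 < Cmod z < s /\ exp (exp (exp (- b * ln (Cmod z)))) < Cmod (f z)) ->
  Rbar_le b (hyper_order0 f).
Proof.
intros Hrho Hf Hb H. apply Rbar_not_lt_le. intros Hlt.
apply LimSup_lt_eventually in Hlt; [|apply at_right_proper_filter].
apply at_right_0 in Hlt. destruct Hlt as [d [Hd Hlt]].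
destruct (H (Rmin d (Rmin 1 rho))) as [z [[Hz1 Hz2] Hz]]; [repeat apply Rmin_glb_lt; lra|].
assert (B1 := Rlt_le_trans _ _ _ Hz2 (Rmin_l _ _)). assert (B0 := Rlt_le_trans _ _ _ Hz2 (Rmin_r _ _)).
assert (B2 := Rlt_le_trans _ _ _ B0 (Rmin_l _ _)). assert (B3 := Rlt_le_trans _ _ _ B0 (Rmin_r _ _)).
specialize (Hlt (Cmod z) (conj Hz1 B1)). assert (Hn := neg_ln_pos (Cmod z) (conj Hz1 B2)).
apply (proj1 (Rlt_div_l _ _ _ Hn)) in Hlt.
apply (Rlt_not_le _ _ Hz).
eapply Rle_trans; [apply (max_modulus_ge rho f z Hf); split; auto|].
do 3 apply le_exp_of_log_plus.
assert (0 <= b * - ln (Cmod z)) by (apply Rmult_le_pos; lra). lra.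
Qed.

Lemma uniform_radius (n : nat) (P : nat -> C -> Prop) (Q : nat -> Prop) :
  (forall j, (j < n)%nat -> Q j -> exists s, 0 < s /\ forall z, 0 < Cmod z < s -> P j z) ->
  exists s, 0 < s /\ forall j z, (j < n)%nat -> Q j -> 0 < Cmod z < s -> P j z.
Proof.
induction n; intros H.
- exists 1. split; [lra|]. intros; lia.
- destruct IHn as [s [Hs IH]]. { intros; apply H; auto. }
  destruct (classic (Q n)) as [Hq|Hq].
  + destruct (H n) as [s' [Hs' H']]; auto. exists (Rmin s s'). split; [now apply Rmin_glb_lt|].
    intros j z Hj HQ [Hz1 Hz2]. 
    assert (B1 := Rlt_le_trans _ _ _ Hz2 (Rmin_l _ _)). assert (B2 := Rlt_le_trans _ _ _ Hz2 (Rmin_r _ _)).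
    destruct (Nat.eq_dec j n) as [->|]; [now apply H'|]. apply IH; auto. lia.
  + exists s. split; auto. intros j z Hj HQ Hz. apply IH; auto. 
    assert (j <> n) by (intros ->; contradiction). lia.
Qed.

Lemma Rbar_real_between (x y : Rbar) : Rbar_lt x y -> exists r : R, Rbar_lt x r /\ Rbar_lt r y.
Proof.
destruct x as [x| |], y as [y| |]; simpl; intros H; try contradiction.
- exists ((x + y) / 2); simpl; lra.
- exists (x + 1); simpl; lra.
- exists (y - 1); simpl; lra.
- exists 0; simpl; auto.
Qed.

Lemma uniform_gap (n : nat) (t : nat -> Rbar) (Q : nat -> Prop) (b0 : R) (y : Rbar) : Rbar_lt b0 y ->
  (forall j, (j < n)%nat -> Q j -> Rbar_lt (t j) y) ->
  exists b : R, b0 <= b /\ Rbar_lt b y /\ forall j, (j < n)%nat -> Q j -> Rbar_lt (t j) b.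
Proof.
intros H0. induction n; intros H.
- exists b0. split; [lra|]. split; auto. intros; lia.
- destruct IHn as [b [Hb [Hby IH]]]. { intros; apply H; auto. }
  destruct (classic (Q n)) as [Hq|Hq].
  + destruct (Rbar_real_between _ _ (H n (Nat.lt_succ_diag_r n) Hq)) as [c [Hc1 Hc2]].
    exists (Rmax b c). split; [eapply Rle_trans; [exact Hb|apply Rmax_l]|]. split.
    * unfold Rmax. destruct Rle_dec; auto.
    * intros j Hj HQ. destruct (Nat.eq_dec j n) as [->|].
      -- eapply Rbar_lt_le_trans; [exact Hc1|]. apply Rmax_r.
      -- eapply Rbar_lt_le_trans; [apply IH; auto; lia|]. apply Rmax_l.
  + exists b. split; auto. split; auto. intros j Hj HQ. apply IH; auto.
    assert (j <> n) by (intros ->; contradiction). lia.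
Qed.

(** * Upper bound for the growth of a solution *)

(** The function [E t * exp (La * t)] is nondecreasing. *)
Lemma gronwall_backward (E dE : R -> R) (r r0 La : R) : r <= r0 ->
  (forall t, r <= t <= r0 -> is_derive E t (dE t) /\ - La * E t <= dE t) ->
  E r * exp (La * r) <= E r0 * exp (La * r0).
Proof.
intros Hr H. set (h := fun t => E t * exp (La * t)). set (dh := fun t => (dE t + La * E t) * exp (La * t)).
assert (Hd : forall t, r <= t <= r0 -> is_derive h t (dh t)).
{ intros t Ht. destruct (H t Ht) as [H1 _]. apply is_derive_Reals. apply is_derive_Reals in H1.
  replace (dh t) with (dE t * exp (La * t) + E t * (exp (La * t) * La)) by (unfold dh; ring).
  apply (derivable_pt_lim_mult E (fun t => exp (La * t))); auto.
  apply (derivable_pt_lim_comp (fun t => La * t) exp); [|apply derivable_pt_lim_exp].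
  assert (Q := derivable_pt_lim_scal (fun t => t) La t 1 (derivable_pt_lim_id t)).
  rewrite Rmult_1_r in Q. exact Q. }
destruct (MVT_gen h r r0 dh) as [c [Hc Heq]].
{ rewrite Rmin_left, Rmax_right by lra. intros x Hx. apply Hd; lra. }
{ rewrite Rmin_left, Rmax_right by lra. intros x Hx. apply continuity_pt_filterlim.
  apply (@ex_derive_continuous R_AbsRing R_NormedModule). exists (dh x). apply Hd; lra. }
rewrite Rmin_left, Rmax_right in Hc by lra. destruct (H c Hc) as [_ H2].
assert (0 <= dh c). { unfold dh. apply Rmult_le_pos; [lra|left; apply exp_pos]. }
assert (0 <= dh c * (r0 - r)) by (apply Rmult_le_pos; lra). unfold h in Heq. lra.
Qed.

Lemma sum_n_R_lower (a : nat -> R) (n : nat) (c : R) : (forall j, (j <= n)%nat -> c <= a j) ->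
  (INR n + 1) * c <= sum_n a n.
Proof.
induction n; intros H.
- rewrite sum_O. simpl. specialize (H O (Nat.le_refl _)). lra.
- rewrite sum_Sn, S_INR. unfold plus; simpl. specialize (H (S n) (Nat.le_refl _)) as HS.
  assert ((INR n + 1) * c <= sum_n a n) by (apply IHn; intros; apply H; lia). lra.
Qed.

Lemma sum_n_R_upper (a : nat -> R) (n : nat) (c : R) : (forall j, (j <= n)%nat -> a j <= c) ->
  sum_n a n <= (INR n + 1) * c.
Proof.
induction n; intros H.
- rewrite sum_O. simpl. specialize (H O (Nat.le_refl _)). lra.
- rewrite sum_Sn, S_INR. unfold plus; simpl. specialize (H (S n) (Nat.le_refl _)) as HS.
  assert (sum_n a n <= (INR n + 1) * c) by (apply IHn; intros; apply H; lia). lra.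
Qed.

Lemma sum_n_R_term (a : nat -> R) (n j : nat) : (forall i, (i <= n)%nat -> 0 <= a i) -> (j <= n)%nat ->
  a j <= sum_n a n.
Proof.
induction n; intros H Hj.
- replace j with O by lia. rewrite sum_O. lra.
- rewrite sum_Sn. unfold plus; simpl.
  assert (0 <= sum_n a n).
  { assert (G := sum_n_R_lower a n 0 ltac:(intros; apply H; lia)). lra. }
  destruct (Nat.eq_dec j (S n)) as [->|].
  + lra.
  + assert (a j <= sum_n a n) by (apply IHn; [intros; apply H; lia|lia]). specialize (H (S n) (Nat.le_refl _)). lra.
Qed.

Definition sqmod (c : C) : R := fst c * fst c + snd c * snd c.

Lemma sqmod_Cmod c : sqmod c = Cmod c * Cmod c.
Proof. replace (Cmod c * Cmod c) with (Cmod c ^ 2) by ring. rewrite Cmod2_alt. unfold sqmod, Re, Im. ring. Qed.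

Lemma sqmod_derive (g : R -> C) (t : R) (l : C) : curve_deriv g t l ->
  is_derive (fun s => sqmod (g s)) t (2 * (fst (g t) * fst l + snd (g t) * snd l)).
Proof.
intros H. destruct (curve_deriv_components g t l H) as [H1 H2]. apply is_derive_Reals in H1, H2. apply is_derive_Reals.
replace (2 * (fst (g t) * fst l + snd (g t) * snd l)) with ((fst l * fst (g t) + fst (g t) * fst l) + (snd l * snd (g t) + snd (g t) * snd l)) by ring.
apply (derivable_pt_lim_plus (fun s => fst (g s) * fst (g s)) (fun s => snd (g s) * snd (g s))).
- apply (derivable_pt_lim_mult (fun s => fst (g s)) (fun s => fst (g s))); auto.
- apply (derivable_pt_lim_mult (fun s => snd (g s)) (fun s => snd (g s))); auto.
Qed.

Lemma real_dot_lower (g l : C) : - (Cmod g * Cmod l) <= fst g * fst l + snd g * snd l.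
Proof.
replace (fst g * fst l + snd g * snd l) with (fst (Cconj g * l)%C) by (simpl; ring).
assert (H := fst_le_Cmod (Cconj g * l)%C). rewrite Cmod_mult, Cmod_conj in H. apply Rabs_le_between in H. lra.
Qed.

Lemma analytic_derive_n rho f n z : analytic_on (punctured_disc rho) f -> punctured_disc rho z ->
  exists l, cderiv (C_derive_n f n) z l.
Proof.
intros Hf [Hz1 Hz2]. set (s := Rmin (Cmod z) (rho - Cmod z)).
assert (S1 : s <= Cmod z) by apply Rmin_l. assert (S2 : s <= rho - Cmod z) by apply Rmin_r.
assert (Hs : 0 < s) by (apply Rmin_glb_lt; lra).
apply (C_derive_n_holo f z s n); [|rewrite Cmod_self; auto].
intros w Hw. apply (analytic_holo _ f w Hf). assert (G1 := Cmod_triangle_rev z w). rewrite Cmod_sub_sym in G1.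
assert (G2 := Cmod_triangle_rev w z). split; lra.
Qed.

(** On the ray through [z], each term of the derivative of
[En = sum_j |f^(j)|^2] is at least [- 2 |f^(j)| |f^(j + 1)|]. Here [|f^(j)|^2 <= En] for
[j < k], and the equation gives [|f^(k)| <= k B sqrt En], so [En' >= - 2 k^2 B En]. *)
Lemma ray_energy (rho : R) (k : nat) (A : nat -> C -> C) (f : C -> C) (z : C) (r0 B M : R) :
  (1 <= k)%nat -> linear_ode_solution (punctured_disc rho) k A f ->
  0 < Cmod z <= r0 -> r0 < rho -> r0 <= 1 -> 1 <= B ->
  (forall j w, (j < k)%nat -> Cmod z <= Cmod w <= r0 -> Cmod (A j w) <= B) ->
  (forall j w, (j < k)%nat -> Cmod w = r0 -> Cmod (C_derive_n f j w) <= M) ->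
  Cmod (f z) * Cmod (f z) <= INR k * (M * M) * exp (2 * INR k * INR k * B).
Proof.
intros Hk [Hf Hode] Hz Hr0 Hr1 HB HA HM.
assert (Hk1 : 1 <= INR k). { change 1 with (INR 1). now apply le_INR. }
set (r := Cmod z) in *.
assert (Hrc : RtoC r <> 0%C) by (apply Cmod_gt_0; rewrite Cmod_R, Rabs_pos_eq; lra).
set (u := (z * / RtoC r)%C).
assert (Hu : Cmod u = 1). { unfold u. rewrite Cmod_mult, Cmod_inv, Cmod_R, Rabs_pos_eq by (auto; lra). fold r. field. lra. }
set (pt := fun t : R => (0 + RtoC t * u)%C).
assert (Hpt : forall t, 0 <= t -> Cmod (pt t) = t).
{ intros t Ht. unfold pt. rewrite Cplus_0_l, Cmod_mult, Hu, Cmod_R, Rabs_pos_eq; lra. }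
set (g := fun j t => C_derive_n f j (pt t)).
set (En := fun t => sum_n (fun j => sqmod (g j t)) (k - 1)).
set (dEn := fun t => sum_n (fun j => 2 * (fst (g j t) * fst (u * g (S j) t)%C + snd (g j t) * snd (u * g (S j) t)%C)) (k - 1)).
assert (Hk' : INR (k - 1) + 1 = INR k) by (rewrite minus_INR by auto; simpl; lra).
assert (Hnn : forall c, 0 <= sqmod c) by (intros c; rewrite sqmod_Cmod; assert (G := Cmod_ge_0 c); nra).
assert (Hgr : En r * exp (2 * INR k * INR k * B * r) <= En r0 * exp (2 * INR k * INR k * B * r0)).
{ apply (gronwall_backward En dEn); [lra|]. intros t Ht.
  assert (Hin : punctured_disc rho (pt t)). { split; rewrite Hpt; lra. }
  split.
  - unfold En, dEn. apply (is_derive_sum_n (fun j s => sqmod (g j s))). intros j _.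
    apply (sqmod_derive (g j)). unfold g, pt. apply curve_deriv_line.
    change (C_derive_n f (S j)) with (C_derive (C_derive_n f j)). apply C_derive_correct_at.
    apply (analytic_derive_n rho); auto.
  - set (S0 := sqrt (En t)).
    assert (HE0 : 0 <= En t). { assert (G := sum_n_R_lower (fun j => sqmod (g j t)) (k - 1) 0 ltac:(intros; apply Hnn)). unfold En. lra. }
    assert (HS0 : 0 <= S0) by apply sqrt_pos. assert (HS2 : S0 * S0 = En t) by now apply sqrt_sqrt.
    assert (Hgj : forall j, (j < k)%nat -> Cmod (g j t) <= S0).
    { intros j Hj. apply Rsqr_incr_0; auto using Cmod_ge_0. unfold Rsqr. rewrite HS2, <- sqmod_Cmod.
      apply (sum_n_R_term (fun j => sqmod (g j t))); [intros; apply Hnn|lia]. }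
    assert (Hgk : Cmod (g k t) <= INR k * B * S0).
    { specialize (Hode (pt t) Hin). 
      assert (T := sum_n_tail_bound (fun j => A j (pt t) * C_derive_n f j (pt t))%C (k - 1) (B * S0)).
      assert (Hterm : forall j, (j < k)%nat -> Cmod (A j (pt t) * C_derive_n f j (pt t))%C <= B * S0).
      { intros j Hj. rewrite Cmod_mult. apply Rmult_le_compat; try apply Cmod_ge_0.
        - apply HA; auto. rewrite Hpt; lra. - apply (Hgj j Hj). }
      assert (T' := T ltac:(intros j Hj; apply Hterm; lia)). cbv beta in T'.
      set (sm := @sum_n C_AbelianGroup (fun j => (A j (pt t) * C_derive_n f j (pt t))%C) (k - 1)) in *.
      assert (T0 := Hterm O ltac:(lia)). set (a0 := (A O (pt t) * C_derive_n f 0 (pt t))%C) in *.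
      unfold g. replace (C_derive_n f k (pt t)) with (- ((sm - a0) + a0) + (C_derive_n f k (pt t) + sm))%C by ring.
      rewrite Hode, Cplus_0_r, Cmod_opp. eapply Rle_trans; [apply Cmod_triangle|]. 
      replace (INR k * B * S0) with (INR (k - 1) * (B * S0) + B * S0) by (rewrite <- Hk'; ring). lra. }
    assert (Hgj1 : forall j, (j <= k)%nat -> Cmod (g j t) <= INR k * B * S0).
    { intros j Hj. destruct (Nat.eq_dec j k) as [->|]; auto. eapply Rle_trans; [apply Hgj; lia|].
      assert (1 <= INR k * B) by nra. nra. }
    replace (- (2 * INR k * INR k * B) * En t) with ((INR (k - 1) + 1) * (- (2 * (INR k * B * En t)))) by (rewrite Hk'; ring).
    apply sum_n_R_lower. intros j Hj. 
    assert (D := real_dot_lower (g j t) (u * g (S j) t)%C). rewrite Cmod_mult, Hu, Rmult_1_l in D.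
    assert (Cmod (g j t) * Cmod (g (S j) t) <= S0 * (INR k * B * S0)).
    { apply Rmult_le_compat; try apply Cmod_ge_0. { apply Hgj; lia. } apply Hgj1; lia. }
    replace (S0 * (INR k * B * S0)) with (INR k * B * En t) in H by (rewrite <- HS2; ring). lra. }
set (La := 2 * INR k * INR k * B) in *.
assert (HLa : 0 <= La). { unfold La. repeat apply Rmult_le_pos; lra. }
assert (HE : En r0 <= INR k * (M * M)).
{ unfold En. rewrite <- Hk'. apply sum_n_R_upper. intros j Hj. rewrite sqmod_Cmod.
  assert (Cmod (g j r0) <= M). { apply HM; [lia|]. apply Hpt; lra. } assert (G := Cmod_ge_0 (g j r0)). 
  apply Rmult_le_compat; auto. }
assert (HEr : Cmod (f z) * Cmod (f z) <= En r).
{ rewrite <- sqmod_Cmod. assert (E : f z = g O r). 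
  { unfold g. change (C_derive_n f 0) with f. f_equal. unfold pt, u. rewrite Cplus_0_l. symmetry. field. auto. }
  rewrite E. apply (sum_n_R_term (fun j => sqmod (g j r))); [intros; apply Hnn|lia]. }
assert (HM2 : 0 <= INR k * (M * M)) by (apply Rmult_le_pos; [lra|nra]).
assert (X1 : 1 <= exp (La * r)) by (rewrite <- exp_0; apply exp_le; apply Rmult_le_pos; lra).
assert (X2 : exp (La * r0) <= exp La). { apply exp_le. rewrite <- (Rmult_1_r La) at 2. apply Rmult_le_compat_l; lra. }
assert (HEpos : 0 <= Cmod (f z) * Cmod (f z)) by (assert (G := Cmod_ge_0 (f z)); nra).
apply Rle_trans with (En r * exp (La * r)); [nra|]. eapply Rle_trans; [exact Hgr|].
apply Rmult_le_compat; auto. { assert (G := sum_n_R_lower (fun j => sqmod (g j r0)) (k - 1) 0 ltac:(intros; apply Hnn)). unfold En. lra. }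
left; apply exp_pos.
Qed.

(** [ray_energy] from a fixed circle, with
[B = exp (exp (c * lam))] and [lam = - ln |z|]; passing from [c] to [c'] absorbs the
constants. *)
Lemma growth_upper (rho : R) (k : nat) (A : nat -> C -> C) (f : C -> C) (c c' s : R) :
  0 < rho -> (1 <= k)%nat -> linear_ode_solution (punctured_disc rho) k A f -> 0 < c < c' -> 0 < s ->
  (forall j z, (j < k)%nat -> 0 < Cmod z < s -> Cmod (A j z) <= exp (exp (- c * ln (Cmod z)))) ->
  exists s', 0 < s' /\ forall z, 0 < Cmod z < s' -> Cmod (f z) <= exp (exp (exp (- c' * ln (Cmod z)))).
Proof.
intros Hrho Hk Hsol Hc Hs HA.
assert (Hk1 : 1 <= INR k). { change 1 with (INR 1). now apply le_INR. }
set (r0 := Rmin (/ 2) (Rmin (rho / 2) (s / 2))).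
assert (R1 : r0 <= / 2) by apply Rmin_l.
assert (R2 : r0 <= rho / 2) by (eapply Rle_trans; [apply Rmin_r|apply Rmin_l]).
assert (R3 : r0 <= s / 2) by (eapply Rle_trans; [apply Rmin_r|apply Rmin_r]).
assert (R0 : 0 < r0) by (unfold r0; repeat apply Rmin_glb_lt; lra). clearbody r0.
assert (HM : exists M, forall j w, (j < k)%nat -> Cmod w = r0 -> Cmod (C_derive_n f j w) <= M).
{ clear HA. generalize k at 1. intros n. induction n.
  - exists 0. intros; lia.
  - destruct IHn as [M HM]. destruct (annulus_bounded (C_derive_n f n) r0 r0) as [M' HM']; [lra| |].
    { intros w Hw. apply ex_cderiv_ccont, (analytic_derive_n rho); [apply Hsol|split; lra]. }
    exists (Rmax M M'). intros j w Hj Hw. destruct (Nat.eq_dec j n) as [->|].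
    + eapply Rle_trans; [apply HM'; lra|apply Rmax_r].
    + eapply Rle_trans; [apply HM; auto; lia|apply Rmax_l]. }
destruct HM as [M HM].
set (D := 1 + INR k * (M * M) + 2 * INR k * INR k).
assert (HkM : 0 <= INR k * (M * M)) by (apply Rmult_le_pos; [lra|nra]).
assert (HD : 1 <= D) by (unfold D; nra).
destruct (exp_beats 1 (ln D) 0 c c' Rlt_0_1 ltac:(lra) ltac:(lra)) as [l0 [Hl0 Hbeats]].
exists (Rmin r0 (exp (- l0))). split. { apply Rmin_glb_lt; auto. apply exp_pos. }
intros z [Hz1 Hz2].
assert (B1 := Rlt_le_trans _ _ _ Hz2 (Rmin_l _ _)). assert (B2 := Rlt_le_trans _ _ _ Hz2 (Rmin_r _ _)).
set (lam := - ln (Cmod z)).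
assert (Hlam : l0 < lam).
{ unfold lam. assert (ln (Cmod z) < ln (exp (- l0))) by (apply ln_increasing; lra). rewrite ln_exp in H. lra. }
specialize (Hbeats lam Hlam).
set (B := exp (exp (c * lam))).
assert (HB : 1 <= B). { unfold B. rewrite <- exp_0. apply exp_le. left; apply exp_pos. }
assert (En := ray_energy rho k A f z r0 B M Hk Hsol ltac:(lra) ltac:(lra) ltac:(lra) HB).
assert (En' : Cmod (f z) * Cmod (f z) <= INR k * (M * M) * exp (2 * INR k * INR k * B)).
{ apply En; auto. intros j w Hj Hw. eapply Rle_trans; [apply HA; auto; lra|]. unfold B. do 2 apply exp_le.
  assert (ln (Cmod z) <= ln (Cmod w)) by (apply ln_le; lra). unfold lam. nra. }
replace (- c' * ln (Cmod z)) with (c' * lam) by (unfold lam; ring).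
assert (F1 : Cmod (f z) <= exp (D * B)).
{ assert (G : INR k * (M * M) <= exp (INR k * (M * M) * B)).
  { assert (G1 := exp_ineq1_le (INR k * (M * M) * B)). nra. }
  assert (G2 : INR k * (M * M) * exp (2 * INR k * INR k * B) <= exp (D * B)).
  { replace (D * B) with (B + INR k * (M * M) * B + 2 * INR k * INR k * B) by (unfold D; ring).
    rewrite exp_plus. apply Rmult_le_compat_r; [left; apply exp_pos|].
    eapply Rle_trans; [exact G|]. apply exp_le. lra. }
  assert (G3 : 1 <= exp (D * B)). { rewrite <- exp_0. apply exp_le. apply Rmult_le_pos; lra. }
  assert (G4 := Cmod_ge_0 (f z)). apply Rnot_lt_le. intros Hlt. nra. }
eapply Rle_trans; [exact F1|]. apply exp_le.
rewrite <- (exp_ln D) by lra. unfold B. rewrite <- exp_plus. apply exp_le.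
assert (exp (c * lam) <= exp (c * (1 + lam))) by (apply exp_le; lra). lra.
Qed.

(** * The hyper-order *)

Lemma power_domination (b a c : R) : 0 < c -> 0 < b < a ->
  exists s, 0 < s /\ forall x, 0 < x < s -> exp (- b * ln x) <= c * exp (- a * ln x).
Proof.
intros Hc Hb. destruct (exp_beats c 0 0 b a Hc ltac:(lra) ltac:(lra)) as [l0 [Hl0 H]].
exists (exp (- l0)). split; [apply exp_pos|]. intros x Hx.
assert (Hl : l0 < - ln x).
{ assert (G : ln x < ln (exp (- l0))) by (apply ln_increasing; lra). rewrite ln_exp in G. lra. }
specialize (H _ Hl). replace (- a * ln x) with (a * - ln x) by ring.
assert (exp (- b * ln x) <= exp (b * (1 + - ln x))) by (apply exp_le; lra). lra.
Qed.

Lemma hyper_order_upper (rho : R) (k : nat) (A : nat -> C -> C) (f : C -> C) (sigma : R) :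
  0 < rho -> (1 <= k)%nat ->
  (forall j, (j < k)%nat -> analytic_on (punctured_disc rho) (A j)) ->
  linear_ode_solution (punctured_disc rho) k A f -> 0 <= sigma ->
  (forall j, (j < k)%nat -> Rbar_le (order0 (A j)) sigma) ->
  Rbar_le (hyper_order0 f) sigma.
Proof.
intros Hrho Hk HA Hsol Hsig Hord.
apply Rbar_not_lt_le. intros Hlt. destruct (Rbar_real_between _ _ Hlt) as [c' [Hc1 Hc2]]. simpl in Hc1.
apply (Rbar_lt_not_le _ _ Hc2).
set (c := (sigma + c') / 2).
destruct (uniform_radius k (fun j z => Cmod (A j z) <= exp (exp (- c * ln (Cmod z)))) (fun _ => True)) as [s [Hs HAs]].
{ intros j Hj _. apply (order0_lt rho); auto; [unfold c; lra|]. eapply Rbar_le_lt_trans; [apply Hord; auto|]. simpl. unfold c; lra. }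
destruct (growth_upper rho k A f c c' s) as [s' [Hs' Hf]]; auto.
{ unfold c; lra. }
apply (hyper_order0_le f c' s'); auto. lra.
Qed.

(** If some [A_j] has order [sigma], then [a = sigma], and [beta < K] are chosen between the
types of those [A_j] and that of [A_0]; coefficients of smaller order satisfy
the bound for each positive [beta]. Otherwise all orders of [A_j], [j >= 1],
lie below some [a < sigma], and the order of [A_0] alone makes it dominate [exp (2 r^(-a))]. *)
Lemma growth_data (rho : R) (k : nat) (A : nat -> C -> C) (sigma b : R) :
  0 < rho -> 
  (forall j, (j < k)%nat -> analytic_on (punctured_disc rho) (A j)) ->
  order0 (A O) = Finite sigma -> 0 <= b < sigma ->
  (forall j, (1 <= j < k)%nat -> Rbar_le (order0 (A j)) sigma) ->
  (forall j, (1 <= j < k)%nat -> order0 (A j) = Finite sigma -> Rbar_lt (type0 (A j)) (type0 (A O))) ->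
  exists a beta K s, b < a /\ 0 < beta < K /\ 0 < s /\
    (forall j z, (1 <= j < k)%nat -> 0 < Cmod z < s -> Cmod (A j z) <= exp (beta * exp (- a * ln (Cmod z)))) /\
    (forall s, 0 < s -> exists z, 0 < Cmod z < s /\ exp (K * exp (- a * ln (Cmod z))) <= Cmod (A O z)).
Proof.
intros Hrho HA Hsig Hb Hord Htype.
destruct (classic (exists j, (1 <= j < k)%nat /\ order0 (A j) = Finite sigma)) as [[j0 [Hj0 Hj0s]]|Hno].
- assert (Ht0 : Rbar_lt 0 (type0 (A O))).
  { eapply Rbar_le_lt_trans; [apply type0_nonneg|]. apply Htype; eauto. }
  destruct (Rbar_real_between _ _ Ht0) as [b0 [Hb0 Hb0']]. simpl in Hb0.
  destruct (uniform_gap k (fun j => type0 (A j)) (fun j => (1 <= j)%nat /\ order0 (A j) = Finite sigma) b0 (type0 (A O))) as [beta [Hbeta [Hbeta' Hgap]]]; auto.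
  { intros j Hj [Hj1 Hj2]. apply Htype; auto. }
  destruct (Rbar_real_between _ _ Hbeta') as [K [HK HK']]. simpl in HK.
  destruct (uniform_radius k (fun j z => Cmod (A j z) <= exp (beta * exp (- sigma * ln (Cmod z)))) (fun j => (1 <= j)%nat)) as [s [Hs HAs]].
  { intros j Hj Hj1. destruct (Rbar_le_lt_or_eq_dec _ _ (Hord j (conj Hj1 Hj))) as [Hlt|Heq].
    - destruct (Rbar_real_between _ _ Hlt) as [c0 [Hc0 Hc0']]. simpl in Hc0'.
      set (c := Rmax c0 (sigma / 2)).
      assert (C1 : c0 <= c) by apply Rmax_l. assert (C2 : sigma / 2 <= c) by apply Rmax_r.
      assert (C3 : c < sigma) by (unfold c, Rmax; destruct Rle_dec; lra).
      destruct (order0_lt rho (A j) c) as [s1 [Hs1 HA1]]; auto; try lra.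
      { eapply Rbar_lt_le_trans; [exact Hc0|]. exact C1. }
      destruct (power_domination c sigma beta) as [s2 [Hs2 HA2]]; try lra.
      exists (Rmin s1 s2). split; [now apply Rmin_glb_lt|]. intros z [Hz1 Hz2].
      assert (B1 := Rlt_le_trans _ _ _ Hz2 (Rmin_l _ _)). assert (B2 := Rlt_le_trans _ _ _ Hz2 (Rmin_r _ _)).
      eapply Rle_trans; [apply HA1; lra|]. apply exp_le, HA2. lra.
    - apply (type0_lt rho); auto. lra. }
  exists sigma, beta, K, s. split; [lra|]. split; [lra|]. split; auto. split.
  + intros j z Hj Hz. apply HAs; auto; apply Hj.
  + intros s' Hs'. destruct (type0_gt (A O) sigma K Hsig ltac:(lra) HK' s' Hs') as [z [Hz1 Hz2]].
    exists z. split; auto. lra.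
- destruct (uniform_gap k (fun j => order0 (A j)) (fun j => (1 <= j)%nat) ((b + sigma) / 2) sigma) as [a [Ha [Ha' Hgap]]].
  { simpl; lra. }
  { intros j Hj Hj1. destruct (Rbar_le_lt_or_eq_dec _ _ (Hord j (conj Hj1 Hj))) as [Hlt|Heq]; auto.
    exfalso. apply Hno. eauto. }
  simpl in Ha'.
  destruct (uniform_radius k (fun j z => Cmod (A j z) <= exp (exp (- a * ln (Cmod z)))) (fun j => (1 <= j)%nat)) as [s [Hs HAs]].
  { intros j Hj Hj1. apply (order0_lt rho); auto. lra. }
  exists a, 1, 2, s. split; [lra|]. split; [lra|]. split; auto. split.
  + intros j z Hj Hz. rewrite Rmult_1_l. apply HAs; auto; apply Hj.
  + intros s' Hs'. set (a' := (a + sigma) / 2).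
    destruct (power_domination a a' (/ 2)) as [s2 [Hs2 HA2]]; [lra|unfold a'; lra|].
    destruct (order0_gt (A O) a' ltac:(unfold a'; lra)) with (s := Rmin s' s2) as [z [[Hz1 Hz2] Hz3]].
    { rewrite Hsig. simpl. unfold a'; lra. } { now apply Rmin_glb_lt. }
    assert (B1 := Rlt_le_trans _ _ _ Hz2 (Rmin_l _ _)). assert (B2 := Rlt_le_trans _ _ _ Hz2 (Rmin_r _ _)).
    exists z. split; [lra|]. apply Rlt_le, Rle_lt_trans with (2 := Hz3). apply exp_le.
    specialize (HA2 (Cmod z) (conj Hz1 B2)). lra.
Qed.

Theorem theorem3 (rho : R) (hrho : 0 < rho) (k : nat) (hk : (1 <= k)%nat)
    (A : nat -> C -> C)
    (hA : forall j : nat, (j < k)%nat -> analytic_on (punctured_disc rho) (A j))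
    (hA0 : exists z : C, punctured_disc rho z /\ A 0%nat z <> 0%C)
    (hfin : Rbar_lt (order0 (A 0%nat)) p_infty)
    (hord : forall j : nat, (1 <= j < k)%nat ->
      Rbar_lt 0 (order0 (A j)) /\ Rbar_le (order0 (A j)) (order0 (A 0%nat)))
    (htype : forall j : nat, (1 <= j < k)%nat ->
      order0 (A j) = order0 (A 0%nat) ->
      Rbar_lt (type0 (A j)) (type0 (A 0%nat)))
    (f : C -> C)
    (hf : linear_ode_solution (punctured_disc rho) k A f)
    (hf0 : exists z : C, punctured_disc rho z /\ f z <> 0%C) :
  hyper_order0 f = order0 (A 0%nat).
Proof.
assert (Hsig : exists sigma, order0 (A O) = Finite sigma /\ 0 <= sigma).
{ assert (G := order0_nonneg (A O)). destruct (order0 (A O)) as [sg| |]; simpl in *; try contradiction.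
  now exists sg. }
destruct Hsig as [sigma [Hsig Hsig0]]. rewrite Hsig in *.
apply Rbar_le_antisym.
- apply (hyper_order_upper rho k A f sigma); auto. intros j Hj.
  destruct j as [|j]; [rewrite Hsig; apply Rbar_le_refl|]. apply hord. lia.
- apply Rbar_not_lt_le. intros Hlt.
  destruct (Rbar_real_between _ _ Hlt) as [b0 [Hb0 Hb0']]. simpl in Hb0'.
  assert (Hb0pos : 0 < b0).
  { assert (G := Rbar_le_lt_trans _ _ _ (hyper_order0_nonneg f) Hb0). exact G. }
  apply (Rbar_lt_not_le _ _ Hb0).
  destruct (growth_data rho k A sigma b0) as [a [beta [K [s [Ha [Hbeta [Hs [H1 H2]]]]]]]]; auto; try lra.
  { intros j Hj. now apply hord. }
  destruct (order0_lt rho (A O) (sigma + 1)) as [s3 [Hs3 H3]]; auto; try lra.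
  { rewrite Hsig. simpl. lra. }
  destruct hf0 as [p0 [Hp0 Hfp0]].
  set (s1 := Rmin (Rmin 1 rho) (Rmin s s3)).
  assert (S1 : s1 <= 1) by (eapply Rle_trans; [apply Rmin_l|apply Rmin_l]).
  assert (S2 : s1 <= rho) by (eapply Rle_trans; [apply Rmin_l|apply Rmin_r]).
  assert (S3 : s1 <= s) by (eapply Rle_trans; [apply Rmin_r|apply Rmin_l]).
  assert (S4 : s1 <= s3) by (eapply Rle_trans; [apply Rmin_r|apply Rmin_r]).
  assert (S0 : 0 < s1) by (unfold s1; repeat apply Rmin_glb_lt; lra). clearbody s1.
  apply (hyper_order0_ge rho); [auto|apply hf|lra|].
  apply (growth_lower rho k A f a b0 beta K (sigma + 1) s1 p0); auto; try lra.
  + intros j z Hj Hz. apply H1; auto. lra.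
  + intros z Hz. apply H3. lra.
Qed.
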